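(* Let $K$ be a field, $(Q,f)$ a connected triangulation quiver, $m\colon Q_1\to\mathbb{Z}_{>0}$ an admissible $g$-invariant function, $c\colon Q_1\to K^\times$ a $g$-invariant function and $\lambda\colon Q_1^f\to K$ a function. Assume that $((Q,f),m)$ is not exceptional. Let $\Gamma=\Gamma(Q,f,m,c)$ be the Brauer graph algebra and $\Lambda=\Lambda(Q,f,m,c,\lambda)$ the triangulation algebra. Let $N=\operatorname{lcm}(m_\alpha n_\alpha)_{\alpha\in Q_1}$, and for $\alpha\in Q_1$ put $$e_\alpha=1-\bigl((m_\alpha n_\alpha)^{-1}+(m_{f(\alpha)}n_{f(\alpha)})^{-1}+(m_{f^2(\alpha)}n_{f^2(\alpha)})^{-1}\bigr),$$ and, if $f(\alpha)=\alpha$, $e'_\alpha=1-2(m_\alpha n_\alpha)^{-1}$ (the numbers $Ne_\alpha$ and $Ne'_\alpha$ are positive integers). For $t\in K$, let $I_t$ be the ideal of the path algebra $KQ$ generated by the elements - $\bar\alpha\cdot f(\bar\alpha)-c_\alpha t^{Ne_{\bar\alpha}}\omega_\alpha^{m_\alpha-1}\omega'_\alpha$ for $\alpha\in Q_1$ with $f(\bar\alpha)\neq\bar\alpha$, - $\bar\alpha^2-c_\alpha t^{Ne_{\bar\alpha}}\omega_\alpha^{m_\alpha-1}\omega'_\alpha-c_\alpha\lambda_{\bar\alpha}t^{Ne'_{\bar\alpha}}\omega_\alpha^{m_\alpha}$ for $\alpha\in Q_1$ with $f(\bar\alpha)=\bar\alpha$, - $\alpha\cdot f(\alpha)\cdot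 gf(\alpha)$ for $\alpha\in Q_1$, - $c_\alpha\omega_\alpha^{m_\alpha}-c_{\bar\alpha}\omega_{\bar\alpha}^{m_{\bar\alpha}}$ for $\alpha\in Q_1$, and let $\Lambda_t=KQ/I_t$. Then: (a) $\Lambda_0\simeq\Gamma$. (b) $\Lambda_1\simeq\Lambda$. (c) For any $t\in K^\times$, the automorphism of $KQ$ defined by sending each arrow $\alpha$ to $t^{N/(m_\alpha n_\alpha)}\alpha$ maps $I_1$ onto $I_t$, hence $\Lambda_t\simeq\Lambda$. (d) $\Gamma$ is a degeneration of $\Lambda$.
   Context: Paths are written left to right; $\widehat{KQ}$ is the complete path algebra of a finite quiver $Q=(Q_0,Q_1,s,t)$. Ribbon quiver $(Q,f)$: exactly two arrows start and two end at each vertex (a loop counts as both), $f$ a permutation of $Q_1$ with $f(\alpha)$ starting where $\alpha$ ends; $\bar\alpha$ is the other arrow starting at $s(\alpha)$; $g(\alpha)=\overline{f(\alpha)}$. Triangulation quiver: $f^3=\mathrm{id}$. $Q_1^f=\{\alpha:f(\alpha)=\alpha\}$. A function $\nu$ on $Q_1$ is $g$-invariant if $\nu_{g(\alpha)}=\nu_\alpha$. $n_\alpha=\min\{n>0:g^n(\alpha)=\alpha\}$; $\omega_\alpha=\alpha g(\alpha)\cdots g^{n_\alpha-1}(\alpha)$; $\omega'_\alpha=\alpha g(\alpha)\cdots g^{n_\alpha-2}(\alpha)$ (trivial path at $s(\alpha)$ if $n_\alpha=1$). $m$ is admissible if $m_\alpha n_\alpha\geq3$ for all $\alpha$. Triangulation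 algebra: $\Lambda(Q,f,m,c,\lambda)=\widehat{KQ}/\overline{\mathcal{J}}$ (closure of $\mathcal{J}$) with $\mathcal{J}$ generated by $\bar\alpha f(\bar\alpha)-c_\alpha\omega_\alpha^{m_\alpha-1}\omega'_\alpha$ (for $f(\bar\alpha)\neq\bar\alpha$) and $\bar\alpha^2-\lambda_{\bar\alpha}\bar\alpha^3-c_\alpha\omega_\alpha^{m_\alpha-1}\omega'_\alpha$ (for $f(\bar\alpha)=\bar\alpha$). Brauer graph algebra: $\Gamma(Q,f,m,c)=KQ/(\alpha f(\alpha),\ c_\alpha\omega_\alpha^{m_\alpha}-c_{\bar\alpha}\omega_{\bar\alpha}^{m_{\bar\alpha}})_{\alpha\in Q_1}$. Exceptional $((Q,f),m)$ (up to isomorphism): punctured monogon: vertices $1,2$, arrows $\alpha\colon1\to1$, $\beta\colon1\to2$, $\gamma\colon2\to1$, $\eta\colon2\to2$, $f=(\alpha\,\beta\,\gamma)(\eta)$, $m_\alpha=3$, $m_\beta=m_\gamma=m_\eta=1$; tetrahedron: vertices are the 2-element subsets of $\{1,2,3,4\}$, arrows the ordered pairs $(i,j)$, $i\neq j$, with $(i,j)$ starting at $\{i,j\}$, $\overline{(i,j)}=(j,i)$, $g=((1,2)(1,3)(1,4))((2,1)(2,4)(2,3))((3,1)(3,2)(3,4))((4,1)(4,3)(4,2))$ (cycle notation), each $\alpha$ ending where $g(\alpha)$ starts, $f(\alpha)=\overline{g(\alpha)}$, $m=1$ constant. Degeneration: for $d$-dimensional algebras viewed as points of the affine variety $\operatorname{alg}_d(K)$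 of unital associative algebra structures on $K^d$, with $\operatorname{GL}_d(K)$ acting by transport of structure, $\Gamma$ is a degeneration of $\Lambda$ if $\Gamma$ lies in the Zariski closure of the orbit of $\Lambda$.
   Formalization: Ne_α can be 0 (e.g. punctured monogon with m_α=4, others 1), where (a) fails; so (a) assumes all Ne_α>0, and Ne_α is only claimed to be a natural number. In (d) the Zariski closure is taken on points over infinite extension fields of K, since for finite K the closure on K-points is trivial. *)

(* Defs.v *)
(* Mathematical Components, with classical reasoning from mathcomp-classical. *)
From HB Require Import structures.
From mathcomp Require Import all_boot all_order all_algebra.
From mathcomp Require Import boolp.
From mathcomp.multinomials Require Import mpoly.

Set Implicit Arguments.
Unset Strict Implicit.
Unset Printing Implicit Defensive.

Import GRing.Theory Num.Theory.
Local Open Scope ring_scope.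

(* The library's algType excludes the zero algebra; using a ring (in which
   1 = 0 is allowed) together with a central structure map K -> A makes every
   quotient by a two-sided ideal an algebra. *)
Record assocAlg (K : fieldType) := AssocAlg {
  alg_ring :> pzRingType;
  alg_str : {rmorphism K -> alg_ring};
  alg_central : forall (a : K) (x : alg_ring), alg_str a * x = x * alg_str a
}.

Definition alg_scale (K : fieldType) (A : assocAlg K) (a : K) (x : A) : A :=
  alg_str A a * x.

Notation "a *' x" := (alg_scale a x) (at level 40, left associativity).

(* A ring morphism compatible with scalars is an algebra morphism. *)
Definition alg_iso (K : fieldType) (A B : assocAlg K) : Prop :=
  exists f : {rmorphism A -> B},
    (forall a x, f (a *' x) = a *' f x) /\ bijective f.

Record ideal (R : pzRingType) := Ideal {
  in_ideal :> R -> Prop;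
  ideal_0 : in_ideal 0;
  ideal_D : forall x y, in_ideal x -> in_ideal y -> in_ideal (x + y);
  ideal_Ml : forall a x, in_ideal x -> in_ideal (a * x);
  ideal_Mr : forall a x, in_ideal x -> in_ideal (x * a)
}.

Section GeneratedIdeal.
Variables (R : pzRingType) (S : R -> Prop).

Definition gen_ideal_pred (x : R) : Prop :=
  forall J : ideal R, (forall y, S y -> J y) -> J x.

Lemma gen_ideal_0 : gen_ideal_pred 0.
Proof. by move=> J _; apply: ideal_0. Qed.

Lemma gen_ideal_D x y :
  gen_ideal_pred x -> gen_ideal_pred y -> gen_ideal_pred (x + y).
Proof. by move=> hx hy J SJ; apply: ideal_D; [apply: hx | apply: hy]. Qed.

Lemma gen_ideal_Ml a x : gen_ideal_pred x -> gen_ideal_pred (a * x).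
Proof. by move=> hx J SJ; apply: ideal_Ml; apply: hx. Qed.

Lemma gen_ideal_Mr a x : gen_ideal_pred x -> gen_ideal_pred (x * a).
Proof. by move=> hx J SJ; apply: ideal_Mr; apply: hx. Qed.

Definition gen_ideal : ideal R :=
  Ideal gen_ideal_0 gen_ideal_D gen_ideal_Ml gen_ideal_Mr.

End GeneratedIdeal.

Section QuotientRing.
Variables (R : pzRingType) (I : ideal R).

Definition ideal_mem : {pred R} := fun x => `[< I x >].

Lemma ideal_memP x : reflect (I x) (x \in ideal_mem).
Proof. exact: asboolP. Qed.

Lemma ideal_mem_zmod : zmod_closed ideal_mem.
Proof.
split=> [|x y /ideal_memP Ix /ideal_memP Iy]; apply/ideal_memP.
  exact: ideal_0.
by apply: ideal_D => //; rewrite -mulN1r; apply: ideal_Ml.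
Qed.

HB.instance Definition _ := GRing.isZmodClosed.Build R ideal_mem ideal_mem_zmod.

Definition quot_ring := Quotient.quot ideal_mem.

HB.instance Definition _ := GRing.Zmodule.on quot_ring.

Local Open Scope quotient_scope.

Definition quot_pi (x : R) : quot_ring := \pi_(Quotient.quot ideal_mem) x.
Definition quot_repr (u : quot_ring) : R :=
  repr (u : Quotient.quot ideal_mem).

Lemma quot_reprK : cancel quot_repr quot_pi.
Proof. by move=> u; rewrite /quot_pi /quot_repr reprK. Qed.

Lemma quot_eqP x y : (quot_pi x = quot_pi y) <-> I (x - y).
Proof.
split=> [h|h].
  by apply/ideal_memP; rewrite Quotient.idealrBE; apply/eqP.
by apply/eqP; rewrite -Quotient.idealrBE; apply/ideal_memP.
Qed.

Lemma quot_reprB x : I (quot_repr (quot_pi x) - x).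
Proof. by apply/quot_eqP; rewrite quot_reprK. Qed.

Lemma quot_piD x y : quot_pi (x + y) = quot_pi x + quot_pi y.
Proof. exact: Quotient.pi_add. Qed.

Lemma quot_piB x y : quot_pi (x - y) = quot_pi x - quot_pi y.
Proof. by apply/eqP; rewrite eq_sym subr_eq -quot_piD subrK. Qed.

Definition quot_one : quot_ring := quot_pi 1.
Definition quot_mul (u v : quot_ring) : quot_ring :=
  quot_pi (quot_repr u * quot_repr v).

Lemma quot_piM x y : quot_pi (x * y) = quot_mul (quot_pi x) (quot_pi y).
Proof.
apply/esym/quot_eqP; set u := quot_repr _; set v := quot_repr _.
have -> : u * v - x * y = (u - x) * v + x * (v - y).
  by rewrite mulrBl mulrBr addrA subrK.
by apply: ideal_D; [apply: ideal_Mr | apply: ideal_Ml]; apply: quot_reprB.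
Qed.

Lemma quot_mulA : associative quot_mul.
Proof.
move=> u v w; rewrite -[u]quot_reprK -[v]quot_reprK -[w]quot_reprK.
by rewrite -!quot_piM mulrA.
Qed.
Lemma quot_mul1l : left_id quot_one quot_mul.
Proof. by move=> u; rewrite -[u]quot_reprK -quot_piM mul1r. Qed.
Lemma quot_mul1r : right_id quot_one quot_mul.
Proof. by move=> u; rewrite -[u]quot_reprK -quot_piM mulr1. Qed.
Lemma quot_mulDl : left_distributive quot_mul +%R.
Proof.
move=> u v w; rewrite -[u]quot_reprK -[v]quot_reprK -[w]quot_reprK.
by rewrite -quot_piD -!quot_piM -quot_piD mulrDl.
Qed.
Lemma quot_mulDr : right_distributive quot_mul +%R.
Proof.
move=> u v w; rewrite -[u]quot_reprK -[v]quot_reprK -[w]quot_reprK.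
by rewrite -quot_piD -!quot_piM -quot_piD mulrDr.
Qed.

HB.instance Definition _ := GRing.Zmodule_isPzRing.Build quot_ring
  quot_mulA quot_mul1l quot_mul1r quot_mulDl quot_mulDr.

HB.instance Definition _ :=
  GRing.isZmodMorphism.Build R quot_ring quot_pi quot_piB.
HB.instance Definition _ :=
  GRing.isMonoidMorphism.Build R quot_ring quot_pi (erefl, quot_piM).

End QuotientRing.

Section QuotientAlgebra.
Variables (K : fieldType) (A : assocAlg K) (I : ideal A).

Definition quot_str : K -> quot_ring I := @quot_pi A I \o alg_str A.
HB.instance Definition _ := GRing.RMorphism.on quot_str.

Lemma quot_central a (u : quot_ring I) : quot_str a * u = u * quot_str a.
Proof. by rewrite -[u]quot_reprK /quot_str /= -!rmorphM alg_central. Qed.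

Definition quot_alg : assocAlg K := @AssocAlg K (quot_ring I) quot_str quot_central.

End QuotientAlgebra.

Record quiver := Quiver {
  vert : finType;
  arr : finType;
  src : arr -> vert;
  tgt : arr -> vert
}.
Arguments src {q}.
Arguments tgt {q}.

Section Paths.
Variable Q : quiver.

Fixpoint composable (v : vert Q) (w : seq (arr Q)) : bool :=
  if w is a :: w' then (src a == v) && composable (tgt a) w' else true.

(* A path is its starting vertex together with its word of arrows, read from
   left to right; the trivial path at v is (v, [::]). *)
Definition qpath := {p : vert Q * seq (arr Q) | composable p.1 p.2}.

Definition endpoint (v : vert Q) (w : seq (arr Q)) : vert Q :=
  last v (map tgt w).

Lemma composable_cat v w1 w2 :
  composable v (w1 ++ w2) = composable v w1 && composable (endpoint v w1) w2.
Proof. by elim: w1 v => //= a w1 IH v; rewrite IH andbA. Qed.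

Lemma endpoint_cat v w1 w2 :
  endpoint v (w1 ++ w2) = endpoint (endpoint v w1) w2.
Proof. by rewrite /endpoint map_cat last_cat. Qed.

Definition plen (p : qpath) : nat := size (val p).2.

Lemma ptake_proof i (p : qpath) : composable (val p).1 (take i (val p).2).
Proof.
by have := valP p; rewrite -{1}(cat_take_drop i (val p).2) composable_cat
  => /andP[].
Qed.

Lemma pdrop_proof i (p : qpath) :
  composable (endpoint (val p).1 (take i (val p).2)) (drop i (val p).2).
Proof.
by have := valP p; rewrite -{1}(cat_take_drop i (val p).2) composable_cat
  => /andP[].
Qed.

Definition ptake i (p : qpath) : qpath :=
  Sub ((val p).1, take i (val p).2) (ptake_proof i p).
Definition pdrop i (p : qpath) : qpath :=
  Sub (endpoint (val p).1 (take i (val p).2), drop i (val p).2)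
      (pdrop_proof i p).

Lemma plen_take i p : (i <= plen p)%N -> plen (ptake i p) = i.
Proof. by move=> h; rewrite /plen /= size_takel. Qed.

Lemma plen_drop i p : plen (pdrop i p) = (plen p - i)%N.
Proof. by rewrite /plen /= size_drop. Qed.

Lemma ptake_all p : ptake (plen p) p = p.
Proof. by apply: val_inj; rewrite /= take_size -surjective_pairing. Qed.

Lemma pdrop0 p : pdrop 0 p = p.
Proof. by apply: val_inj; rewrite /= take0 drop0 -surjective_pairing. Qed.

Lemma ptake_take i j p : (j <= i)%N -> ptake j (ptake i p) = ptake j p.
Proof. by move=> h; apply: val_inj; rewrite /= take_takel. Qed.

Lemma pdrop_drop i j p : pdrop j (pdrop i p) = pdrop (j + i) p.
Proof.
apply: val_inj; rewrite /= drop_drop; congr (_, _).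
by rewrite -endpoint_cat addnC takeD.
Qed.

Lemma ptake_drop i j p : ptake j (pdrop i p) = pdrop i (ptake (j + i) p).
Proof.
apply: val_inj; rewrite /= take_drop; congr (_, _).
by rewrite take_takel // leq_addl.
Qed.

End Paths.

Section CompletePathAlgebra.
Variables (K : fieldType) (Q : quiver).

(* The complete path algebra: formal, possibly infinite, linear combinations of
   paths, i.e. the product over n of the spans of the paths of length n. *)
Definition cpath := qpath Q -> K.
HB.instance Definition _ := Choice.on cpath.

Implicit Types x y z : cpath.

Definition cp_zero : cpath := fun=> 0.
Definition cp_opp x : cpath := fun p => - x p.
Definition cp_add x y : cpath := fun p => x p + y p.
Definition cp_one : cpath := fun p => (plen p == 0%N)%:R.
Definition cp_mul x y : cpath := fun p =>
  \sum_(0 <= i < (plen p).+1) x (ptake i p) * y (pdrop i p).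

Lemma cp_addA : associative cp_add.
Proof. by move=> x y z; apply/funext => p; apply: addrA. Qed.
Lemma cp_addC : commutative cp_add.
Proof. by move=> x y; apply/funext => p; apply: addrC. Qed.
Lemma cp_add0 : left_id cp_zero cp_add.
Proof. by move=> x; apply/funext => p; apply: add0r. Qed.
Lemma cp_addN : left_inverse cp_zero cp_opp cp_add.
Proof. by move=> x; apply/funext => p; apply: addNr. Qed.

HB.instance Definition _ :=
  GRing.isZmodule.Build cpath cp_addA cp_addC cp_add0 cp_addN.

Lemma cp_mulA : associative cp_mul.
Proof.
move=> x y z; apply/funext => p; rewrite /cp_mul; set n := plen p.
pose F i j := x (ptake i p) * y (ptake j (pdrop i p)) * z (pdrop (j + i) p).
transitivity (\sum_(0 <= i < n.+1) \sum_(0 <= k < n.+1 | (i <= k)%N) F i (k - i)%N).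
  apply: eq_big_nat => i /andP[_ hi]; rewrite mulr_sumr plen_drop -/n.
  have -> : \sum_(0 <= k < n.+1 | (i <= k)%N) F i (k - i)%N
          = \sum_(i <= k < n.+1) F i (k - i)%N.
    rewrite [RHS](big_nat_widenl i 0) //.
  have := big_addn 0 n.+1 i xpredT (fun k => F i (k - i)%N).
  rewrite add0n subSn // => ->.
  apply: eq_big_nat => j /andP[_ hj]; rewrite addnK /F mulrA.
  by rewrite pdrop_drop.
rewrite (exchange_big_dep_nat xpredT) //=; apply: eq_big_nat => k /andP[_ hk].
rewrite mulr_suml plen_take //.
rewrite [RHS](big_nat_widen _ _ n.+1) //.
apply: eq_bigr => i hik.
by rewrite /F ptake_drop subnK // ptake_take.
Qed.

Lemma cp_mul1l : left_id cp_one cp_mul.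
Proof.
move=> x; apply/funext => p; rewrite /cp_mul big_nat_recl //.
rewrite big1_seq ?addr0 => [|i].
  by rewrite /cp_one plen_take // mul1r pdrop0.
rewrite mem_index_iota => /andP[_ /andP[_ hi]].
by rewrite /cp_one plen_take // mul0r.
Qed.

Lemma cp_mul1r : right_id cp_one cp_mul.
Proof.
move=> x; apply/funext => p; rewrite /cp_mul big_nat_recr //=.
rewrite big1_seq ?add0r => [|i].
  by rewrite /cp_one plen_drop subnn mulr1 ptake_all.
rewrite mem_index_iota => /andP[_ /andP[_ hi]].
by rewrite /cp_one plen_drop subn_eq0 leqNgt hi mulr0.
Qed.

Lemma cp_mulDl : left_distributive cp_mul +%R.
Proof.
move=> x y z; apply/funext => p; rewrite /cp_mul.
transitivity (\sum_(0 <= i < (plen p).+1)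
   (x (ptake i p) * z (pdrop i p) + y (ptake i p) * z (pdrop i p))).
  by apply: eq_bigr => i _; rewrite -mulrDl.
by rewrite big_split.
Qed.

Lemma cp_mulDr : right_distributive cp_mul +%R.
Proof.
move=> x y z; apply/funext => p; rewrite /cp_mul.
transitivity (\sum_(0 <= i < (plen p).+1)
   (x (ptake i p) * y (pdrop i p) + x (ptake i p) * z (pdrop i p))).
  by apply: eq_bigr => i _; rewrite -mulrDr.
by rewrite big_split.
Qed.

HB.instance Definition _ := GRing.Zmodule_isPzRing.Build cpath
  cp_mulA cp_mul1l cp_mul1r cp_mulDl cp_mulDr.

Definition cp_str (a : K) : cpath := fun p => if plen p == 0%N then a else 0.

Lemma cp_strMl a x p : (cp_str a * x) p = a * x p.
Proof.
rewrite [LHS]/GRing.mul /= /cp_mul big_nat_recl // big1_seq ?addr0 => [|i].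
  by rewrite /cp_str plen_take //= pdrop0.
rewrite mem_index_iota => /andP[_ /andP[_ hi]].
by rewrite /cp_str plen_take // mul0r.
Qed.

Lemma cp_strMr a x p : (x * cp_str a) p = x p * a.
Proof.
rewrite [LHS]/GRing.mul /= /cp_mul big_nat_recr //= big1_seq ?add0r => [|i].
  by rewrite /cp_str plen_drop subnn /= ptake_all.
rewrite mem_index_iota => /andP[_ /andP[_ hi]].
by rewrite /cp_str plen_drop subn_eq0 leqNgt hi mulr0.
Qed.

Lemma cp_strB : zmod_morphism cp_str.
Proof.
move=> a b; apply/funext => p.
rewrite [RHS]/GRing.add /= /cp_add [in RHS]/GRing.opp /= /cp_opp /cp_str.
by case: ifP => // _; rewrite subr0.
Qed.

Lemma cp_strM : monoid_morphism cp_str.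
Proof.
split=> [|a b]; apply/funext => p.
  by rewrite [RHS]/GRing.one /= /cp_one /cp_str; case: ifP.
by rewrite cp_strMl /cp_str; case: ifP; rewrite ?mulr0.
Qed.

HB.instance Definition _ := GRing.isZmodMorphism.Build K cpath cp_str cp_strB.
HB.instance Definition _ := GRing.isMonoidMorphism.Build K cpath cp_str cp_strM.

Lemma cp_central a x : cp_str a * x = x * cp_str a.
Proof. by apply/funext => p; rewrite cp_strMl cp_strMr mulrC. Qed.

Definition complete_path_alg : assocAlg K :=
  @AssocAlg K cpath cp_str cp_central.

(* The closure in the topology whose basic neighbourhoods of 0 are the
   combinations of paths of length at least n. *)
Definition closure_pred (J : cpath -> Prop) (x : cpath) : Prop :=
  forall n, exists2 y, J y & forall p, (plen p < n)%N -> x p = y p.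

Section Closure.
Variable J : ideal cpath.

Lemma closure_0 : closure_pred J 0.
Proof. by move=> n; exists 0 => //; apply: ideal_0. Qed.

Lemma closure_D x y :
  closure_pred J x -> closure_pred J y -> closure_pred J (x + y).
Proof.
move=> hx hy n; have [x' Jx' ex] := hx n; have [y' Jy' ey] := hy n.
exists (x' + y'); first exact: ideal_D.
by move=> p hp; congr (_ + _); [apply: ex | apply: ey].
Qed.

Lemma closure_Ml a x : closure_pred J x -> closure_pred J (a * x).
Proof.
move=> hx n; have [x' Jx' ex] := hx n; exists (a * x'); first exact: ideal_Ml.
move=> p hp; rewrite [LHS]/GRing.mul [RHS]/GRing.mul /= /cp_mul.
apply: eq_bigr => i _; rewrite ex // plen_drop.
exact: leq_ltn_trans (leq_subr _ _) hp.
Qed.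

Lemma closure_Mr a x : closure_pred J x -> closure_pred J (x * a).
Proof.
move=> hx n; have [x' Jx' ex] := hx n; exists (x' * a); first exact: ideal_Mr.
move=> p hp; rewrite [LHS]/GRing.mul [RHS]/GRing.mul /= /cp_mul.
apply: eq_big_nat => i /andP[_ hi]; rewrite ex // plen_take //.
by apply: leq_ltn_trans hp.
Qed.

Definition closure_ideal : ideal cpath :=
  Ideal closure_0 closure_D closure_Ml closure_Mr.

End Closure.

(* The path algebra: finite linear combinations of paths. *)
Definition finitely_supported : {pred cpath} := fun x =>
  `[< exists s : seq (qpath Q), forall p, p \notin s -> x p = 0 >].

Lemma finitely_supportedP x :
  reflect (exists s : seq (qpath Q), forall p, p \notin s -> x p = 0)
          (x \in finitely_supported).
Proof. exact: asboolP. Qed.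

Lemma finitely_supported_str a : cp_str a \in finitely_supported.
Proof.
apply/finitely_supportedP.
exists [seq insubd (Sub (v, [::]) isT : qpath Q) (v, [::])
       | v <- enum (vert Q)] => p.
rewrite /cp_str; case: ifP => // /eqP p0 /mapP[].
exists (val p).1; first by rewrite mem_enum.
have p2 : (val p).2 = [::] by apply: size0nil.
by apply: val_inj; rewrite val_insubd /= -p2 -surjective_pairing.
Qed.

Lemma finitely_supported_subring : subring_closed finitely_supported.
Proof.
split.
- have -> : (1 : cpath) = cp_str 1 by rewrite rmorph1.
  exact: finitely_supported_str.
- move=> x y /finitely_supportedP[s hs] /finitely_supportedP[r hr].
  apply/finitely_supportedP; exists (s ++ r) => p.
  rewrite mem_cat negb_or => /andP[ps pr].
  by rewrite [LHS]/GRing.add /= /cp_add hs // /GRing.opp /= /cp_opp hr // subr0.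
- move=> x y /finitely_supportedP[s hs] /finitely_supportedP[r hr].
  apply/finitely_supportedP.
  exists [seq insubd q1 ((val q1).1, (val q1).2 ++ (val q2).2) | q1 <- s, q2 <- r].
  move=> p hp; rewrite [LHS]/GRing.mul /= /cp_mul big1 // => i _.
  case hs1: (ptake i p \in s); last by rewrite hs ?mul0r ?hs1.
  case hr1: (pdrop i p \in r); last by rewrite hr ?mulr0 ?hr1.
  case/negP: hp; apply/allpairsP; exists (ptake i p, pdrop i p); split=> //=.
  rewrite cat_take_drop -surjective_pairing; apply: val_inj.
  by rewrite val_insubd (valP p).
Qed.

HB.instance Definition _ := GRing.isSubringClosed.Build cpath finitely_supported
  finitely_supported_subring.

Definition fpath := {x : cpath | x \in finitely_supported}.
HB.instance Definition _ := SubChoice.on fpath.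
HB.instance Definition _ := GRing.SubChoice_isSubPzRing.Build _ _ fpath (subringClosedP _).

Definition fp_str (a : K) : fpath := Sub (cp_str a) (finitely_supported_str a).

Lemma fp_strB : zmod_morphism fp_str.
Proof. by move=> a b; apply: val_inj; rewrite rmorphB /= rmorphB. Qed.
Lemma fp_strM : monoid_morphism fp_str.
Proof.
by split=> [|a b]; apply: val_inj; rewrite ?rmorph1 ?rmorphM /= ?rmorph1 ?rmorphM.
Qed.

HB.instance Definition _ := GRing.isZmodMorphism.Build K fpath fp_str fp_strB.
HB.instance Definition _ := GRing.isMonoidMorphism.Build K fpath fp_str fp_strM.

Lemma fp_central a (x : fpath) : fp_str a * x = x * fp_str a.
Proof. by apply: val_inj; rewrite !rmorphM /= cp_central. Qed.

Definition path_alg : assocAlg K := @AssocAlg K fpath fp_str fp_central.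

Definition path_elt (p : qpath Q) : path_alg :=
  insubd (0 : fpath) ((fun q => (q == p)%:R) : cpath).

Lemma path_eltE p q : val (path_elt p : fpath) q = (q == p)%:R.
Proof.
rewrite val_insubd ifT //; apply/finitely_supportedP; exists [:: p] => r.
by rewrite inE => /negPf ->.
Qed.

Definition triv_elt (v : vert Q) : path_alg :=
  path_elt (Sub (v, [::]) isT).

Lemma arrow_composable (a : arr Q) : composable (src a) [:: a].
Proof. by rewrite /= eqxx. Qed.

Definition arr_elt (a : arr Q) : path_alg :=
  path_elt (Sub (src a, [:: a]) (arrow_composable a)).

End CompletePathAlgebra.

(* In rq_out and rq_in a loop is counted once as starting and once as ending at
   its vertex. *)
Record ribbonQuiver := RibbonQuiver {
  rq_quiver :> quiver;
  rq_f : arr rq_quiver -> arr rq_quiver;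
  rq_out : forall v : vert rq_quiver, #|[pred a : arr rq_quiver | src a == v]| = 2%N;
  rq_in : forall v : vert rq_quiver, #|[pred a : arr rq_quiver | tgt a == v]| = 2%N;
  rq_f_inj : injective rq_f;
  rq_fP : forall a, src (rq_f a) = tgt a
}.

Section RibbonQuiver.
Variable R : ribbonQuiver.
Implicit Types a b : arr R.

Definition connected_quiver : Prop :=
  (0 < #|vert R|)%N /\
  forall v w : vert R,
    connect (fun x y : vert R =>
      [exists a : arr R, ((src a == x) && (tgt a == y))
                      || ((src a == y) && (tgt a == x))]) v w.

Definition triangulation : Prop := forall a, rq_f (rq_f (rq_f a)) = a.

(* The default value of odflt is never used, by rq_out. *)
Definition rq_bar a : arr R := odflt a [pick b | (src b == src a) && (b != a)].

Definition rq_g a : arr R := rq_bar (rq_f a).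

Definition rq_n a : nat := fingraph.order rq_g a.

Lemma rq_barP a : src (rq_bar a) = src a /\ rq_bar a <> a.
Proof.
rewrite /rq_bar; case: pickP => [b /andP[/eqP ? /eqP] //|none] /=.
have := rq_out (src a); rewrite (cardD1 a) inE eqxx eq_card0 // => b.
by rewrite !inE andbC; apply: none.
Qed.

Lemma rq_bar_unique a b : src b = src a -> b <> a -> b = rq_bar a.
Proof.
move=> sb /eqP ba; have [sa' /eqP a'a] := rq_barP a.
apply/eqP/negPn/negP => ba'.
have := rq_out (src a); rewrite (cardD1 a) inE eqxx (cardD1 b) !inE ba sb eqxx.
rewrite (cardD1 (rq_bar a)) !inE a'a sa' eqxx eq_sym ba' //.
Qed.

Lemma rq_barK : involutive rq_bar.
Proof.
move=> a; have [sa' a'a] := rq_barP a.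
by apply/esym/rq_bar_unique => // /esym.
Qed.

Lemma rq_g_inj : injective rq_g.
Proof. by move=> a b /(inv_inj rq_barK); apply: rq_f_inj. Qed.

Lemma rq_nP a :
  [/\ (0 < rq_n a)%N, iter (rq_n a) rq_g a = a &
      forall k, (0 < k < rq_n a)%N -> iter k rq_g a <> a].
Proof.
split; [exact: order_gt0 | exact: iter_order rq_g_inj a |].
move=> k /andP[k0 kn] e; move: k0; rewrite -(findex_iter kn) e.
by rewrite findex0.
Qed.

End RibbonQuiver.

Definition g_invariant (R : ribbonQuiver) (T : Type) (nu : arr R -> T) : Prop :=
  forall a, nu (rq_g a) = nu a.

Definition admissible (R : ribbonQuiver) (m : arr R -> nat) : Prop :=
  forall a, (3 <= m a * rq_n a)%N.

Definition f_fixed (R : ribbonQuiver) := {a : arr R | rq_f a == a}.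

Section Algebras.
Variables (K : fieldType) (R : ribbonQuiver).
Variables (m : arr R -> nat) (c : arr R -> K) (lam : f_fixed R -> K).
Implicit Types a b : arr R.

Local Notation x_ a := (arr_elt K a).

Definition omega a : path_alg K R :=
  \prod_(i < rq_n a) x_ (iter i (@rq_g R) a).

Definition omega' a : path_alg K R :=
  triv_elt K (src a) * \prod_(i < (rq_n a).-1) x_ (iter i (@rq_g R) a).

Inductive triangulation_rel : path_alg K R -> Prop :=
| TriRel a of rq_f (rq_bar a) != rq_bar a :
    triangulation_rel
      (x_ (rq_bar a) * x_ (rq_f (rq_bar a))
       - c a *' (omega a ^+ (m a).-1 * omega' a))
| TriRelFixed a (fa : rq_f (rq_bar a) == rq_bar a) :
    triangulation_rel
      (x_ (rq_bar a) ^+ 2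
       - lam (exist _ (rq_bar a) fa) *' x_ (rq_bar a) ^+ 3
       - c a *' (omega a ^+ (m a).-1 * omega' a)).

Definition triangulation_ideal : ideal (complete_path_alg K R) :=
  gen_ideal (fun y : complete_path_alg K R =>
    exists2 x : fpath K R, triangulation_rel x & y = val x).

Definition triangulation_alg : assocAlg K :=
  quot_alg (A := complete_path_alg K R) (closure_ideal triangulation_ideal).

Inductive brauer_rel : path_alg K R -> Prop :=
| BrauerZero a : brauer_rel (x_ a * x_ (rq_f a))
| BrauerCommut a :
    brauer_rel (c a *' omega a ^+ m a
                - c (rq_bar a) *' omega (rq_bar a) ^+ m (rq_bar a)).

Definition brauer_graph_alg : assocAlg K :=
  quot_alg (A := path_alg K R) (gen_ideal brauer_rel).

Definition tri_N : nat := \big[lcmn/1%N]_(a : arr R) (m a * rq_n a)%N.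

Definition tri_e a : rat :=
  let h b := (m b * rq_n b)%N%:R^-1 in 1 - (h a + h (rq_f a) + h (rq_f (rq_f a))).

Definition tri_e' a : rat := 1 - 2 * (m a * rq_n a)%N%:R^-1.

(* truncn turns a nonnegative integral rational into the natural number it
   is; it is only applied to such rationals below. *)
Definition tri_Ne a : nat := Num.truncn (tri_N%:R * tri_e a).
Definition tri_Ne' a : nat := Num.truncn (tri_N%:R * tri_e' a).

Inductive deform_rel (t : K) : path_alg K R -> Prop :=
| DefRel a of rq_f (rq_bar a) != rq_bar a :
    deform_rel t
      (x_ (rq_bar a) * x_ (rq_f (rq_bar a))
       - (c a * t ^+ tri_Ne (rq_bar a)) *' (omega a ^+ (m a).-1 * omega' a))
| DefRelFixed a (fa : rq_f (rq_bar a) == rq_bar a) :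
    deform_rel t
      (x_ (rq_bar a) ^+ 2
       - (c a * t ^+ tri_Ne (rq_bar a)) *' (omega a ^+ (m a).-1 * omega' a)
       - (c a * lam (exist _ (rq_bar a) fa) * t ^+ tri_Ne' (rq_bar a))
           *' omega a ^+ m a)
| DefRelZero a :
    deform_rel t (x_ a * x_ (rq_f a) * x_ (rq_g (rq_f a)))
| DefRelCommut a :
    deform_rel t (c a *' omega a ^+ m a
                  - c (rq_bar a) *' omega (rq_bar a) ^+ m (rq_bar a)).

Definition deform_ideal (t : K) : ideal (path_alg K R) :=
  gen_ideal (deform_rel t).

Definition deform_alg (t : K) : assocAlg K := quot_alg (deform_ideal t).

End Algebras.

Definition weighted_iso (R R' : ribbonQuiver)
    (m : arr R -> nat) (m' : arr R' -> nat) : Prop :=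
  exists (phi0 : vert R -> vert R') (phi1 : arr R -> arr R'),
    [/\ bijective phi0, bijective phi1,
        forall a, src (phi1 a) = phi0 (src a) /\ tgt (phi1 a) = phi0 (tgt a),
        forall a, phi1 (rq_f a) = rq_f (phi1 a) &
        forall a, m' (phi1 a) = m a].

(* The vertices 1, 2 are 0, 1 : 'I_2 and the arrows alpha, beta, gamma, eta are
   0, 1, 2, 3 : 'I_4. *)
Definition monogon_src (a : 'I_4) : 'I_2 := tnth [tuple 0; 0; 1; 1] a.
Definition monogon_tgt (a : 'I_4) : 'I_2 := tnth [tuple 0; 1; 0; 1] a.
Definition monogon_f (a : 'I_4) : 'I_4 := tnth [tuple 1; 2%:R; 0; 3%:R] a.
Definition monogon_m (a : 'I_4) : nat := tnth [tuple 3; 1; 1; 1]%N a.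

Definition monogon_quiver : quiver := Quiver monogon_src monogon_tgt.

Lemma monogon_out (v : vert monogon_quiver) :
  #|[pred a : arr monogon_quiver | src a == v]| = 2%N.
Proof.
by rewrite -sum1_card big_mkcond /= !big_ord_recl big_ord0; case: v => [[|[|]]].
Qed.

Lemma monogon_in (v : vert monogon_quiver) :
  #|[pred a : arr monogon_quiver | tgt a == v]| = 2%N.
Proof.
by rewrite -sum1_card big_mkcond /= !big_ord_recl big_ord0; case: v => [[|[|]]].
Qed.

Lemma monogon_f3 a : monogon_f (monogon_f (monogon_f a)) = a.
Proof. by apply/val_inj; case: a => [[|[|[|[|]]]]]. Qed.

Lemma monogon_f_inj : injective monogon_f.
Proof. by apply: (can_inj (g := fun a => monogon_f (monogon_f a))) => a;
  apply: monogon_f3. Qed.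

Lemma monogon_fP a : monogon_src (monogon_f a) = monogon_tgt a.
Proof. by apply/val_inj; case: a => [[|[|[|[|]]]]]. Qed.

Definition punctured_monogon : ribbonQuiver :=
  @RibbonQuiver monogon_quiver monogon_f monogon_out monogon_in monogon_f_inj
    monogon_fP.

Definition tet_vert := {A : {set 'I_4} | #|A| == 2%N}.
Definition tet_arr := {p : 'I_4 * 'I_4 | p.1 != p.2}.

Lemma tet_src_proof (a : tet_arr) : #|[set (val a).1; (val a).2]| == 2%N.
Proof. by rewrite cards2 (valP a). Qed.

Definition tet_src (a : tet_arr) : tet_vert :=
  exist _ [set (val a).1; (val a).2] (tet_src_proof a).

Lemma tet_bar_proof (a : tet_arr) :
  ((val a).2, (val a).1).1 != ((val a).2, (val a).1).2.
Proof. by rewrite eq_sym (valP a). Qed.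

Definition tet_bar (a : tet_arr) : tet_arr :=
  exist _ ((val a).2, (val a).1) (tet_bar_proof a).

(* The points 1, 2, 3, 4 are 0, 1, 2, 3 : 'I_4; the i-th entry is the cycle of
   the second components of the g-orbit of the arrows (i, j). *)
Definition tet_cycle (i : 'I_4) : seq 'I_4 :=
  tnth [tuple [:: 1; 2; 3]; [:: 0; 3; 2]; [:: 0; 1; 3]; [:: 0; 2; 1]] i.

Lemma tet_cycle_mem i j : (j \in tet_cycle i) = (i != j).
Proof. by case: i j => [[|[|[|[|]]]] // i] [[|[|[|[|]]]] // j]. Qed.

Lemma tet_cycle_uniq i : uniq (tet_cycle i).
Proof. by case: i => [[|[|[|[|]]]]]. Qed.

Lemma tet_g_proof (a : tet_arr) :
  let p := ((val a).1, next (tet_cycle (val a).1) (val a).2) in p.1 != p.2.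
Proof. by rewrite /= -tet_cycle_mem mem_next tet_cycle_mem (valP a). Qed.

Definition tet_g (a : tet_arr) : tet_arr :=
  exist _ ((val a).1, next (tet_cycle (val a).1) (val a).2) (tet_g_proof a).

Definition tet_tgt (a : tet_arr) : tet_vert := tet_src (tet_g a).
Definition tet_f (a : tet_arr) : tet_arr := tet_bar (tet_g a).

Lemma tet_barK : involutive tet_bar.
Proof. by move=> a; apply/val_inj; rewrite /= -surjective_pairing. Qed.

Lemma tet_g_inj : injective tet_g.
Proof.
move=> a b /(congr1 val) /= [e1 e2]; apply/val_inj.
rewrite [LHS]surjective_pairing [RHS]surjective_pairing e1; congr (_, _).
rewrite e1 in e2.
by rewrite -[LHS](prev_next (tet_cycle_uniq (val b).1)) e2 prev_next
  ?tet_cycle_uniq.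
Qed.

Lemma tet_src_bar a : tet_src (tet_bar a) = tet_src a.
Proof. by apply/val_inj; rewrite /= setUC. Qed.

Lemma tet_bar_neq a : a != tet_bar a.
Proof.
apply/eqP => /(congr1 val)/(congr1 fst) /= e.
by have := valP a; rewrite e eqxx.
Qed.

Lemma tet_src_eq a b : tet_src b = tet_src a -> b = a \/ b = tet_bar a.
Proof.
case: a b => [[i j] /= ij] [[k l] /= kl] /(congr1 val) /= e.
have kl' := kl.
have: k \in [set i; j] by rewrite -e set21.
have: l \in [set i; j] by rewrite -e set22.
rewrite !inE => /orP[] /eqP el /orP[] /eqP ek.
- by rewrite el ek eqxx in kl'.
- by right; apply/val_inj; rewrite /= ek el.
- by left; apply/val_inj; rewrite /= ek el.
- by rewrite el ek eqxx in kl'.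
Qed.

Definition tetrahedron_quiver : quiver := Quiver tet_src tet_tgt.

Lemma tet_out (v : vert tetrahedron_quiver) :
  #|[pred a : arr tetrahedron_quiver | src a == v]| = 2%N.
Proof.
have [a av] : exists a : tet_arr, tet_src a = v.
  have /cards2P[i [j [ij e]]] := valP v.
  by exists (exist _ (i, j) ij); apply/val_inj.
rewrite -av -[RHS](_ : #|pred2 a (tet_bar a)| = _); last first.
  by rewrite card2 tet_bar_neq.
apply: eq_card => b; rewrite !inE; apply/eqP/idP => [/tet_src_eq[]->|].
- by rewrite eqxx.
- by rewrite eqxx orbT.
- by case/orP=> /eqP ->; rewrite //= tet_src_bar.
Qed.

Lemma tet_in (v : vert tetrahedron_quiver) :
  #|[pred a : arr tetrahedron_quiver | tgt a == v]| = 2%N.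
Proof.
rewrite -(tet_out v).
transitivity #|[predI codom tet_g & [pred a | tet_src a == v]]|.
  by rewrite -(card_preim tet_g_inj); apply: eq_card.
by apply: eq_card => a; rewrite !inE (injF_onto tet_g_inj).
Qed.

Lemma tet_f_inj : injective tet_f.
Proof. by move=> a b /(inv_inj tet_barK)/tet_g_inj. Qed.

Lemma tet_fP a : tet_src (tet_f a) = tet_tgt a.
Proof. exact: tet_src_bar. Qed.

Definition tetrahedron : ribbonQuiver :=
  @RibbonQuiver tetrahedron_quiver tet_f tet_out tet_in tet_f_inj tet_fP.

Definition exceptional (R : ribbonQuiver) (m : arr R -> nat) : Prop :=
  weighted_iso m (monogon_m : arr punctured_monogon -> nat) \/
  weighted_iso m ((fun=> 1%N) : arr tetrahedron -> nat).

(* A point of K^(d^3): mu (i, j, k) is the k-th coordinate of the product of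
   the i-th and j-th basis vectors. *)
Definition structure_constants (K : Type) (d : nat) :=
  {ffun 'I_d * 'I_d * 'I_d -> K}.

Section Degeneration.
Variables (K : fieldType) (d : nat).
Implicit Types (mu nu : structure_constants K d) (x y z : 'rV[K]_d).

Definition sc_mul mu x y : 'rV[K]_d :=
  \row_k \sum_i \sum_j x 0 i * y 0 j * mu (i, j, k).

(* The points of the variety of unital associative algebra structures. *)
Definition in_alg mu : Prop :=
  (forall x y z, sc_mul mu (sc_mul mu x y) z = sc_mul mu x (sc_mul mu y z)) /\
  (exists e, forall x, sc_mul mu e x = x /\ sc_mul mu x e = x).

(* Transport of structure along the linear automorphism x |-> x *m g. *)
Definition sc_act (g : 'M[K]_d) mu : structure_constants K d :=
  [ffun p => (sc_mul mu (row p.1.1 (invmx g)) (row p.1.2 (invmx g)) *m g) 0 p.2].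

Definition sc_orbit mu : structure_constants K d -> Prop :=
  fun nu => exists2 g, g \in unitmx & nu = sc_act g mu.

Definition sc_eval (P : {mpoly K[#|{: 'I_d * 'I_d * 'I_d}|]}) mu : K :=
  P.@[fun i => mu (enum_val i)].

(* Closure, in the variety of algebra structures, of a subset of it. *)
Definition zariski_closure (X : structure_constants K d -> Prop) nu : Prop :=
  in_alg nu /\
  forall P, (forall mu, X mu -> sc_eval P mu = 0) -> sc_eval P nu = 0.

Definition sc_presents mu (A : assocAlg K) : Prop :=
  exists f : 'rV[K]_d -> A,
    [/\ bijective f, forall x y, f (x + y) = f x + f y,
        forall a x, f (a *: x) = a *' f x &
        forall x y, f (sc_mul mu x y) = f x * f y].

End Degeneration.

Definition sc_map (K L : fieldType) (d : nat) (iota : K -> L)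
    (mu : structure_constants K d) : structure_constants L d :=
  [ffun p => iota (mu p)].

(* B is a degeneration of A. If K is infinite, this amounts to the condition
   for iota = id, that B is in the Zariski closure of the GL_d(K)-orbit of A in
   alg_d(K): the other cases follow from it by expanding the coefficients of a
   polynomial over L along a basis of L over K. If K is finite, every subset of
   alg_d(K) is Zariski closed, and one has to use the points of alg_d over the
   infinite fields containing K. *)
Definition degeneration (K : fieldType) (A B : assocAlg K) : Prop :=
  exists (d : nat) (mu nu : structure_constants K d),
    [/\ in_alg mu, in_alg nu, sc_presents mu A, sc_presents nu B &
        forall (L : fieldType) (iota : {rmorphism K -> L}),
          (forall s : seq L, exists x, x \notin s) ->
          zariski_closure (sc_orbit (sc_map iota mu)) (sc_map iota nu)].

(* Main.v *)
Require Import Defs.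
From HB Require Import structures.
From mathcomp Require Import all_boot all_order all_algebra.
From mathcomp Require Import boolp zify ring.
From mathcomp.multinomials Require Import mpoly.

Set Implicit Arguments.
Unset Strict Implicit.
Unset Printing Implicit Defensive.

Import GRing.Theory Num.Theory.
Local Open Scope ring_scope.

(** All the algebras in question are quotients by relations of one shape
    ([turn_rel]): a turn by f is replaced by tau times the path along g that
    stops one arrow short of the socle, plus sigma times a socle element. The
    choice tau = sigma = 0 gives Gamma, while tau = t^(N e) and
    sigma = lam t^(N e') give Lambda_t. So (a) amounts to 0^k = 0 for positive k.
    For (c), give the arrow a the weight N / (m n): a full path along g then has
    weight N, and the exponents of t are exactly the differences of weight
    between the two sides of the relations ([rescaling_ideal]).

    In (b), the point is that the paths a (f a) (g f a) vanish in Lambda. The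
    relations rewrite such a path as a path b (g b) (f g b) times a path of length
    m n - 3, and conversely. Four such steps lead back to the initial path. If one
    of them adds length, the path can be lengthened without end and lies in the
    closure of the ideal ([fg_gf_near]); otherwise m n = 3 at four neighbouring
    arrows, which forces the whole quiver to be exceptional
    ([local_exceptional]). Conversely the relations of Lambda hold in Lambda_1,
    where moreover all long paths vanish, so that passing to the completion
    changes nothing ([completion_iso]).

    For (d), the family Lambda_t is of no use when some N e vanishes, which happens
    on the f-orbits with m n = 3 throughout. However, not all arrows have m n = 3,
    and weight can be moved along the g-orbits from the f-orbits without slack
    to the others: there are positive weights for which the full paths along g
    still have a common weight M, while every f-orbit has weight less than M
    ([strict_weights]). All the quotients by relations of the above shape have
    the same basis ([turn_basis]), whose linear independence comes from a matrix
    representation ([rep_mx_ideal], [psi_bij]). With respect to the weights, the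
    structure constants of Lambda in this basis are those of Gamma plus terms
    that strictly raise the weight ([turn_sc_leading]). So a one-parameter group
    of diagonal matrices moves Lambda towards Gamma ([weight_degeneration]). The
    same weights make long paths vanish in Lambda_1 ([long_word_in_ideal]). *)

(** * Algebras over a field and their quotients *)

(* Simplification must not replace a concrete algebra by its underlying ring,
   from which the algebra structure cannot be inferred back. *)
Arguments alg_ring : simpl never.

Section ScalarAction.
Variables (K : fieldType) (A : assocAlg K).
Implicit Types (a b : K) (x y : A).

Lemma alg_scaleA a b x : a *' (b *' x) = (a * b) *' x.
Proof. by rewrite /alg_scale mulrA rmorphM. Qed.
Lemma alg_scale1 x : 1 *' x = x.
Proof. by rewrite /alg_scale rmorph1 mul1r. Qed.
Lemma alg_scale0 x : 0 *' x = 0.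
Proof. by rewrite /alg_scale rmorph0 mul0r. Qed.
Lemma alg_scaler0 a : a *' (0 : A) = 0.
Proof. by rewrite /alg_scale mulr0. Qed.
Lemma alg_scaleBr a x y : a *' (x - y) = a *' x - a *' y.
Proof. by rewrite /alg_scale mulrBr. Qed.
Lemma alg_scaleDl a b x : (a + b) *' x = a *' x + b *' x.
Proof. by rewrite /alg_scale rmorphD mulrDl. Qed.
Lemma alg_scaleAl a x y : (a *' x) * y = a *' (x * y).
Proof. by rewrite /alg_scale mulrA. Qed.
Lemma alg_scaleAr a x y : x * (a *' y) = a *' (x * y).
Proof. by rewrite /alg_scale !mulrA alg_central. Qed.
Lemma alg_scale_sum (I : Type) (r : seq I) (P : pred I) a (F : I -> A) :
  a *' (\sum_(i <- r | P i) F i) = \sum_(i <- r | P i) a *' F i.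
Proof. by rewrite /alg_scale mulr_sumr. Qed.

Lemma ideal_scale (I : ideal A) a x : I x -> I (a *' x).
Proof. exact: ideal_Ml. Qed.
Lemma ideal_sum (I : ideal A) (T : Type) (r : seq T) (F : T -> A) :
  (forall i, I (F i)) -> I (\sum_(i <- r) F i).
Proof.
move=> IF; elim/big_rec: _ => [|i x _ Ix]; first exact: ideal_0.
exact: ideal_D.
Qed.

Lemma quot_piZ (I : ideal A) a x :
  @quot_pi A I (a *' x) = (a *' (@quot_pi A I x : quot_alg I)).
Proof. by rewrite /alg_scale rmorphM. Qed.

Lemma quot_pi0P (I : ideal A) x : @quot_pi A I x = 0 <-> I x.
Proof. by rewrite -(rmorph0 (@quot_pi A I)) quot_eqP subr0. Qed.

End ScalarAction.

Section GeneratedIdeal.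
Variables (R : pzRingType) (S : R -> Prop).

Lemma gen_ideal_in x : S x -> gen_ideal S x.
Proof. by move=> Sx J; apply. Qed.

Lemma gen_ideal_min (J : ideal R) :
  (forall x, S x -> J x) -> forall x, gen_ideal S x -> J x.
Proof. by move=> SJ x; apply. Qed.

End GeneratedIdeal.

Section Pullback.
Variables (R S : pzRingType) (F : {rmorphism R -> S}) (J : ideal S).

Definition pullback_pred (x : R) : Prop := J (F x).
Lemma pullback_0 : pullback_pred 0.
Proof. by rewrite /pullback_pred rmorph0; apply: ideal_0. Qed.
Lemma pullback_D x y :
  pullback_pred x -> pullback_pred y -> pullback_pred (x + y).
Proof. by rewrite /pullback_pred rmorphD; apply: ideal_D. Qed.
Lemma pullback_Ml a x : pullback_pred x -> pullback_pred (a * x).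
Proof. by rewrite /pullback_pred rmorphM; apply: ideal_Ml. Qed.
Lemma pullback_Mr a x : pullback_pred x -> pullback_pred (x * a).
Proof. by rewrite /pullback_pred rmorphM; apply: ideal_Mr. Qed.

Definition pullback : ideal R :=
  Ideal pullback_0 pullback_D pullback_Ml pullback_Mr.
End Pullback.

Section ZeroIdeal.
Variable S : pzRingType.
Lemma zero_ideal_D (x y : S) : x = 0 -> y = 0 -> x + y = 0.
Proof. by move=> -> ->; rewrite addr0. Qed.
Lemma zero_ideal_Ml (a x : S) : x = 0 -> a * x = 0.
Proof. by move=> ->; rewrite mulr0. Qed.
Lemma zero_ideal_Mr (a x : S) : x = 0 -> x * a = 0.
Proof. by move=> ->; rewrite mul0r. Qed.
Definition zero_ideal : ideal S :=
  Ideal erefl zero_ideal_D zero_ideal_Ml zero_ideal_Mr.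
End ZeroIdeal.

Section FirstIsomorphism.
Variables (K : fieldType) (A B : assocAlg K).

Lemma alg_iso_sym : alg_iso A B -> alg_iso B A.
Proof.
move=> [f [fZ [h fK hK]]].
have hB : zmod_morphism h.
  by move=> x y; apply: (can_inj fK); rewrite rmorphB !hK.
have hM : monoid_morphism h.
  by split=> [|x y]; apply: (can_inj fK); rewrite ?rmorphM ?rmorph1 !hK.
pose hb := GRing.isZmodMorphism.Build B A h hB.
pose hm := GRing.isMonoidMorphism.Build B A h hM.
pose H : {rmorphism B -> A} := HB.pack h hb hm.
exists H; split; last by exists f.
by move=> a x; apply: (can_inj fK); rewrite /= fZ !hK.
Qed.

Lemma alg_iso_trans (C : assocAlg K) : alg_iso A B -> alg_iso B C -> alg_iso A C.
Proof.
move=> [f [fZ fb]] [h [hZ hb]].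
exists (h \o f : {rmorphism A -> C}); split=> [a x|]; first by rewrite /= fZ hZ.
exact: bij_comp.
Qed.

(** The quotients compared below are seldom quotients by the same ideal of the
    same algebra: this is how each isomorphism is produced. *)
Lemma first_iso (I : ideal A) (F : {rmorphism A -> B}) :
  (forall a x, F (a *' x) = a *' F x) -> (forall y, exists x, F x = y) ->
  (forall x, F x = 0 <-> I x) -> alg_iso (quot_alg I) B.
Proof.
move=> FZ Fsurj FI.
pose h (u : quot_alg I) : B := F (@quot_repr A I u).
have hpi x : h (@quot_pi A I x) = F x.
  apply/eqP; rewrite -subr_eq0 -rmorphB; apply/eqP/FI; exact: quot_reprB.
have hB : zmod_morphism h.
  move=> u v; rewrite -[u](@quot_reprK A I) -[v](@quot_reprK A I).
  by rewrite -rmorphB !hpi rmorphB.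
have hM : monoid_morphism h.
  split=> [|u v]; first by rewrite -[X in h X](rmorph1 (@quot_pi A I)) hpi rmorph1.
  rewrite -[u](@quot_reprK A I) -[v](@quot_reprK A I).
  by rewrite -rmorphM !hpi rmorphM.
pose hb := GRing.isZmodMorphism.Build (quot_alg I) B h hB.
pose hm := GRing.isMonoidMorphism.Build (quot_alg I) B h hM.
pose H : {rmorphism quot_alg I -> B} := HB.pack h hb hm.
exists H; split.
  move=> a u; rewrite -[u](@quot_reprK A I) -quot_piZ.
  by rewrite /= !hpi FZ.
pose s y := projT1 (cid (Fsurj y)).
have sK y : F (s y) = y by rewrite /s; case: cid.
exists (fun y => @quot_pi A I (s y)) => [u|y]; last by rewrite /= hpi sK.
rewrite -[u](@quot_reprK A I) /= hpi; apply/quot_eqP/FI.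
by rewrite rmorphB sK subrr.
Qed.

End FirstIsomorphism.

Lemma eq_ideal_iso (K : fieldType) (A : assocAlg K) (I J : ideal A) :
  (forall x, I x <-> J x) -> alg_iso (quot_alg I) (quot_alg J).
Proof.
move=> IJ; apply: (@first_iso K A (quot_alg J) I (@quot_pi A J : {rmorphism A -> quot_alg J})).
- by move=> a x; rewrite -quot_piZ.
- by move=> y; exists (@quot_repr A J y); apply: quot_reprK.
- by move=> x; rewrite quot_pi0P IJ.
Qed.

(** * The path algebra *)

Section PathAlgebra.
Variables (K : fieldType) (Q : quiver).
Implicit Types (x y : path_alg K Q) (p q : qpath Q) (v u : vert Q).
Implicit Types (w : seq (arr Q)) (a : arr Q).

Definition pcoef x p : K := val (x : Defs.fpath K Q) p.

Lemma pcoefP x y : (forall p, pcoef x p = pcoef y p) -> x = y.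
Proof. by move=> h; apply: val_inj; apply/funext. Qed.
Lemma pcoef0 p : pcoef 0 p = 0. Proof. by []. Qed.
Lemma pcoefD x y p : pcoef (x + y) p = pcoef x p + pcoef y p. Proof. by []. Qed.
Lemma pcoefB x y p : pcoef (x - y) p = pcoef x p - pcoef y p. Proof. by []. Qed.
Lemma pcoefZ b x p : pcoef (b *' x) p = b * pcoef x p.
Proof. exact: cp_strMl. Qed.
Lemma pcoefM x y p :
  pcoef (x * y) p
  = \sum_(0 <= i < (plen p).+1) pcoef x (ptake i p) * pcoef y (pdrop i p).
Proof. by []. Qed.
Lemma pcoef_sum (I : Type) (r : seq I) (F : I -> path_alg K Q) p :
  pcoef (\sum_(i <- r) F i) p = \sum_(i <- r) pcoef (F i) p.
Proof. by apply: (big_morph (pcoef^~ p)) => // x y; apply: pcoefD. Qed.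

(** The value 0 on words that are not composable makes the product formula
    [word_eltM] hold for all words. *)
Definition word_elt v w : path_alg K Q := oapp (@path_elt K Q) 0 (insub (v, w)).

Lemma pcoef_word v w q : pcoef (word_elt v w) q = (val q == (v, w))%:R.
Proof.
rewrite /word_elt /pcoef; case: insubP => [p _ ep|nc] /=.
  by rewrite path_eltE -(inj_eq val_inj) ep.
by case: eqP nc => // <-; rewrite (valP q).
Qed.

Lemma path_word p : path_elt K p = word_elt (val p).1 (val p).2.
Proof. by apply: pcoefP => q; rewrite pcoef_word /pcoef path_eltE -surjective_pairing. Qed.
Lemma triv_word v : triv_elt K v = word_elt v [::].
Proof. by apply: pcoefP => q; rewrite pcoef_word /pcoef path_eltE. Qed.
Lemma arr_word a : arr_elt K a = word_elt (src a) [:: a].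
Proof. by apply: pcoefP => q; rewrite pcoef_word /pcoef path_eltE. Qed.

Lemma word_eltM v w u w' :
  word_elt v w * word_elt u w'
  = if u == endpoint v w then word_elt v (w ++ w') else 0.
Proof.
apply: pcoefP => q; rewrite pcoefM.
transitivity (\sum_(0 <= i < (plen q).+1)
    ((i == size w) && (u == endpoint v w) && (val q == (v, w ++ w')))%:R : K).
  apply: eq_big_nat => i /andP[_ hi]; rewrite !pcoef_word -natrM mulnb.
  congr (nat_of_bool _)%:R; rewrite /= !xpair_eqE; apply/idP/idP.
    case/andP=> /andP[/eqP ev /eqP ew] /andP[/eqP eu /eqP ew'].
    rewrite -ew' -eu -ew -ev cat_take_drop -surjective_pairing.
    by rewrite size_takel // !eqxx.
  case/andP=> /andP[/eqP ei /eqP eu] /eqP eq.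
  rewrite eq /= ei take_size_cat // drop_size_cat // eu !eqxx //.
case: eqP => [eu|_]; last by rewrite big1 // => i _; rewrite andbF.
rewrite pcoef_word; case: eqP => [eq|_]; last by rewrite big1 // => i _; rewrite andbF.
rewrite (bigD1_seq (size w)) ?iota_uniq //=; last first.
  by rewrite mem_index_iota /= ltnS /plen eq size_cat leq_addr.
by rewrite eqxx big1 ?addr0 // => i /negPf ->.
Qed.

Lemma word_rcons v w a : word_elt v (rcons w a) = word_elt v w * arr_elt K a.
Proof.
rewrite arr_word word_eltM; case: eqP => [_|ne]; first by rewrite cats1.
apply: pcoefP => q; rewrite pcoef_word pcoef0; case: eqP => // eq.
by move: (valP q); rewrite eq -cats1 composable_cat /= andbT => /andP[_ /eqP].
Qed.

Lemma triv_mul v u : triv_elt K v * triv_elt K u = if v == u then triv_elt K v else 0.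
Proof. by rewrite !triv_word word_eltM eq_sym. Qed.

Lemma triv_sum : \sum_v triv_elt K v = 1 :> path_alg K Q.
Proof.
apply: pcoefP => q; rewrite pcoef_sum [RHS]/(plen q == 0%N)%:R.
under eq_bigr => v _ do rewrite triv_word pcoef_word.
rewrite (bigD1 (val q).1) //= big1 => [|v ne]; last first.
  by case: eqP => // e; rewrite e eqxx in ne.
by rewrite addr0 /plen; case: q => [[u w] cw] /=; rewrite xpair_eqE eqxx -size_eq0.
Qed.

Lemma triv_arr v a : triv_elt K v * arr_elt K a = if src a == v then arr_elt K a else 0.
Proof.
rewrite triv_word arr_word word_eltM /endpoint /=.
by case: eqP => [->|].
Qed.

Lemma arr_triv a v : arr_elt K a * triv_elt K v = if v == tgt a then arr_elt K a else 0.
Proof. by rewrite triv_word arr_word word_eltM. Qed.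

Lemma arr_mul0 a b : src b <> tgt a -> arr_elt K a * arr_elt K b = 0.
Proof. by move=> h; rewrite !arr_word word_eltM /endpoint /=; case: eqP. Qed.

Lemma path_decomp x (s : seq (qpath Q)) : uniq s ->
  (forall p, p \notin s -> pcoef x p = 0) ->
  x = \sum_(p <- s) pcoef x p *' path_elt K p.
Proof.
move=> us hs; apply: pcoefP => q; rewrite pcoef_sum.
under eq_bigr => p _ do rewrite pcoefZ [pcoef (path_elt K p) q]path_eltE.
case: (boolP (q \in s)) => qs; last first.
  rewrite hs // big1_seq // => p /andP[_ ps].
  by case: eqP ps qs => [-> ->|] //; rewrite mulr0.
rewrite (bigD1_seq q) //= eqxx mulr1 big1 ?addr0 // => p.
by rewrite eq_sym => /negPf ->; rewrite mulr0.
Qed.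

Lemma fin_supp x : exists2 s : seq (qpath Q), uniq s &
  forall p, p \notin s -> pcoef x p = 0.
Proof.
have /finitely_supportedP[s hs] := valP (x : Defs.fpath K Q).
by exists (undup s); [apply: undup_uniq | move=> p; rewrite mem_undup; apply: hs].
Qed.

(** Only closure under sums, products and scalars has to be checked, since every
    element is a combination of products of arrows. *)
Lemma path_alg_ind (P : path_alg K Q -> Prop) : P 0 ->
  (forall v, P (triv_elt K v)) -> (forall a, P (arr_elt K a)) ->
  (forall x y, P x -> P y -> P (x + y)) ->
  (forall x y, P x -> P y -> P (x * y)) ->
  (forall b x, P x -> P (b *' x)) -> forall x, P x.
Proof.
move=> P0 Pt Pa PD PM PZ x; have [s us hs] := fin_supp x.
rewrite (path_decomp us hs); elim/big_rec: _ => [|p y _ Py] //.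
apply: PD => //; apply: PZ; rewrite path_word.
elim/last_ind: (_.2) => [|w a IH]; first by rewrite -triv_word.
by rewrite word_rcons; apply: PM.
Qed.

End PathAlgebra.

(** * Universal property of the path algebra *)

Section MatrixAlgebra.
Variables (K : fieldType) (d : nat).

Lemma scalar_mx_central (a : K) (x : 'M[K]_d) : a%:M * x = x * a%:M.
Proof. exact: esym (scalar_mxC a x). Qed.

Definition mx_alg : assocAlg K :=
  @AssocAlg K ('M[K]_d : pzRingType) (@scalar_mx K d : {rmorphism K -> 'M[K]_d})
    scalar_mx_central.

Lemma mx_alg_scale a (x : mx_alg) : a *' x = a *: (x : 'M[K]_d).
Proof. exact: mul_scalar_mx. Qed.
End MatrixAlgebra.

Section UniversalProperty.
Variables (K : fieldType) (Q : quiver) (S : assocAlg K).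
Variables (E : vert Q -> S) (X : arr Q -> S).
Hypothesis EE : forall v u, E v * E u = if v == u then E v else 0.
Hypothesis E1 : \sum_v E v = 1.
Hypothesis EX : forall a, E (src a) * X a = X a.
Hypothesis XE : forall a, X a * E (tgt a) = X a.

Definition ext_word v w : S := E v * \prod_(a <- w) X a.
Definition ext_path (p : qpath Q) : S := ext_word (val p).1 (val p).2.

Lemma ext_word_end v w : composable v w ->
  ext_word v w * E (endpoint v w) = ext_word v w.
Proof.
rewrite /ext_word; elim/last_ind: w => [|w a _]; first by rewrite big_nil mulr1 EE eqxx.
move=> _; rewrite -cats1 endpoint_cat big_cat big_seq1 -!mulrA.
by rewrite [endpoint _ [:: a]]/= XE.
Qed.

Lemma ext_wordM v w u w' : composable v w -> composable u w' ->
  ext_word v w * ext_word u w'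
  = if u == endpoint v w then ext_word v (w ++ w') else 0.
Proof.
move=> cw cw'; rewrite -(ext_word_end cw) {2}/ext_word mulrA -(mulrA _ _ (E u)).
rewrite EE eq_sym; case: eqP => _; last by rewrite mulr0 mul0r.
by rewrite ext_word_end // /ext_word big_cat mulrA.
Qed.

Definition path_supp (x : path_alg K Q) : seq (qpath Q) :=
  projT1 (cid2 (fin_supp x)).

Definition ext (x : path_alg K Q) : S :=
  \sum_(p <- path_supp x) pcoef x p *' ext_path p.

(** The sum over a chosen support may be taken over any larger list, which is
    what makes [ext] additive. *)
Lemma extE x s : uniq s -> (forall p, p \notin s -> pcoef x p = 0) ->
  ext x = \sum_(p <- s) pcoef x p *' ext_path p.
Proof.
move=> us hs; rewrite /ext /path_supp; case: cid2 => r /= ur hr.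
have sub t1 t2 : uniq t1 -> uniq t2 -> (forall p, p \notin t1 -> pcoef x p = 0) ->
    (forall p, p \notin t2 -> pcoef x p = 0) ->
    \sum_(p <- t1) pcoef x p *' ext_path p
    = \sum_(p <- [seq p <- t1 | p \in t2]) pcoef x p *' ext_path p.
  move=> _ _ _ h2; rewrite big_filter [LHS](bigID (mem t2)) /=.
  by rewrite [X in _ + X]big1 ?addr0 // => p /h2 ->; rewrite alg_scale0.
rewrite (sub r s) // (sub s r) //; apply: perm_big.
by apply: uniq_perm; rewrite ?filter_uniq // => p; rewrite !mem_filter andbC.
Qed.

Lemma ext_common (x y : path_alg K Q) : exists s : seq (qpath Q), [/\ uniq s,
  forall p, p \notin s -> pcoef x p = 0 & forall p, p \notin s -> pcoef y p = 0].
Proof.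
have [s us hs] := fin_supp x; have [r ur hr] := fin_supp y.
exists (undup (s ++ r)); split; first exact: undup_uniq.
  by move=> p; rewrite mem_undup mem_cat negb_or => /andP[/hs].
by move=> p; rewrite mem_undup mem_cat negb_or => /andP[_ /hr].
Qed.

Lemma extB : zmod_morphism ext.
Proof.
move=> x y; have [s [us hx hy]] := ext_common x y.
rewrite (extE us hx) (extE us hy) (extE us (x := x - y)); last first.
  by move=> p ps; rewrite pcoefB hx // hy // subrr.
rewrite -sumrB; apply: eq_bigr => p _; rewrite pcoefB.
by rewrite alg_scaleDl /alg_scale rmorphN mulNr.
Qed.
HB.instance Definition _ := GRing.isZmodMorphism.Build (path_alg K Q) S ext extB.

Lemma extZ b x : ext (b *' x) = b *' ext x.
Proof.
have [s us hs] := fin_supp x.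
rewrite (extE us hs) (extE us (x := b *' x)); last first.
  by move=> p ps; rewrite pcoefZ hs ?mulr0.
by rewrite alg_scale_sum; apply: eq_bigr => p _; rewrite pcoefZ alg_scaleA.
Qed.

Lemma ext_wordE v w : ext (word_elt K v w) = if composable v w then ext_word v w else 0.
Proof.
rewrite /word_elt; case: insubP => [p cw ep|/negPf nc] /=; last by rewrite raddf0 nc.
rewrite cw (extE (s := [:: p])) //; last first.
  by move=> q; rewrite inE /pcoef path_eltE => /negPf ->.
by rewrite big_seq1 /pcoef path_eltE eqxx alg_scale1 /ext_path ep.
Qed.

Lemma extM : monoid_morphism ext.
Proof.
split.
  rewrite -triv_sum raddf_sum -E1; apply: eq_bigr => v _.
  by rewrite /= triv_word ext_wordE /ext_word big_nil mulr1.
move=> x y; have [s us hs] := fin_supp x; have [r ur hr] := fin_supp y.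
rewrite [x in LHS](path_decomp us hs) [y in LHS](path_decomp ur hr).
rewrite mulr_suml raddf_sum (extE us hs) mulr_suml; apply: eq_bigr => p _.
rewrite mulr_sumr raddf_sum (extE ur hr) mulr_sumr; apply: eq_bigr => q _.
rewrite !alg_scaleAl !alg_scaleAr /= !extZ; congr (_ *' (_ *' _)).
rewrite !path_word word_eltM /ext_path ext_wordM ?(valP p) ?(valP q) //.
case: eqP => [e|_]; last by rewrite raddf0.
by rewrite ext_wordE composable_cat (valP p) -e (valP q).
Qed.
HB.instance Definition _ := GRing.isMonoidMorphism.Build (path_alg K Q) S ext extM.

Lemma ext_triv v : ext (triv_elt K v) = E v.
Proof. by rewrite triv_word ext_wordE /ext_word big_nil mulr1. Qed.
Lemma ext_arr a : ext (arr_elt K a) = X a.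
Proof. by rewrite arr_word ext_wordE /= eqxx /ext_word big_seq1 EX. Qed.

(** The path algebra is freely generated by its arrows over the trivial paths:
    this produces both the automorphisms that rescale the arrows and the matrix
    representations. *)
Lemma path_alg_univ : exists F : {rmorphism path_alg K Q -> S},
  [/\ forall b x, F (b *' x) = b *' F x,
      forall v, F (triv_elt K v) = E v & forall a, F (arr_elt K a) = X a].
Proof.
by exists (ext : {rmorphism path_alg K Q -> S}); split;
  [apply: extZ | apply: ext_triv | apply: ext_arr].
Qed.

End UniversalProperty.

(** * The permutations f and g, and paths along g *)

Section Combinatorics.
Variables (R : ribbonQuiver) (m : arr R -> nat).
Implicit Types a b : arr R.
Local Notation g := (@rq_g R).
Local Notation f := (@rq_f R).
Local Notation bar := (@rq_bar R).

(** The length of a full power of the g-cycle through a; the paths along g of this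
    length span the socle. *)
Definition len a : nat := (m a * rq_n a)%N.

Lemma src_bar a : src (bar a) = src a. Proof. by case: (rq_barP a). Qed.
Lemma bar_neq a : (bar a == a) = false. Proof. by apply/eqP; case: (rq_barP a). Qed.
Lemma src_eq a b : src a = src b -> a = b \/ a = bar b.
Proof. by move=> e; case: (eqVneq a b) => [|/eqP] ?; [left | right; apply: rq_bar_unique]. Qed.
Lemma src_f a : src (f a) = tgt a. Proof. exact: rq_fP. Qed.
Lemma src_g a : src (g a) = tgt a. Proof. by rewrite src_bar src_f. Qed.
Lemma bar_f a : bar (f a) = g a. Proof. by []. Qed.
Lemma bar_g a : bar (g a) = f a. Proof. exact: rq_barK. Qed.
Lemma g_neq_f a : (g a == f a) = false. Proof. exact: bar_neq. Qed.
Lemma f_neq_g a : (f a == g a) = false. Proof. by rewrite eq_sym g_neq_f. Qed.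

Lemma src_tgt a b : src a = tgt b -> a = g b \/ a = f b.
Proof. by rewrite -src_g => /src_eq[]; rewrite ?bar_g; [left | right]. Qed.

Lemma arrow_exists (v : vert R) : exists a : arr R, src a = v.
Proof.
have := rq_out v; case: (pickP [pred a : arr R | src a == v]) => [a /eqP <- _|e].
  by exists a.
by rewrite eq_card0.
Qed.
Definition arrow_at (v : vert R) : arr R := projT1 (cid (arrow_exists v)).
Lemma src_arrow_at (v : vert R) : src (arrow_at v) = v.
Proof. exact: projT2 (cid (arrow_exists v)). Qed.

Lemma n_g a : rq_n (g a) = rq_n a.
Proof. exact: order_id_cycle (cycle_orbit (@rq_g_inj R) a). Qed.

Lemma iter_n a : iter (rq_n a) g a = a. Proof. by case: (rq_nP a). Qed.

Lemma iter_len a : iter (len a) g a = a.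
Proof. by rewrite /len; elim: (m a) => // k IH; rewrite mulSn iterD IH iter_n. Qed.

Hypothesis m_inv : g_invariant m.
Lemma len_g a : len (g a) = len a. Proof. by rewrite /len n_g m_inv. Qed.
Lemma len_iter k a : len (iter k g a) = len a.
Proof. by elim: k => //= k IH; rewrite len_g. Qed.

Hypothesis m_adm : admissible m.
Lemma len_ge3 a : (3 <= len a)%N. Proof. exact: m_adm. Qed.
Lemma len_gt0 a : (0 < len a)%N. Proof. exact: leq_trans (m_adm a). Qed.
Lemma len_predK a : (len a).-1.+1 = len a. Proof. exact: prednK (len_gt0 a). Qed.

(** The last arrow of the g-cycle through a is the one after which f would turn
    into the other arrow at the source of a. *)
Lemma iter_last a : f (iter (len a).-1 g a) = bar a.
Proof. by apply: (inv_inj (@rq_barK R)); rewrite rq_barK bar_f -iterS len_predK iter_len. Qed.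

Hypothesis tri : triangulation R.
Lemma iter_last_bar a : iter (len (bar a)).-1 g (bar a) = f (f a).
Proof. by apply: (@rq_f_inj R); rewrite iter_last rq_barK tri. Qed.

Lemma g_ff a : g (f (f a)) = bar a. Proof. by rewrite /rq_g tri. Qed.

End Combinatorics.

Fact gpath_key : unit. Proof. exact: tt. Qed.

Section GPaths.
Variables (K : fieldType) (R : ribbonQuiver).
Implicit Types (a b : arr R) (v : vert R).
Local Notation g := (@rq_g R).
Local Notation f := (@rq_f R).
Local Notation bar := (@rq_bar R).
Local Notation x_ a := (arr_elt K a).

(* Locked, as unification would otherwise unfold a g-path into a product. *)
Definition gpath a k : path_alg K R :=
  locked_with gpath_key (triv_elt K (src a) * \prod_(i < k) x_ (iter i g a)).

Lemma gpathE a k :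
  gpath a k = triv_elt K (src a) * \prod_(i < k) x_ (iter i g a).
Proof. by rewrite /gpath unlock. Qed.

Lemma gpath0 a : gpath a 0 = triv_elt K (src a).
Proof. by rewrite gpathE big_ord0 mulr1. Qed.
Lemma gpathS a k : gpath a k.+1 = gpath a k * x_ (iter k g a).
Proof. by rewrite !gpathE big_ord_recr mulrA. Qed.
Lemma gpath1 a : gpath a 1 = x_ a.
Proof. by rewrite gpathS gpath0 triv_arr eqxx. Qed.

Lemma gpath_end a k : gpath a k * triv_elt K (src (iter k g a)) = gpath a k.
Proof.
case: k => [|k]; first by rewrite gpath0 triv_mul eqxx.
by rewrite gpathS -mulrA arr_triv src_g eqxx.
Qed.

Lemma gpathD a k l : gpath a (k + l) = gpath a k * gpath (iter k g a) l.
Proof.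
elim: l => [|l IH]; first by rewrite addn0 gpath0 gpath_end.
by rewrite addnS !gpathS IH -iterD addnC mulrA.
Qed.

Lemma gpathSl a k : gpath a k.+1 = x_ a * gpath (g a) k.
Proof. by rewrite -add1n gpathD gpath1. Qed.

Lemma triv_gpath v a k : triv_elt K v * gpath a k = if v == src a then gpath a k else 0.
Proof.
by rewrite gpathE mulrA triv_mul; case: eqP => [->|_]; rewrite ?mul0r.
Qed.

Lemma omega_gpath a : omega K a = gpath a (rq_n a).
Proof.
rewrite /omega gpathE; case: (rq_nP a) => n0 _ _; case: (rq_n a) n0 => // n _.
by rewrite big_ord_recl mulrA triv_arr eqxx.
Qed.

Lemma omegaX a k l : omega K a ^+ k * gpath a l = gpath a (k * rq_n a + l).
Proof.
elim: k => [|k IH]; first by rewrite mul1r.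
by rewrite exprS -mulrA IH omega_gpath mulSn -addnA (gpathD a (rq_n a)) iter_n.
Qed.

Variable m : arr R -> nat.
Hypothesis m_gt0 : forall a, (0 < m a)%N.

Lemma omega_len a : omega K a ^+ m a = gpath a (len m a).
Proof.
rewrite -(prednK (m_gt0 a)) exprSr [X in _ * X]omega_gpath omegaX /len.
by rewrite -{2}(prednK (m_gt0 a)) mulSn addnC.
Qed.

Lemma omega'_len a : omega K a ^+ (m a).-1 * omega' K a = gpath a (len m a).-1.
Proof.
rewrite -[X in _ * X]gpathE omegaX /len.
rewrite -{2}(prednK (m_gt0 a)) mulSn addnC; congr gpath.
by case: (rq_nP a) => n0 _ _; case: (rq_n a) n0.
Qed.

End GPaths.

(** * The relations *)

Section TurnIdeal.
Variables (K : fieldType) (R : ribbonQuiver).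
Variables (m : arr R -> nat) (c : arr R -> K) (tau sigma : arr R -> K).
Implicit Types a b : arr R.
Local Notation g := (@rq_g R).
Local Notation f := (@rq_f R).
Local Notation bar := (@rq_bar R).
Local Notation x_ a := (arr_elt K a).
Local Notation gp := (gpath K).
Local Notation len := (len m).

(** The common shape of the relations of the algebras at hand: a turn by f equals
    tau times the g-path from the other arrow that stops one arrow before the
    socle, plus sigma times the socle. The Brauer graph algebra is the case
    tau = sigma = 0. *)
Inductive turn_rel : path_alg K R -> Prop :=
| TurnRel a : turn_rel (x_ a * x_ (f a)
    - (tau a * c (bar a)) *' gp (bar a) (len (bar a)).-1
    - (sigma a * c (bar a)) *' gp (bar a) (len (bar a)))
| TurnZero a : turn_rel (x_ a * x_ (f a) * x_ (g (f a)))
| TurnCommut a : turn_rel (c a *' gp a (len a) - c (bar a) *' gp (bar a) (len (bar a))).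

Definition turn_ideal : ideal (path_alg K R) := gen_ideal turn_rel.

End TurnIdeal.

(** * The exponents of the family *)

Section Exponents.
Variables (R : ribbonQuiver) (m : arr R -> nat).
Hypotheses (m_adm : admissible m) (m_inv : g_invariant m).
Implicit Types a : arr R.
Local Notation f := (@rq_f R).
Local Notation g := (@rq_g R).
Local Notation len := (len m).

(** Giving the arrow a the weight W a, all socle paths get the weight M. *)
Definition balanced (W : arr R -> nat) (M : nat) : Prop :=
  forall a, (\sum_(i < len a) W (iter i g a))%N = M.

Definition uniform_weight a : nat := (tri_N m %/ len a)%N.
Local Notation W := uniform_weight.

Lemma len_dvd a : (len a %| tri_N m)%N.
Proof. by rewrite /tri_N (bigD1 a) //= dvdn_lcml. Qed.

Lemma tri_N_gt0 : (0 < tri_N m)%N.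
Proof.
rewrite /tri_N; elim/big_rec: _ => // a x _ x0.
by rewrite lcmn_gt0 x0 (len_gt0 m_adm).
Qed.

Lemma uniform_gt0 a : (0 < W a)%N.
Proof. by rewrite divn_gt0 ?(len_gt0 m_adm) // dvdn_leq ?tri_N_gt0 ?len_dvd. Qed.

Lemma uniform_balanced : balanced W (tri_N m).
Proof.
move=> a; under eq_bigr => i _ do rewrite /W len_iter //.
by rewrite sum_nat_const card_ord mulnC divnK ?len_dvd.
Qed.

Lemma uniform_le3 a : (3 * W a <= tri_N m)%N.
Proof.
rewrite -[X in (_ <= X)%N](divnK (len_dvd a)) mulnC.
by rewrite leq_mul2l (len_ge3 m_adm) orbT.
Qed.

Lemma uniform_le a : (W a + W (f a) + W (f (f a)) <= tri_N m)%N.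
Proof. by have := uniform_le3 a; have := uniform_le3 (f a); have := uniform_le3 (f (f a)); lia. Qed.

Lemma uniform_ratE a : (tri_N m)%:R * (m a * rq_n a)%N%:R^-1 = (W a)%:R :> rat.
Proof.
by rewrite /W natr_div ?len_dvd // unitfE pnatr_eq0 -lt0n (len_gt0 m_adm).
Qed.

Lemma tri_eE a : (tri_N m)%:R * tri_e m a
  = (tri_N m - (W a + W (f a) + W (f (f a))))%N%:R.
Proof.
rewrite natrB ?uniform_le // !natrD /tri_e /= mulrBr mulr1 !mulrDr.
by congr (_ - (_ + _ + _)); apply: uniform_ratE.
Qed.

Lemma tri_e'E a : (tri_N m)%:R * tri_e' m a = (tri_N m - 2 * W a)%N%:R.
Proof.
rewrite natrB; last by have := uniform_le3 a; lia.
by rewrite /tri_e' mulrBr mulr1 [in RHS]natrM mulrCA; congr (_ - _ * _); apply: uniform_ratE.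
Qed.

Lemma tri_NeE a : tri_Ne m a = (tri_N m - (W a + W (f a) + W (f (f a))))%N.
Proof. by rewrite /tri_Ne tri_eE Num.Theory.natrK. Qed.
Lemma tri_Ne'E a : tri_Ne' m a = (tri_N m - 2 * W a)%N.
Proof. by rewrite /tri_Ne' tri_e'E Num.Theory.natrK. Qed.

Lemma tri_Ne'_gt0 a : (0 < tri_N m - 2 * W a)%N.
Proof. by have := uniform_le3 a; have := tri_N_gt0; lia. Qed.

End Exponents.

Section SpecialTurnIdeals.
Variables (K : fieldType) (R : ribbonQuiver).
Variables (m : arr R -> nat) (c : arr R -> K) (lam : f_fixed R -> K).
Hypotheses (m_gt0 : forall a, (0 < m a)%N) (m_adm : admissible m)
  (m_inv : g_invariant m).
Local Notation f := (@rq_f R).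
Local Notation bar := (@rq_bar R).
Local Notation x_ a := (arr_elt K a).

(** Extending lam by 0 allows one formula for the relations at fixed and at
    moved arrows. *)
Definition lam_ext (a : arr R) : K := oapp lam 0 (insub a : option (f_fixed R)).

Lemma lam_extE a (fa : f a == a) : lam_ext a = lam (exist _ a fa).
Proof. by rewrite /lam_ext (insubT (fun a => f a == a) fa). Qed.
Lemma lam_ext0 a : f a != a -> lam_ext a = 0.
Proof. by move=> fa; rewrite /lam_ext insubN. Qed.

Lemma deform_turn t x : deform_ideal m c lam t x <->
  turn_ideal m c (fun a => t ^+ tri_Ne m a) (fun a => lam_ext a * t ^+ tri_Ne' m a) x.
Proof.
split; apply: gen_ideal_min => {}x.
- case=> [a fa|a fa|a|a]; apply: gen_ideal_in.
  + rewrite omega'_len // -[a in c a]rq_barK -[a in gpath K a]rq_barK.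
    rewrite -[a in len m a]rq_barK.
    have := TurnRel m c (fun a => t ^+ tri_Ne m a)
      (fun a => lam_ext a * t ^+ tri_Ne' m a) (bar a).
    by rewrite lam_ext0 // !mul0r alg_scale0 subr0 [_ * c _]mulrC.
  + rewrite omega'_len // omega_len // -!lam_extE.
    have := TurnRel m c (fun a => t ^+ tri_Ne m a)
      (fun a => lam_ext a * t ^+ tri_Ne' m a) (bar a).
    by rewrite !rq_barK (eqP fa) -expr2 [t ^+ _ * c a]mulrC
      [lam_ext _ * _ * c a]mulrC mulrA.
  + exact: TurnZero.
  + by rewrite !omega_len //; apply: TurnCommut.
- case=> [a|a|a]; apply: gen_ideal_in.
  + have [fa|fa] := boolP (f a == a).
      have fb : f (bar (bar a)) == bar (bar a) by rewrite rq_barK.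
      have := DefRelFixed m c lam t fb.
      rewrite omega'_len // omega_len // -lam_extE !rq_barK (eqP fa) -expr2.
      by rewrite [c _ * t ^+ tri_Ne m a]mulrC -[_ * t ^+ tri_Ne' m a]mulrA
        [c _ * (_ * _)]mulrC.
    have := @DefRel K R m c lam t (bar a); rewrite rq_barK => /(_ fa).
    by rewrite omega'_len // lam_ext0 // !mul0r alg_scale0 subr0 [c _ * _]mulrC.
  + exact: DefRelZero.
  + by rewrite -!omega_len //; apply: DefRelCommut.
Qed.

Lemma brauer_turn x : gen_ideal (brauer_rel m c) x <->
  turn_ideal m c (fun=> 0) (fun=> 0) x.
Proof.
split; apply: gen_ideal_min => {}x.
- case=> [a|a].
  + apply: gen_ideal_in.
    by have := TurnRel m c (fun=> 0) (fun=> 0) a; rewrite !mul0r !alg_scale0 !subr0.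
  + by apply: gen_ideal_in; rewrite !omega_len //; apply: TurnCommut.
- case=> [a|a|a].
  + by apply: gen_ideal_in; rewrite !mul0r !alg_scale0 !subr0; apply: BrauerZero.
  + by apply: ideal_Mr; apply: gen_ideal_in; apply: BrauerZero.
  + by apply: gen_ideal_in; rewrite -!omega_len //; apply: BrauerCommut.
Qed.

Lemma turn_ideal_ext tau sigma tau' sigma' x : tau =1 tau' -> sigma =1 sigma' ->
  turn_ideal m c tau sigma x <-> turn_ideal m c tau' sigma' x.
Proof. by move=> /funext -> /funext ->. Qed.

(** At t = 0 all the powers of t vanish, as their exponents are positive. *)
Lemma deform0_iso : (forall a : arr R, 0 < (tri_N m)%:R * tri_e m a) ->
  alg_iso (deform_alg m c lam 0) (brauer_graph_alg m c).
Proof.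
move=> e_gt0; apply: eq_ideal_iso => x; rewrite deform_turn brauer_turn.
apply: turn_ideal_ext => a.
  have := e_gt0 a; rewrite tri_eE // tri_NeE // ltr0n => e0.
  by rewrite expr0n eqn0Ngt e0.
by rewrite tri_Ne'E // expr0n eqn0Ngt tri_Ne'_gt0 ?mulr0.
Qed.

Lemma deform1_turn x : deform_ideal m c lam 1 x <->
  turn_ideal m c (fun=> 1) lam_ext x.
Proof.
by rewrite deform_turn; apply: turn_ideal_ext => a; rewrite !expr1n ?mulr1.
Qed.

End SpecialTurnIdeals.

(** * Rescaling the arrows *)

Section Rescaling.
Variables (K : fieldType) (Q : quiver).
Local Notation A := (path_alg K Q).

Lemma path_mor_ext (S : assocAlg K) (F G : {rmorphism A -> S}) :
  (forall b x, F (b *' x) = b *' F x) -> (forall b x, G (b *' x) = b *' G x) ->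
  (forall v, F (triv_elt K v) = G (triv_elt K v)) ->
  (forall a, F (arr_elt K a) = G (arr_elt K a)) -> F =1 G.
Proof.
move=> FZ GZ Fv Fa; apply: path_alg_ind => //; first by rewrite !rmorph0.
- by move=> x y ex ey; rewrite !rmorphD ex ey.
- by move=> x y ex ey; rewrite !rmorphM ex ey.
- by move=> b x ex; rewrite FZ GZ ex.
Qed.

Lemma rescaling_exists (u : arr Q -> K) : exists F : {rmorphism A -> A},
  [/\ forall b x, F (b *' x) = b *' F x,
      forall v, F (triv_elt K v) = triv_elt K v &
      forall a, F (arr_elt K a) = u a *' arr_elt K a].
Proof.
apply: path_alg_univ => [v w||a|a]; first exact: triv_mul.
- exact: triv_sum.
- by rewrite alg_scaleAr triv_arr eqxx.
- by rewrite alg_scaleAl arr_triv eqxx.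
Qed.

Definition rescaling (u : arr Q -> K) : {rmorphism A -> A} :=
  projT1 (cid (rescaling_exists u)).

Lemma rescalingP (u : arr Q -> K) :
  [/\ forall b x, rescaling u (b *' x) = b *' rescaling u x,
      forall v, rescaling u (triv_elt K v) = triv_elt K v &
      forall a, rescaling u (arr_elt K a) = u a *' arr_elt K a].
Proof. exact: projT2 (cid (rescaling_exists u)). Qed.

Lemma rescalingK (u : arr Q -> K) : (forall a, u a != 0) ->
  cancel (rescaling u) (rescaling (fun a => (u a)^-1)).
Proof.
move=> u0 x; have [FZ Fv Fa] := rescalingP u.
have [GZ Gv Ga] := rescalingP (fun a => (u a)^-1).
apply: (@path_mor_ext _
  (rescaling (fun a => (u a)^-1) \o rescaling u : {rmorphism A -> A})
  (idfun : {rmorphism A -> A})) => [b y|//|v|a] /=.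
- by rewrite FZ GZ.
- by rewrite Fv Gv.
- by rewrite Fa GZ Ga alg_scaleA mulfV // alg_scale1.
Qed.

Lemma rescaling_bij (u : arr Q -> K) : (forall a, u a != 0) -> bijective (rescaling u).
Proof.
move=> u0; exists (rescaling (fun a => (u a)^-1)); first exact: rescalingK.
have := @rescalingK (fun a => (u a)^-1) (fun a => invr_neq0 (u0 a)).
by rewrite (_ : (fun a => (u a)^-1^-1) = u) //; apply/funext => a; rewrite invrK.
Qed.

End Rescaling.

Section RescaledIdeal.
Variables (K : fieldType) (R : ribbonQuiver).
Variables (m : arr R -> nat) (c lamx : arr R -> K).
Hypotheses (m_adm : admissible m) (tri : triangulation R)
  (lam0 : forall a : arr R, rq_f a != a -> lamx a = 0).
Variables (W : arr R -> nat) (M : nat).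
Hypotheses (W_bal : balanced m W M)
  (W_le : forall a, (W a + W (rq_f a) + W (rq_f (rq_f a)) <= M)%N).
Local Notation f := (@rq_f R).
Local Notation g := (@rq_g R).
Local Notation bar := (@rq_bar R).
Local Notation x_ a := (arr_elt K a).
Local Notation len := (len m).

(** The weight gained when the turn at a is replaced by the g-path of length
    [len (bar a) - 1]: the arrow f (f a) would complete this g-path to one of
    weight M. *)
Definition defect a : nat := (M - (W a + W (f a) + W (f (f a))))%N.
Definition weighted_ideal (s : K) : ideal (path_alg K R) :=
  turn_ideal m c (fun a => s ^+ defect a) (fun a => lamx a * s ^+ (M - 2 * W a)).

Definition gpath_weight (a : arr R) k : nat := (\sum_(i < k) W (iter i g a))%N.

Lemma gpath_weight_last a : (gpath_weight (bar a) (len (bar a)).-1 + W (f (f a)))%N = M.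
Proof.
have <- : gpath_weight (bar a) (len (bar a)) = M by apply: W_bal.
rewrite -{2}(len_predK m_adm (bar a)) /gpath_weight big_ord_recr /=.
by rewrite (iter_last_bar m_adm tri).
Qed.

Lemma rescaling_gpath u a k :
  rescaling (fun a => u ^+ W a) (gpath K a k) = u ^+ gpath_weight a k *' gpath K a k.
Proof.
have [FZ Fv Fa] := rescalingP (fun a : arr R => u ^+ W a).
elim: k => [|k IH]; first by rewrite gpath0 Fv /gpath_weight big_ord0 alg_scale1.
rewrite gpathS rmorphM IH Fa /gpath_weight big_ord_recr /= exprD.
by rewrite alg_scaleAl alg_scaleAr alg_scaleA.
Qed.

(** Rescaling multiplies both sides of every relation by a common power of u,
    once the missing powers of u are absorbed in those of s. *)
Lemma rescaling_ideal s u x : weighted_ideal s x ->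
  weighted_ideal (s * u) (rescaling (fun a => u ^+ W a) x).
Proof.
have [FZ Fv Fa] := rescalingP (fun a : arr R => u ^+ W a).
apply: (@gen_ideal_min _ _ (pullback (rescaling (fun a => u ^+ W a)) (weighted_ideal (s * u)))).
move=> {}x hx; change (weighted_ideal (s * u) (rescaling (fun a => u ^+ W a) x)).
case: hx => {x} a.
- have rel := gen_ideal_in (TurnRel m c (fun a => (s * u) ^+ defect a)
    (fun a => lamx a * (s * u) ^+ (M - 2 * W a)) a).
  have := ideal_scale (u ^+ (W a + W (f a))) rel; congr (in_ideal _ _).
  rewrite !rmorphB rmorphM !FZ !Fa !rescaling_gpath !alg_scaleBr.
  rewrite !alg_scaleAl !alg_scaleAr !alg_scaleA; congr (_ *' _ - _ *' _ - _ *' _).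
  + by rewrite exprD.
  + have -> : gpath_weight (bar a) (len (bar a)).-1 = (W a + W (f a) + defect a)%N.
      by have := gpath_weight_last a; have := W_le a; rewrite /defect; lia.
    by rewrite !exprD exprMn; ring.
  + have -> : gpath_weight (bar a) (len (bar a)) = M by apply: W_bal.
    have [fa|fa] := eqVneq (f a) a; last by rewrite lam0 // !(mul0r, mulr0).
    have -> : u ^+ M = u ^+ (W a + W a) * u ^+ (M - 2 * W a).
      by rewrite -exprD; congr (_ ^+ _); have := W_le a; rewrite fa; lia.
    by rewrite exprMn fa; ring.
- rewrite !rmorphM !Fa !(alg_scaleAl, alg_scaleAr, alg_scaleA).
  by apply: ideal_scale; apply: gen_ideal_in; apply: TurnZero.
- rewrite rmorphB !FZ !rescaling_gpath [gpath_weight _ _]W_bal [gpath_weight (bar a) _]W_bal.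
  rewrite !alg_scaleA ![_ * u ^+ M]mulrC -!alg_scaleA -alg_scaleBr.
  by apply: ideal_scale; apply: gen_ideal_in; apply: TurnCommut.
Qed.

Lemma rescaling_idealP t y : t != 0 -> weighted_ideal t y <->
  exists2 x, weighted_ideal 1 x & y = rescaling (fun a => t ^+ W a) x.
Proof.
move=> t0; have t0' : t^-1 != 0 by rewrite invr_neq0.
split=> [Iy|[x Ix ->]]; last by rewrite -[t in weighted_ideal t]mul1r; apply: rescaling_ideal.
exists (rescaling (fun a => t^-1 ^+ W a) y).
  by rewrite -(mulfV t0); apply: rescaling_ideal.
have := @rescalingK K R (fun a => t^-1 ^+ W a) (fun a => expf_neq0 _ t0') y.
rewrite (_ : (fun a => (t^-1 ^+ W a)^-1) = (fun a => t ^+ W a)) //.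
by apply/funext => a; rewrite exprVn invrK.
Qed.

End RescaledIdeal.

Section PartC.
Variables (K : fieldType) (R : ribbonQuiver).
Variables (m : arr R -> nat) (c : arr R -> K) (lam : f_fixed R -> K).
Hypotheses (tri : triangulation R) (m_gt0 : forall a, (0 < m a)%N)
  (m_inv : g_invariant m) (m_adm : admissible m).
Local Notation W := (uniform_weight m).

Lemma deform_weighted t x : deform_ideal m c lam t x <->
  weighted_ideal m c (lam_ext lam) W (tri_N m) t x.
Proof.
by rewrite deform_turn //; apply: turn_ideal_ext => a; rewrite ?tri_NeE ?tri_Ne'E.
Qed.

Lemma deform_rescaling t y : t != 0 -> deform_ideal m c lam t y <->
  exists2 x, deform_ideal m c lam 1 x & y = rescaling (fun a => t ^+ W a) x.
Proof.
move=> t0; rewrite deform_weighted rescaling_idealP //.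
- by split=> -[x Ix ->]; exists x => //; apply/deform_weighted.
- by move=> a; apply: lam_ext0.
- exact: uniform_balanced.
- exact: uniform_le.
Qed.

Lemma deform_iso t : t != 0 ->
  alg_iso (deform_alg m c lam 1) (deform_alg m c lam t).
Proof.
move=> t0; have [FZ _ _] := rescalingP (fun a : arr R => t ^+ W a).
have [G FK GK] := @rescaling_bij K R (fun a => t ^+ W a) (fun a => expf_neq0 _ t0).
apply: (@first_iso _ _ _ _ (@quot_pi _ (deform_ideal m c lam t)
  \o rescaling (fun a => t ^+ W a) : {rmorphism path_alg K R -> deform_alg m c lam t})).
- by move=> b x; rewrite /= FZ -quot_piZ.
- move=> y; exists (G (@quot_repr _ (deform_ideal m c lam t) y)).
  by rewrite /= GK quot_reprK.
- move=> x; rewrite /= quot_pi0P deform_rescaling //.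
  by split=> [[z Iz /(can_inj FK) ->]|Ix] //; exists x.
Qed.

End PartC.

(** * A matrix representation of the quotient *)

Section Representation.
Variables (K : fieldType) (R : ribbonQuiver).
Variables (m : arr R -> nat) (c tau sigma : arr R -> K).
Hypotheses (m_inv : g_invariant m) (m_adm : admissible m)
  (tri : triangulation R) (c_neq0 : forall a, c a != 0) (c_inv : g_invariant c).
Hypotheses (tau_f : forall a, tau (rq_f a) = tau a)
  (sigma_fixed : forall a, rq_f a != a -> sigma a = 0).
Local Notation f := (@rq_f R).
Local Notation g := (@rq_g R).
Local Notation bar := (@rq_bar R).
Local Notation x_ a := (arr_elt K a).
Local Notation len := (len m).
Implicit Types (a b e : arr R) (v w : vert R).

(** The trivial paths, one socle element at each vertex, and the g-paths that are
    neither trivial nor in the socle; the index i at an arrow stands for the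
    g-path of length i + 1 from it. *)
Definition turn_basis : finType :=
  ((vert R + vert R) + {a : arr R & 'I_(len a).-1})%type.
Local Notation d := #|turn_basis|.

Definition bvec (s : turn_basis) : 'rV[K]_d := delta_mx 0 (enum_rank s).
Definition mx_of (F : turn_basis -> 'rV[K]_d) : 'M[K]_d := \matrix_i F (enum_val i).

Lemma mx_ofE F s : bvec s *m mx_of F = F s.
Proof. by rewrite -rowE rowK enum_rankK. Qed.

Lemma mx_basisP (A B : 'M[K]_d) :
  (forall s, bvec s *m A = bvec s *m B) -> A = B.
Proof. by move=> h; apply/row_matrixP => i; rewrite !rowE -(enum_valK i) h. Qed.

Definition evec v := bvec (inl (inl v)).
Definition svec v := bvec (inl (inr v)).

(** The vector of the g-path of length k from a; it is a multiple of a socle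
    vector for k = len a and 0 beyond. *)
Definition pvec a k : 'rV[K]_d :=
  if k is k'.+1 then
    if (insub k' : option 'I_(len a).-1) is Some i then bvec (inr (Tagged _ i))
    else if k == len a then (c a)^-1 *: svec (src a) else 0
  else evec (src a).

(** The vector of the product of a and f a, as prescribed by the relation at
    a. *)
Definition turn a : 'rV[K]_d :=
  (tau a * c (bar a)) *: pvec (bar a) (len (bar a)).-1 + sigma a *: svec (src a).

(** Right multiplication of a basis element by an arrow: a g-path is prolonged,
    an arrow followed by a turn is rewritten, everything else is 0. *)
Definition act a (s : turn_basis) : 'rV[K]_d :=
  match s with
  | inl (inl v) => if src a == v then pvec a 1 else 0
  | inl (inr _) => 0
  | inr u =>
    if a == iter (tagged u).+1 g (tag u) then pvec (tag u) (tagged u).+2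
    else if (tagged u == 0%N :> nat) && (a == f (tag u)) then turn (tag u) else 0
  end.

Definition bend (s : turn_basis) : vert R :=
  match s with
  | inl (inl v) | inl (inr v) => v
  | inr u => src (iter (tagged u).+1 g (tag u))
  end.

Definition amx a := mx_of (act a).
Definition vmx v := mx_of (fun s => if bend s == v then bvec s else 0).

Lemma pvec0 a : pvec a 0 = evec (src a). Proof. by []. Qed.
Lemma pvec_bvec a (i : 'I_(len a).-1) : pvec a i.+1 = bvec (inr (Tagged _ i)).
Proof. by rewrite /pvec valK. Qed.
Lemma pvec_len a : pvec a (len a) = (c a)^-1 *: svec (src a).
Proof.
rewrite -{1}(len_predK m_adm a) /pvec insubN ?ltnn //.
by rewrite (len_predK m_adm) eqxx.
Qed.
Lemma pvec_gt a k : (len a < k)%N -> pvec a k = 0.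
Proof.
case: k => // k lk; rewrite /pvec insubN; last by have := len_ge3 m_adm a; lia.
by rewrite gtn_eqF.
Qed.

Arguments pvec : simpl never.

Variant pvec_spec a : nat -> 'rV[K]_d -> Type :=
| PvecTriv : pvec_spec a 0 (evec (src a))
| PvecMid (i : 'I_(len a).-1) : pvec_spec a i.+1 (bvec (inr (Tagged _ i)))
| PvecSoc : pvec_spec a (len a) ((c a)^-1 *: svec (src a))
| PvecBig k of (len a < k)%N : pvec_spec a k 0.

Lemma pvecP a k : pvec_spec a k (pvec a k).
Proof.
case: k => [|k]; first by rewrite pvec0; apply: PvecTriv.
have [lk|kl|<-] := ltngtP (len a) k.+1.
- by rewrite pvec_gt //; apply: PvecBig.
- have h : (k < (len a).-1)%N by lia.
  by have := pvec_bvec (Ordinal h); rewrite /= -[k.+1]/(nat_of_ord (Ordinal h)).+1 => ->;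
     apply: PvecMid.
- by rewrite pvec_len; apply: PvecSoc.
Qed.

Lemma basis_cases (P : 'rV[K]_d -> Prop) :
  (forall v, P (evec v)) -> (forall v, P (svec v)) ->
  (forall a k, (0 < k < len a)%N -> P (pvec a k)) -> forall s, P (bvec s).
Proof.
move=> Pe Ps Pp [[v|v]|[a i]]; [exact: Pe | exact: Ps |].
by have := Pp a i.+1; rewrite pvec_bvec; apply; rewrite /= -ltn_predRL.
Qed.

Lemma mx_casesP (A B : 'M[K]_d) :
  (forall v, evec v *m A = evec v *m B) -> (forall v, svec v *m A = svec v *m B) ->
  (forall a k, (0 < k < len a)%N -> pvec a k *m A = pvec a k *m B) -> A = B.
Proof.
by move=> he hs hp; apply: mx_basisP; apply: (@basis_cases (fun u => u *m A = u *m B)).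
Qed.

Lemma evec_amx v a : evec v *m amx a = if src a == v then pvec a 1 else 0.
Proof. exact: mx_ofE. Qed.
Lemma svec_amx v a : svec v *m amx a = 0. Proof. exact: mx_ofE. Qed.
Lemma evec_vmx v w : evec v *m vmx w = if v == w then evec v else 0.
Proof. exact: mx_ofE. Qed.
Lemma svec_vmx v w : svec v *m vmx w = if v == w then svec v else 0.
Proof. exact: mx_ofE. Qed.

Lemma pvec_amx a k : pvec a k *m amx (iter k g a) = pvec a k.+1.
Proof.
case: pvecP => [|i||l lk].
- by rewrite evec_amx eqxx.
- by rewrite mx_ofE /act eqxx.
- by rewrite -scalemxAl svec_amx scaler0 pvec_gt.
- by rewrite mul0mx pvec_gt // ltnW.
Qed.

Lemma pvec_amx0 a k b : (2 <= k)%N -> b != iter k g a -> pvec a k *m amx b = 0.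
Proof.
case: pvecP => [|i i0 bi||l lk _ _] //.
- by rewrite mx_ofE /act (negPf bi) /= gtn_eqF.
- by move=> _ _; rewrite -scalemxAl svec_amx scaler0.
- exact: mul0mx.
Qed.

Lemma pvec_turn a : pvec a 1 *m amx (f a) = turn a.
Proof.
have h : (0 < (len a).-1)%N by have := len_ge3 m_adm a; lia.
by rewrite (pvec_bvec (Ordinal h)) mx_ofE /act /= f_neq_g eqxx.
Qed.

Lemma pvec_vmx a k v : pvec a k *m vmx v = if src (iter k g a) == v then pvec a k else 0.
Proof.
case: pvecP => [|i||l lk].
- exact: evec_vmx.
- exact: mx_ofE.
- by rewrite -scalemxAl svec_vmx iter_len; case: ifP; rewrite ?scaler0.
- by rewrite mul0mx if_same.
Qed.

Lemma len_bar_gt1 a : (1 < (len (bar a)).-1)%N.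
Proof. by have := len_ge3 m_adm (bar a); lia. Qed.

Lemma turn_vmx a v : turn a *m vmx v = if tgt (f a) == v then turn a else 0.
Proof.
rewrite mulmxDl -!scalemxAl pvec_vmx (iter_last_bar m_adm tri) svec_vmx.
rewrite src_f -/(turn a) /turn.
have [fa|fa] := eqVneq (f a) a; last first.
  by rewrite (sigma_fixed fa) !scale0r !addr0; case: ifP; rewrite ?scaler0.
by rewrite fa -src_f fa; case: ifP; rewrite ?scaler0 ?addr0.
Qed.

Lemma vmxM v w : vmx v *m vmx w = if v == w then vmx v else 0.
Proof.
apply: mx_basisP => s; rewrite mulmxA mx_ofE.
have [vw|vw] := eqVneq v w.
  by rewrite -vw mx_ofE; case: (eqVneq (bend s) v) => [e|]; rewrite ?mul0mx // mx_ofE e eqxx.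
case: (eqVneq (bend s) v) => [e|]; rewrite ?mul0mx ?mulmx0 //.
by rewrite mx_ofE e (negPf vw).
Qed.

Lemma vmx_sum : \sum_v vmx v = 1%:M.
Proof.
apply: mx_basisP => s; rewrite mulmx_sumr mulmx1 (bigD1 (bend s)) //= mx_ofE eqxx.
by rewrite big1 ?addr0 // => v /negPf ne; rewrite mx_ofE eq_sym ne.
Qed.

Lemma vmx_amx a : vmx (src a) *m amx a = amx a.
Proof.
apply: mx_basisP => s; rewrite mulmxA mx_ofE.
case: eqVneq => // ne; rewrite mul0mx mx_ofE.
case: s ne => [[v|v]|[b i]] //=; first by rewrite eq_sym => /negPf ->.
move=> ne; case: eqP => [ea|_]; first by rewrite ea eqxx in ne.
case: andP => // -[/eqP i0 /eqP ea]; move: ne.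
by rewrite i0 ea /= src_f src_g eqxx.
Qed.

Lemma amx_vmx a : amx a *m vmx (tgt a) = amx a.
Proof.
apply: mx_basisP => s; rewrite mulmxA mx_ofE.
case: s => [[v|v]|[b i]] /=.
- by case: ifP => _; rewrite ?mul0mx // pvec_vmx src_g eqxx.
- by rewrite mul0mx.
- case: eqP => [ea|_]; first by rewrite pvec_vmx ea -src_g eqxx.
  case: andP => [[_ /eqP ->]|_]; last by rewrite mul0mx.
  by rewrite turn_vmx eqxx.
Qed.

Lemma rho_exists : exists F : {rmorphism path_alg K R -> mx_alg K d},
  [/\ forall (z : K) x, F (z *' x) = z *' F x,
      forall v, F (triv_elt K v) = vmx v & forall a, F (arr_elt K a) = amx a].
Proof.
apply: path_alg_univ; [exact: vmxM | exact: vmx_sum | exact: vmx_amx | exact: amx_vmx].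
Qed.

Definition rho : {rmorphism path_alg K R -> mx_alg K d} := projT1 (cid rho_exists).
Definition rep_mx (x : path_alg K R) : 'M[K]_d := rho x.

Lemma rep_mxD x y : rep_mx (x + y) = rep_mx x + rep_mx y. Proof. exact: rmorphD. Qed.
Lemma rep_mxB x y : rep_mx (x - y) = rep_mx x - rep_mx y. Proof. exact: rmorphB. Qed.
Lemma rep_mxM x y : rep_mx (x * y) = rep_mx x *m rep_mx y. Proof. exact: rmorphM. Qed.
Lemma rep_mxZ (z : K) x : rep_mx (z *' x) = z *: rep_mx x.
Proof.
have [FZ _ _] := projT2 (cid rho_exists).
by rewrite /rep_mx FZ mx_alg_scale.
Qed.
Lemma rep_mx_triv v : rep_mx (triv_elt K v) = vmx v.
Proof. by have [_ Fv _] := projT2 (cid rho_exists); apply: Fv. Qed.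
Lemma rep_mx_arr a : rep_mx (x_ a) = amx a.
Proof. by have [_ _ Fa] := projT2 (cid rho_exists); apply: Fa. Qed.

Lemma pvec_gpath a k l : pvec a k *m rep_mx (gpath K (iter k g a) l) = pvec a (k + l).
Proof.
elim: l => [|l IH]; first by rewrite gpath0 rep_mx_triv pvec_vmx eqxx addn0.
by rewrite gpathS rep_mxM mulmxA IH rep_mx_arr -iterD [(l + k)%N]addnC pvec_amx addnS.
Qed.

Lemma turn_amx0 a : turn a *m amx (g (f a)) = 0.
Proof.
rewrite mulmxDl -!scalemxAl svec_amx scaler0 addr0 pvec_amx0 ?scaler0 //.
  exact: len_bar_gt1.
by rewrite (iter_last_bar m_adm tri) g_neq_f.
Qed.

(** A g-path, an f-turn and then an arrow along g: for k = 1 the turn becomes a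
    g-path of length at least 2, up to a socle element, and another turn follows;
    for k > 1 the turn itself is preceded by an arrow along g. Both give 0. *)
Lemma pvec_gpath_bar a k l : (0 < k)%N -> (2 <= l)%N ->
  pvec a k *m rep_mx (gpath K (bar (iter k g a)) l) = 0.
Proof.
move=> k0; case: l => [|[|l]] // _.
rewrite gpathSl rep_mxM mulmxA rep_mx_arr.
case: k k0 => [|[|k]] // _; last by rewrite pvec_amx0 ?mul0mx //; apply/eqP; case: (rq_barP (iter k.+2 g a)).
rewrite /= bar_g pvec_turn gpathSl rep_mxM mulmxA rep_mx_arr.
by rewrite turn_amx0 mul0mx.
Qed.

Lemma svec_gpath v a l : (0 < l)%N -> svec v *m rep_mx (gpath K a l) = 0.
Proof. by case: l => // l _; rewrite gpathSl rep_mxM mulmxA rep_mx_arr svec_amx mul0mx. Qed.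

Lemma evec_gpath v a l : evec v *m rep_mx (gpath K a l) = if src a == v then pvec a l else 0.
Proof.
have [<-|ne] := eqVneq (src a) v; first by rewrite -(pvec_gpath a 0).
case: l => [|l]; first by rewrite gpath0 rep_mx_triv evec_vmx eq_sym (negPf ne).
by rewrite gpathSl rep_mxM mulmxA rep_mx_arr evec_amx (negPf ne) mul0mx.
Qed.

(** The only case where the two sides are not 0 is k = 1 and b = f a: then both
    are tau times the socle vector at the source of a, reached on the left through
    the f-orbit of a and on the right through its g-orbit. The value of tau is
    that at a on the left and that at f a on the right. *)
Lemma pvec_turn_turn a k b : (0 < k)%N ->
  pvec a k *m rep_mx (x_ b * x_ (f b))
  = (tau b * c (bar b)) *: (pvec a k *m rep_mx (gpath K (bar b) (len (bar b)).-1))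
  + (sigma b * c (bar b)) *: (pvec a k *m rep_mx (gpath K (bar b) (len (bar b)))).
Proof.
move=> k0; have [sb|sb] := eqVneq (src b) (src (iter k g a)); last first.
  have z y : pvec a k *m rep_mx (triv_elt K (src b) * y) = 0.
    by rewrite rep_mxM mulmxA rep_mx_triv pvec_vmx eq_sym (negPf sb) mul0mx.
  have zg l : pvec a k *m rep_mx (gpath K (bar b) l) = 0.
    by rewrite -(z (gpath K (bar b) l)) triv_gpath src_bar eqxx.
  rewrite !zg !scaler0 addr0 -(z (x_ b * x_ (f b))) mulrA triv_arr eqxx //.
have l2 := len_bar_gt1 b; have l1 : (1 < len (bar b))%N by lia.
have [eb|eb] := src_eq sb.
  rewrite eb !pvec_gpath_bar -?eb // !scaler0 addr0.
  rewrite rep_mxM mulmxA !rep_mx_arr eb pvec_amx pvec_amx0 //.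
  by rewrite -eb iterS -eb f_neq_g.
have ebb : bar b = iter k g a by rewrite eb rq_barK.
rewrite ebb !pvec_gpath -ebb (_ : len (bar b) = len a); last by rewrite ebb len_iter.
rewrite (pvec_gt (k := k + len a)) ?scaler0 ?addr0; last by lia.
rewrite rep_mxM mulmxA !rep_mx_arr.
case: k k0 sb eb ebb => [|[|k]] // _ sb eb ebb; last first.
  rewrite pvec_amx0 ?mul0mx //; last by rewrite -ebb; apply/eqP => /esym; case: (rq_barP b).
  by rewrite pvec_gt ?scaler0 //; have := len_ge3 m_adm a; lia.
have {eb}eb : b = f a by rewrite eb /= bar_g.
rewrite eb pvec_turn mulmxDl -!scalemxAl svec_amx scaler0 addr0.
have := pvec_amx (bar a) (len (bar a)).-1.
rewrite (iter_last_bar m_adm tri) => ->; rewrite (len_predK m_adm) pvec_len.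
rewrite add1n (len_predK m_adm) pvec_len tau_f bar_f c_inv.
by rewrite !scalerA !mulfK // src_bar.
Qed.

Lemma pvec_socle0 a k b : (0 < k)%N -> pvec a k *m rep_mx (gpath K b (len b)) = 0.
Proof.
move=> k0; have [sb|sb] := eqVneq (src b) (src (iter k g a)); last first.
  rewrite -[gpath K b _](_ : triv_elt K (src b) * gpath K b (len b) = _); last first.
    by rewrite triv_gpath eqxx.
  by rewrite rep_mxM mulmxA rep_mx_triv pvec_vmx eq_sym (negPf sb) mul0mx.
have l3 := len_ge3 m_adm b.
have [eb|eb] := src_eq sb; last by rewrite eb pvec_gpath_bar // -eb; lia.
have lb : len b = len a by rewrite eb len_iter.
by have := pvec_gpath a k (len b); rewrite -eb => ->; rewrite pvec_gt // lb; lia.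
Qed.

Lemma svec_arr v a y : svec v *m rep_mx (x_ a * y) = 0.
Proof. by rewrite rep_mxM mulmxA rep_mx_arr svec_amx mul0mx. Qed.

Lemma rep_mx_turn a : rep_mx (x_ a * x_ (f a)) =
  (tau a * c (bar a)) *: rep_mx (gpath K (bar a) (len (bar a)).-1)
  + (sigma a * c (bar a)) *: rep_mx (gpath K (bar a) (len (bar a))).
Proof.
have l2 := len_bar_gt1 a; apply: mx_casesP => [v|v|b k /andP[k0 _]].
- rewrite mulmxDr -!scalemxAr !evec_gpath src_bar rep_mxM mulmxA !rep_mx_arr evec_amx.
  case: eqP => [ev|_]; last by rewrite mul0mx !scaler0 addr0.
  rewrite pvec_turn /turn pvec_len src_bar scalerA mulfK //.
- rewrite mulmxDr -!scalemxAr !svec_gpath ?(len_gt0 m_adm) //; last by lia.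
  by rewrite !scaler0 addr0 svec_arr.
- by rewrite mulmxDr -!scalemxAr pvec_turn_turn.
Qed.

Lemma pvec_amx_len a k b : (len a <= k)%N -> pvec a k *m amx b = 0.
Proof.
rewrite leq_eqVlt => /orP[/eqP <-|lk]; last by rewrite pvec_gt ?mul0mx.
by rewrite pvec_len -scalemxAl svec_amx scaler0.
Qed.

Lemma pvec_gpath_amx a k b l e : (0 < k)%N -> (2 <= l)%N -> (len b <= l.+1)%N ->
  pvec a k *m rep_mx (gpath K b l) *m amx e = 0.
Proof.
move=> k0 l2 lb; have [sb|sb] := eqVneq (src b) (src (iter k g a)); last first.
  rewrite -[gpath K b l](_ : triv_elt K (src b) * gpath K b l = _); last first.
    by rewrite triv_gpath eqxx.
  by rewrite rep_mxM mulmxA rep_mx_triv pvec_vmx eq_sym (negPf sb) !mul0mx.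
have [eb|eb] := src_eq sb; last by rewrite eb pvec_gpath_bar // mul0mx.
have lba : len b = len a by rewrite eb len_iter.
by rewrite eb pvec_gpath pvec_amx_len //; lia.
Qed.

Lemma rep_mx_zero a : rep_mx (x_ a * x_ (f a) * x_ (g (f a))) = 0.
Proof.
have l2 := len_bar_gt1 a; have l1 := len_predK m_adm (bar a).
apply: mx_casesP => [v|v|b k /andP[k0 _]].
- rewrite mulmx0 !rep_mxM !rep_mx_arr !mulmxA evec_amx; case: eqP => _; last by rewrite !mul0mx.
  by rewrite pvec_turn turn_amx0.
- by rewrite mulmx0 -mulrA svec_arr.
- rewrite mulmx0 rep_mxM mulmxA pvec_turn_turn // rep_mx_arr mulmxDl -!scalemxAl.
  by rewrite !pvec_gpath_amx ?scaler0 ?addr0 //; lia.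
Qed.

Lemma rep_mx_commut a : rep_mx (c a *' gpath K a (len a)) =
  rep_mx (c (bar a) *' gpath K (bar a) (len (bar a))).
Proof.
rewrite !rep_mxZ; apply: mx_casesP => [v|v|b k /andP[k0 _]]; rewrite -!scalemxAr.
- rewrite !evec_gpath src_bar; case: ifP => _; last by rewrite !scaler0.
  by rewrite !pvec_len !scalerA !mulfV // src_bar.
- by rewrite !svec_gpath ?scaler0 ?(len_gt0 m_adm).
- by rewrite !pvec_socle0 ?scaler0.
Qed.

(** So the quotient acts on row vectors. This separates the basis elements: acting
    on the sum of the trivial vectors, they give the vectors of the standard
    basis. *)
Lemma rep_mx_ideal x : turn_ideal m c tau sigma x -> rep_mx x = 0.
Proof.
apply: (@gen_ideal_min _ _ (pullback rho (zero_ideal (mx_alg K d)))) => {}x hx.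
change (rep_mx x = 0); case: hx => {x} a.
- by rewrite !rep_mxB rep_mx_turn !rep_mxZ -addrA -opprD subrr.
- exact: rep_mx_zero.
- by rewrite rep_mxB rep_mx_commut subrr.
Qed.

End Representation.
Arguments pvec : simpl never.

(** * A basis of the quotient *)

Section BasisTheorem.
Variables (K : fieldType) (R : ribbonQuiver).
Variables (m : arr R -> nat) (c tau sigma : arr R -> K).
Hypotheses (m_inv : g_invariant m) (m_adm : admissible m)
  (tri : triangulation R) (c_neq0 : forall a, c a != 0) (c_inv : g_invariant c).
Hypotheses (tau_f : forall a, tau (rq_f a) = tau a)
  (sigma_fixed : forall a, rq_f a != a -> sigma a = 0).
Local Notation f := (@rq_f R).
Local Notation g := (@rq_g R).
Local Notation bar := (@rq_bar R).
Local Notation x_ a := (arr_elt K a).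
Local Notation len := (len m).
Local Notation gp := (gpath K).
Implicit Types (a b e : arr R) (v w : vert R).

Local Notation I := (turn_ideal m c tau sigma).
Definition turn_alg : assocAlg K := quot_alg I.
Definition tpi : {rmorphism path_alg K R -> turn_alg} := @quot_pi (path_alg K R) I.

Lemma tpiZ (z : K) x : tpi (z *' x) = z *' tpi x. Proof. exact: quot_piZ. Qed.
Lemma tpi0P x : tpi x = 0 <-> I x. Proof. exact: quot_pi0P. Qed.

Lemma tpi_turn a : tpi (x_ a) * tpi (x_ (f a)) =
  (tau a * c (bar a)) *' tpi (gp (bar a) (len (bar a)).-1)
  + (sigma a * c (bar a)) *' tpi (gp (bar a) (len (bar a))).
Proof.
have /tpi0P := gen_ideal_in (TurnRel m c tau sigma a).
rewrite !rmorphB !tpiZ rmorphM -addrA -opprD => /eqP.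
by rewrite subr_eq0 => /eqP.
Qed.

Lemma tpi_zero a : tpi (x_ a) * tpi (x_ (f a)) * tpi (x_ (g (f a))) = 0.
Proof. by rewrite -!rmorphM; apply/tpi0P/gen_ideal_in/TurnZero. Qed.

Lemma tpi_commut a :
  c a *' tpi (gp a (len a)) = c (bar a) *' tpi (gp (bar a) (len (bar a))).
Proof.
have /tpi0P := gen_ideal_in (TurnCommut m c tau sigma a).
by rewrite rmorphB !tpiZ => /eqP; rewrite subr_eq0 => /eqP.
Qed.

Lemma tpi_f_gpath a l : (2 <= l)%N -> tpi (x_ a) * tpi (gp (f a) l) = 0.
Proof.
case: l => [|[|l]] // _.
by rewrite !gpathSl !rmorphM !mulrA tpi_zero mul0r.
Qed.

(** Replacing the turn by a g-path of length at least two creates a path that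
    starts with an f-turn followed by g. *)
Lemma tpi_gf a : tpi (x_ a) * tpi (x_ (g a)) * tpi (x_ (f (g a))) = 0.
Proof.
have l3 := len_ge3 m_adm (f a).
rewrite -mulrA tpi_turn bar_g mulrDr !alg_scaleAr !tpi_f_gpath ?alg_scaler0 ?addr0 //.
  by lia.
by lia.
Qed.

Lemma tpi_gpath0 b k e : (2 <= k)%N -> e != iter k g b ->
  tpi (gp b k) * tpi (x_ e) = 0.
Proof.
case: k => [|[|k]] // _; rewrite !gpathS !rmorphM iterS; set y := iter k.+1 g b => ey.
have [sy|sy] := eqVneq (src e) (tgt y); last first.
  rewrite -(mulrA _ (tpi (x_ y))) -[tpi (x_ y) * _]rmorphM arr_mul0; last exact/eqP.
  by rewrite rmorph0 mulr0.
have [eg|ef] := src_tgt sy; first by rewrite eg eqxx in ey.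
by rewrite ef -!mulrA (mulrA (tpi (x_ (iter k g b)))) tpi_gf mulr0.
Qed.

(** If e prolongs the g-path, the commutation relation exchanges this g-path with
    the one from bar b, which e does not prolong. *)
Lemma tpi_socle b e : tpi (gp b (len b)) * tpi (x_ e) = 0.
Proof.
have l3 b' := len_ge3 m_adm b'.
have [->|ne] := eqVneq e b; last by rewrite tpi_gpath0 ?iter_len // ltnW.
rewrite -[tpi (gp b _)]alg_scale1 -(mulVf (c_neq0 b)) -alg_scaleA tpi_commut.
rewrite 2!alg_scaleAl tpi_gpath0 ?alg_scaler0 ?iter_len ?(eq_sym b) ?bar_neq //.
exact: ltnW.
Qed.

Lemma tpi_gpath_gt b k : (len b < k)%N -> tpi (gp b k) = 0.
Proof.
move=> lk; rewrite -(subnKC lk) gpathD gpathS !rmorphM iter_len tpi_socle.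
exact: mul0r.
Qed.

Local Notation basis := (turn_basis m).
Local Notation d := #|basis|.
Local Notation bvec := (@bvec K R m).
Local Notation evec := (@evec K R m).
Local Notation svec := (@svec K R m).
Local Notation pvec := (@pvec K R m c).
Local Notation rep := (@rep_mx K R m c tau sigma m_adm tri sigma_fixed).

Definition basis_elt (s : basis) : path_alg K R :=
  match s with
  | inl (inl v) => triv_elt K v
  | inl (inr v) => c (arrow_at v) *' gp (arrow_at v) (len (arrow_at v))
  | inr u => gp (tag u) (tagged u).+1
  end.

Definition basis_lift (u : 'rV[K]_d) : path_alg K R :=
  \sum_s u 0 (enum_rank s) *' basis_elt s.
(** Inverse to the map that lets an element of the quotient act on the sum of the
    trivial paths. *)
Definition psi (u : 'rV[K]_d) : turn_alg := tpi (basis_lift u).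

Lemma basis_liftD u u' : basis_lift (u + u') = basis_lift u + basis_lift u'.
Proof. by rewrite -big_split; apply: eq_bigr => s _; rewrite mxE alg_scaleDl. Qed.
Lemma basis_liftZ z u : basis_lift (z *: u) = z *' basis_lift u.
Proof. by rewrite alg_scale_sum; apply: eq_bigr => s _; rewrite mxE alg_scaleA. Qed.
Lemma basis_lift_bvec s : basis_lift (bvec s) = basis_elt s.
Proof.
rewrite /basis_lift (bigD1 s) //= mxE !eqxx alg_scale1 big1 ?addr0 // => t ts.
by rewrite mxE (inj_eq enum_rank_inj) (negPf ts) andbF alg_scale0.
Qed.

Lemma psiD u u' : psi (u + u') = psi u + psi u'. Proof. by rewrite /psi basis_liftD rmorphD. Qed.
Lemma psiZ z u : psi (z *: u) = z *' psi u. Proof. by rewrite /psi basis_liftZ tpiZ. Qed.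
Lemma psi0 : psi 0 = 0. Proof. by rewrite -(scale0r 0) psiZ alg_scale0. Qed.
Lemma psi_bvec s : psi (bvec s) = tpi (basis_elt s). Proof. by rewrite /psi basis_lift_bvec. Qed.

Lemma vec_decomp (u : 'rV[K]_d) : u = \sum_s u 0 (enum_rank s) *: bvec s.
Proof.
rewrite {1}(row_sum_delta u) (reindex (@enum_rank basis)) //.
by exists enum_val => s _; rewrite ?enum_rankK ?enum_valK.
Qed.

Lemma psi_socle a : psi (svec (src a)) = c a *' tpi (gp a (len a)).
Proof.
rewrite psi_bvec /= tpiZ.
by have [->//|->] := src_eq (src_arrow_at (src a)); rewrite -tpi_commut.
Qed.

Lemma psi_pvec a k : psi (pvec a k) = tpi (gp a k).
Proof.
case: pvecP => // [|i||l lk]; rewrite ?psi_bvec //.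
- by rewrite gpath0.
- by rewrite psiZ psi_socle alg_scaleA mulVf // alg_scale1.
- by rewrite psi0 tpi_gpath_gt.
Qed.

Lemma psi_turn a : psi (@turn K R m c tau sigma a) = tpi (x_ a) * tpi (x_ (f a)).
Proof.
by rewrite psiD !psiZ psi_pvec -src_bar psi_socle tpi_turn alg_scaleA.
Qed.

Lemma psi_amx s a : psi (bvec s *m @amx K R m c tau sigma a) = psi (bvec s) * tpi (x_ a).
Proof.
apply: (@basis_cases K R m c (fun u => psi (u *m _) = psi u * _)) => [v|v|b k /andP[k0 kb]].
- rewrite evec_amx [psi (evec v)]psi_bvec -rmorphM triv_arr.
  by case: ifP => _; rewrite ?psi0 ?rmorph0 // psi_pvec gpath1.
- rewrite svec_amx psi0 -(src_arrow_at v) psi_socle alg_scaleAl tpi_socle.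
  by rewrite alg_scaler0.
- rewrite psi_pvec; have [->|ne] := eqVneq a (iter k g b).
    by rewrite pvec_amx // psi_pvec gpathS rmorphM.
  have [k1|k1] := leqP k 1; last by rewrite pvec_amx0 // psi0 tpi_gpath0.
  have {k0 k1 kb}k1 : k = 1%N by lia.
  rewrite k1 gpath1; rewrite k1 in ne.
  have [sb|sb] := eqVneq (src a) (tgt b).
    have [eg|ef] := src_tgt sb; first by rewrite eg eqxx in ne.
    by rewrite ef pvec_turn // psi_turn.
  rewrite -rmorphM arr_mul0 ?rmorph0; last exact/eqP.
  by rewrite -vmx_amx mulmxA pvec_vmx // /= src_g eq_sym (negPf sb) mul0mx psi0.
Qed.

Lemma psi_lin (A : 'M[K]_d) (y : turn_alg) :
  (forall s, psi (bvec s *m A) = psi (bvec s) * y) -> forall u, psi (u *m A) = psi u * y.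
Proof.
move=> h u; rewrite (vec_decomp u) mulmx_suml.
elim/big_rec2: _ => [|s u1 u2 _ IH]; first by rewrite psi0 mul0r.
by rewrite !psiD mulrDl -IH -scalemxAl !psiZ alg_scaleAl h.
Qed.

(** Since psi is compatible with the actions, every element of the quotient is the
    image of the vector that it gives on the sum of the trivial paths: the basis
    elements span. *)
Lemma psi_rep x u : psi (u *m rep x) = psi u * tpi x.
Proof.
move: x u; apply: path_alg_ind => [u|v|a|x y ix iy u|x y ix iy u|z x ix u].
- by rewrite /rep_mx rmorph0 rmorph0 mulr0; rewrite mulmx0 psi0.
- rewrite rep_mx_triv; apply: psi_lin.
  apply: (@basis_cases K R m c (fun u => psi (u *m _) = psi u * _)) => [w|w|a k _].
  + by rewrite evec_vmx psi_bvec -rmorphM triv_mul; case: ifP => _; rewrite ?psi0 ?rmorph0 ?psi_bvec.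
  + rewrite svec_vmx -(src_arrow_at w) psi_socle alg_scaleAl -rmorphM -gpath_end.
    rewrite iter_len -mulrA triv_mul; case: eqP => _.
      have := gpath_end K (arrow_at w) (len (arrow_at w)).
      by rewrite iter_len psi_socle => ->.
    by rewrite psi0 mulr0 rmorph0 alg_scaler0.
  + rewrite pvec_vmx // !psi_pvec -rmorphM -gpath_end -mulrA triv_mul.
    case: eqP => _; first by rewrite psi_pvec gpath_end.
    by rewrite psi0 mulr0 rmorph0.
- by rewrite rep_mx_arr; apply: psi_lin => s; apply: psi_amx.
- by rewrite rep_mxD mulmxDr psiD ix iy rmorphD mulrDr.
- by rewrite rep_mxM mulmxA iy ix rmorphM mulrA.
- by rewrite rep_mxZ -scalemxAr psiZ ix tpiZ alg_scaleAr.
Qed.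

Definition ones : 'rV[K]_d := \sum_v evec v.

Lemma psi_ones : psi ones = 1.
Proof.
have psi_sum r : psi (\sum_(v <- r) evec v) = tpi (\sum_(v <- r) triv_elt K v).
  elim: r => [|v r IH]; first by rewrite !big_nil psi0 rmorph0.
  by rewrite !big_cons psiD IH rmorphD psi_bvec.
by rewrite [LHS]psi_sum triv_sum rmorph1.
Qed.

Lemma ones_gpath a k : ones *m rep (gp a k) = pvec a k.
Proof.
rewrite mulmx_suml (bigD1 (src a)) //= evec_gpath // eqxx big1 ?addr0 // => v.
by rewrite eq_sym evec_gpath // => /negPf ->.
Qed.

Lemma ones_basis_elt s : ones *m rep (basis_elt s) = bvec s.
Proof.
case: s => [[v|v]|[a i]] /=.
- by have := ones_gpath (arrow_at v) 0; rewrite gpath0 src_arrow_at pvec0 src_arrow_at.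
- rewrite rep_mxZ -scalemxAr ones_gpath pvec_len // scalerA mulfV // scale1r.
  by rewrite src_arrow_at.
- by rewrite ones_gpath pvec_bvec.
Qed.

Lemma ones_basis_lift u : ones *m rep (basis_lift u) = u.
Proof.
rewrite [RHS]vec_decomp /basis_lift; elim/big_rec2: _ => [|s x y _ IH].
  by rewrite /rep_mx rmorph0; apply: mulmx0.
by rewrite rep_mxD mulmxDr IH rep_mxZ -scalemxAr ones_basis_elt.
Qed.

(** The inverse lets an element of the quotient act on the sum of the trivial
    paths, which is well defined as the relations act by 0. *)
Lemma psi_bij : bijective psi.
Proof.
exists (fun y => ones *m rep (@quot_repr _ I y)) => [u|y].
  rewrite -[RHS]ones_basis_lift; apply/eqP; rewrite -subr_eq0 -mulmxBr -rep_mxB.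
  by rewrite rep_mx_ideal ?mulmx0 //; apply: quot_reprB.
by rewrite psi_rep psi_ones mul1r; apply: quot_reprK.
Qed.

Definition turn_sc : structure_constants K d :=
  [ffun p => rep (basis_elt (enum_val p.1.2)) p.1.1 p.2].

Lemma turn_scE u u' : sc_mul turn_sc u u' = u *m rep (basis_lift u').
Proof.
have -> : rep (basis_lift u') = \sum_j u' 0 j *: rep (basis_elt (enum_val j)).
  rewrite /basis_lift (reindex (@enum_val basis predT)); last first.
    by exists enum_rank => s _; rewrite ?enum_rankK ?enum_valK.
  elim/big_rec2: _ => [|j x y _ IH]; first by rewrite /rep_mx rmorph0.
  by rewrite rep_mxD IH rep_mxZ enum_valK.
apply/rowP => k; rewrite mulmx_sumr !mxE summxE exchange_big; apply: eq_bigr => j _.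
rewrite -scalemxAr !mxE mulr_sumr; apply: eq_bigr => i _.
by rewrite ffunE /= mulrCA mulrA.
Qed.

Lemma turn_sc_presents : sc_presents turn_sc turn_alg.
Proof.
exists psi; split; [exact: psi_bij | exact: psiD | exact: psiZ |].
by move=> x y; rewrite turn_scE psi_rep.
Qed.

End BasisTheorem.

(** * Filtration by weights *)

Section LeadingTerm.
Variables (K : fieldType) (d : nat) (wt : 'I_d -> nat).

(** X raises weights by at least n, and X0 is its part that raises them by
    exactly n; wr and wt are the weights of the rows and columns. *)
Definition leading p (wr : 'I_p -> nat) (X X0 : 'M[K]_(p, d)) (n : nat) : Prop :=
  forall i k, (X0 i k != 0 -> wt k = (wr i + n)%N) /\
              (X i k != X0 i k -> (wr i + n < wt k)%N).

Lemma leading0 p (wr : 'I_p -> nat) n : leading wr 0 0 n.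
Proof. by move=> i k; rewrite !mxE eqxx. Qed.

Lemma leadingZ p (wr : 'I_p -> nat) X X0 n (z : K) :
  leading wr X X0 n -> leading wr (z *: X) (z *: X0) n.
Proof.
move=> h i k; have [h0 h1] := h i k; rewrite !mxE; split=> ne.
  by apply: h0; apply: contraNneq ne => ->; rewrite mulr0.
by apply: h1; apply: contraNneq ne => ->.
Qed.

Lemma leading_neq0 p (wr : 'I_p -> nat) X X0 n i k :
  leading wr X X0 n -> X i k != 0 -> (wr i + n <= wt k)%N.
Proof.
move=> h ne; have [h0 h1] := h i k.
have [e|ne1] := eqVneq (X i k) (X0 i k); first by rewrite h0 // -e.
by apply: ltnW; apply: h1.
Qed.

Lemma leading_mul p (wr : 'I_p -> nat) X X0 n (Y Y0 : 'M[K]_d) n' :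
  leading wr X X0 n -> leading wt Y Y0 n' ->
  leading wr (X *m Y) (X0 *m Y0) (n + n').
Proof.
move=> hX hY i k; rewrite !mxE; split=> ne.
  have [j ne_j] : exists j, X0 i j * Y0 j k != 0.
    apply/existsP; apply: contraNT ne; rewrite negb_exists => /forallP h; apply/eqP.
    by apply: big1 => j _; apply/eqP; rewrite -[_ == _]negbK.
  have [h0 _] := hX i j; have [h1 _] := hY j k.
  by move: ne_j; rewrite mulf_eq0 negb_or => /andP[/h0 wj /h1 ->]; rewrite wj addnA.
have [j ne_j] : exists j, X i j * Y j k != X0 i j * Y0 j k.
  apply/existsP; apply: contraNT ne; rewrite negb_exists => /forallP h; apply/eqP.
  by apply: eq_bigr => j _; apply/eqP; rewrite -[_ == _]negbK.
have [h0 h1] := hX i j; have [h2 h3] := hY j k.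
have [eX|neX] := eqVneq (X i j) (X0 i j).
  have /h0 wj : X0 i j != 0.
    by apply: contraNneq ne_j => e; rewrite eX e !mul0r.
  have /h3 : Y j k != Y0 j k by apply: contraNneq ne_j => ->; rewrite eX.
  by rewrite wj -addnA.
have /h1 wj := neX.
have [Y00|/h2 wk] := eqVneq (Y0 j k) 0; last by rewrite wk; lia.
have /h3 : Y j k != Y0 j k.
  by apply: contraNneq ne_j => ->; rewrite Y00 !mulr0.
by lia.
Qed.

End LeadingTerm.

Section WeightedBasis.
Variables (K : fieldType) (R : ribbonQuiver).
Variables (m : arr R -> nat) (c tau sigma : arr R -> K).
Hypotheses (m_adm : admissible m) (tri : triangulation R)
  (c_neq0 : forall a, c a != 0)
  (sigma_fixed : forall a, rq_f a != a -> sigma a = 0).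
Variables (W : arr R -> nat) (M : nat).
Hypotheses (W_gt0 : forall a, (0 < W a)%N) (W_bal : balanced m W M)
  (W_lt : forall a, (W a + W (rq_f a) + W (rq_f (rq_f a)) < M)%N).
Local Notation f := (@rq_f R).
Local Notation g := (@rq_g R).
Local Notation bar := (@rq_bar R).
Local Notation x_ a := (arr_elt K a).
Local Notation len := (len m).
Local Notation gp := (gpath K).
Implicit Types (a b e : arr R) (v w : vert R).
Local Notation basis := (turn_basis m).
Local Notation d := #|basis|.
Local Notation bvec := (@bvec K R m).
Local Notation evec := (@evec K R m).
Local Notation svec := (@svec K R m).
Local Notation pvec := (@pvec K R m c).
Local Notation gweight := (gpath_weight W).
Local Notation zero := (fun=> 0 : K).
Local Notation sigma0 := (fun a (_ : f a != a) => erefl : zero a = 0).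
Local Notation rep := (@rep_mx K R m c tau sigma m_adm tri sigma_fixed).
Local Notation rep0 := (@rep_mx K R m c zero zero m_adm tri sigma0).

Definition basis_wt (s : basis) : nat :=
  match s with
  | inl (inl _) => 0
  | inl (inr _) => M
  | inr u => gweight (tag u) (tagged u).+1
  end.
Definition ord_wt (i : 'I_d) : nat := basis_wt (enum_val i).

Lemma gweightS a k : gweight a k.+1 = (gweight a k + W (iter k g a))%N.
Proof. by rewrite /gpath_weight big_ord_recr. Qed.
Lemma gweight1 a : gweight a 1 = W a.
Proof. by rewrite gweightS /gpath_weight big_ord0. Qed.
Lemma gweight_mono a k l : (k <= l)%N -> (gweight a k <= gweight a l)%N.
Proof.
move=> /subnKC <-; elim: (l - k)%N => [|n IH]; first by rewrite addn0.
by rewrite addnS gweightS (leq_trans IH) // leq_addr.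
Qed.

Lemma basis_wt_le s : (basis_wt s <= M)%N.
Proof.
case: s => [[v|v]|[a i]] //=; have <- : gweight a (len a) = M by apply: W_bal.
by apply: gweight_mono; have := ltn_ord i; lia.
Qed.

Local Notation vleading := (leading ord_wt (fun _ : 'I_1 => 0%N)).
Local Notation mleading := (leading ord_wt ord_wt).

Lemma vleading_bvec s : vleading (bvec s) (bvec s) (basis_wt s).
Proof.
move=> i k; rewrite eqxx; split=> //; rewrite mxE /ord_wt.
by case: (eqVneq k) => [->|]; rewrite ?andbF ?eqxx // enum_rankK.
Qed.

Lemma mleading_mx_of (F F0 : basis -> 'rV[K]_d) n :
  (forall s, vleading (F s) (F0 s) (basis_wt s + n)) ->
  mleading (mx_of F) (mx_of F0) n.
Proof. by move=> h i k; have := h (enum_val i) 0 k; rewrite !mxE. Qed.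

Lemma vleading_pvec a k : vleading (pvec a k) (pvec a k) (gweight a k).
Proof.
case: pvecP => // [|i||l lk].
- by rewrite /gpath_weight big_ord0; apply: vleading_bvec.
- exact: vleading_bvec.
- rewrite [gweight _ _]W_bal; apply: leadingZ; exact: vleading_bvec.
- exact: leading0.
Qed.

(** This is where the inequality between the weights on an f-orbit is used: a turn
    lies strictly above its weight. *)
Lemma vleading_turn a : vleading (@turn K R m c tau sigma a)
  (@turn K R m c zero zero a) (W a + W (f a)).
Proof.
have -> : @turn K R m c zero zero a = 0 by rewrite /turn mul0r !scale0r addr0.
move=> i k; rewrite [(0 : 'rV[K]_d) i k]mxE eqxx; split=> //; rewrite add0n.
rewrite /turn [(_ + _ : 'rV[K]_d) i k]mxE ![(_ *: _ : 'rV[K]_d) i k]mxE.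
have W_last := gpath_weight_last m_adm tri W_bal a; have := W_lt a.
have hp : pvec (bar a) (len (bar a)).-1 i k != 0 -> _ :=
  leading_neq0 (vleading_pvec (bar a) (len (bar a)).-1).
have hs : svec (src a) i k != 0 -> _ := leading_neq0 (vleading_bvec (inl (inr (src a)))).
rewrite /= in hs; case: (eqVneq (svec (src a) i k) 0) => [->|/hs]; last by lia.
case: (eqVneq (pvec (bar a) (len (bar a)).-1 i k) 0) => [->|/hp]; last by lia.
by rewrite !mulr0 addr0 eqxx.
Qed.

Lemma mleading_amx a : mleading (@amx K R m c tau sigma a) (@amx K R m c zero zero a) (W a).
Proof.
apply: mleading_mx_of => -[[v|v]|[b i]] /=.
- rewrite add0n; case: ifP => _; last exact: leading0.
  by rewrite -gweight1; apply: vleading_pvec.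
- exact: leading0.
- case: eqP => [->|_]; first by rewrite -gweightS; apply: vleading_pvec.
  case: ifP => [/andP[/eqP -> /eqP ->]|_]; last exact: leading0.
  by rewrite gweight1; apply: vleading_turn.
Qed.

Lemma mleading_vmx v : mleading (@vmx K R m v) (@vmx K R m v) 0.
Proof.
apply: mleading_mx_of => s; rewrite addn0.
by case: ifP => _; [apply: vleading_bvec | apply: leading0].
Qed.

Lemma mleading_word v (w : seq (arr R)) :
  mleading (rep (word_elt K v w)) (rep0 (word_elt K v w)) (\sum_(a <- w) W a).
Proof.
elim/last_ind: w => [|w a IH].
  by rewrite big_nil -triv_word !rep_mx_triv; apply: mleading_vmx.
rewrite word_rcons !rep_mxM !rep_mx_arr -cats1 big_cat big_seq1.
by apply: leading_mul IH _; apply: mleading_amx.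
Qed.

Lemma mleading_gpath a k : mleading (rep (gp a k)) (rep0 (gp a k)) (gweight a k).
Proof.
elim: k => [|k IH]; first by rewrite gpath0 !rep_mx_triv /gpath_weight big_ord0; apply: mleading_vmx.
rewrite gpathS gweightS !rep_mxM !rep_mx_arr.
by apply: leading_mul IH _; apply: mleading_amx.
Qed.

Lemma mleading_basis_elt s :
  mleading (rep (basis_elt c s)) (rep0 (basis_elt c s)) (basis_wt s).
Proof.
case: s => [[v|v]|[a i]] /=.
- by rewrite !rep_mx_triv; apply: mleading_vmx.
- rewrite !rep_mxZ; apply: leadingZ.
  by rewrite -(W_bal (arrow_at v)); apply: mleading_gpath.
- exact: mleading_gpath.
Qed.

(** As all weights of arrows are positive, a path of length more than M raises the
    weight beyond M, the largest weight of a basis element; so it acts by 0. *)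
Lemma long_word_in_ideal v (w : seq (arr R)) : (M < size w)%N ->
  turn_ideal m c tau sigma (word_elt K v w).
Proof.
move=> Mw; apply/tpi0P.
have -> : tpi m c tau sigma (word_elt K v w)
    = psi c tau sigma (ones K m *m rep (word_elt K v w)).
  by rewrite psi_rep // psi_ones mul1r.
suff -> : rep (word_elt K v w) = 0 by rewrite mulmx0 psi0.
apply/matrixP => i k; rewrite [RHS]mxE; apply/eqP; apply: contraT => ne.
have := leading_neq0 (mleading_word v w) ne.
have : (size w <= \sum_(a <- w) W a)%N.
  by rewrite -sum1_size; apply: leq_sum.
by have := basis_wt_le (enum_val k); rewrite /ord_wt; lia.
Qed.

Local Notation mu := (@turn_sc K R m c tau sigma m_adm tri sigma_fixed).
Local Notation nu := (@turn_sc K R m c zero zero m_adm tri sigma0).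

Lemma turn_sc_leading i j k :
  (nu (i, j, k) != 0 -> ord_wt k = (ord_wt i + ord_wt j)%N) /\
  (mu (i, j, k) != nu (i, j, k) -> (ord_wt i + ord_wt j < ord_wt k)%N).
Proof. by rewrite !ffunE; apply: mleading_basis_elt. Qed.

End WeightedBasis.

(** * Degeneration along a one-parameter subgroup *)

Lemma presents_in_alg (K : fieldType) (d : nat) (mu : structure_constants K d)
    (A : assocAlg K) : sc_presents mu A -> Defs.in_alg mu.
Proof.
move=> [F [[G FK GK] _ _ FM]]; split=> [x y z|].
  by apply: (can_inj FK); rewrite !FM mulrA.
by exists (G 1) => x; split; apply: (can_inj FK); rewrite FM GK ?mul1r ?mulr1.
Qed.

Lemma presents_iso (K : fieldType) (d : nat) (mu : structure_constants K d)
    (A B : assocAlg K) : alg_iso A B -> sc_presents mu A -> sc_presents mu B.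
Proof.
move=> [H [HZ Hbij]] [F [Fbij FD FZ FM]]; exists (H \o F); split=> [|x y|a x|x y] /=.
- exact: bij_comp.
- by rewrite FD rmorphD.
- by rewrite FZ HZ.
- by rewrite FM rmorphM.
Qed.

Section RightMultiplication.
Variables (K : fieldType) (d : nat).
Implicit Types (mu : structure_constants K d) (x y z : 'rV[K]_d).

Definition sc_mx mu j : 'M[K]_d := \matrix_(i, k) mu (i, j, k).
Definition sc_right mu y : 'M[K]_d := \sum_j y 0 j *: sc_mx mu j.

Lemma sc_rightE mu x y : sc_mul mu x y = x *m sc_right mu y.
Proof.
apply/rowP => k; rewrite mulmx_sumr !mxE summxE exchange_big; apply: eq_bigr => j _.
rewrite -scalemxAr !mxE mulr_sumr; apply: eq_bigr => i _.
by rewrite mxE mulrCA mulrA.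
Qed.

Lemma sc_right_delta mu j : sc_right mu (delta_mx 0 j) = sc_mx mu j.
Proof.
rewrite /sc_right (bigD1 j) //= mxE !eqxx scale1r big1 ?addr0 // => i ij.
by rewrite mxE (negPf ij) andbF scale0r.
Qed.

Lemma sc_rightZ mu (a : K) y : sc_right mu (a *: y) = a *: sc_right mu y.
Proof.
by rewrite /sc_right scaler_sumr; apply: eq_bigr => j _; rewrite mxE scalerA.
Qed.

Lemma sc_right_sum mu (n : nat) (a : 'I_n -> K) (u : 'I_n -> 'rV[K]_d) :
  sc_right mu (\sum_i a i *: u i) = \sum_i a i *: sc_right mu (u i).
Proof.
rewrite /sc_right.
under [RHS]eq_bigr => i _ do rewrite scaler_sumr.
rewrite exchange_big; apply: eq_bigr => j _; rewrite summxE scaler_suml.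
by apply: eq_bigr => i _; rewrite mxE scalerA.
Qed.

(** Associativity and unit, as polynomial equations in the structure constants:
    in this form they are preserved by extension of the base field. *)
Lemma in_algP mu : Defs.in_alg mu <->
  (forall j k, sc_mx mu j *m sc_mx mu k = sc_right mu (row j (sc_mx mu k))) /\
  exists e : 'rV[K]_d, (forall j, e *m sc_mx mu j = delta_mx 0 j) /\ sc_right mu e = 1%:M.
Proof.
split=> [[muA [e mue]]|[muA [e [el er]]]]; split.
- move=> j k; apply/row_matrixP => i; rewrite !rowE mulmxA.
  have := muA (delta_mx 0 i) (delta_mx 0 j) (delta_mx 0 k).
  by rewrite !sc_rightE !sc_right_delta.
- exists e; split=> [j|].
    by have [+ _] := mue (delta_mx 0 j); rewrite sc_rightE sc_right_delta.
  apply/row_matrixP => i; rewrite !rowE mulmx1.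
  by have [_ +] := mue (delta_mx 0 i); rewrite sc_rightE.
- move=> x y z; rewrite !sc_rightE -mulmxA; congr (_ *m _).
  have -> : y *m sc_right mu z = \sum_j y 0 j *: (\sum_k z 0 k *: row j (sc_mx mu k)).
    rewrite {1}(row_sum_delta y) mulmx_suml; apply: eq_bigr => j _.
    rewrite -scalemxAl mulmx_sumr; congr (_ *: _); apply: eq_bigr => k _.
    by rewrite -scalemxAr -rowE.
  rewrite sc_right_sum {1}/sc_right mulmx_suml; apply: eq_bigr => j _.
  rewrite sc_right_sum -scalemxAl mulmx_sumr; congr (_ *: _); apply: eq_bigr => k _.
  by rewrite -scalemxAr muA.
- exists e => x; rewrite !sc_rightE er mulmx1; split=> //.
  rewrite mulmx_sumr [RHS]row_sum_delta; apply: eq_bigr => j _.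
  by rewrite -scalemxAr el.
Qed.

End RightMultiplication.

Section BaseChange.
Variables (K L : fieldType) (d : nat) (iota : {rmorphism K -> L}).
Variable mu : structure_constants K d.

Lemma sc_mx_map j : sc_mx (sc_map iota mu) j = map_mx iota (sc_mx mu j).
Proof. by apply/matrixP => i k; rewrite !mxE ffunE. Qed.

Lemma sc_right_map y : sc_right (sc_map iota mu) (map_mx iota y) = map_mx iota (sc_right mu y).
Proof.
rewrite /sc_right map_mx_sum; apply: eq_bigr => j _.
by rewrite sc_mx_map map_mxZ mxE.
Qed.

Lemma in_alg_map : Defs.in_alg mu -> Defs.in_alg (sc_map iota mu).
Proof.
move=> /in_algP[muA [e [el er]]]; apply/in_algP; split=> [j k|].
  by rewrite !sc_mx_map -map_mxM muA -sc_right_map map_row.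
exists (map_mx iota e); split=> [j|]; first by rewrite sc_mx_map -map_mxM el map_delta_mx.
by rewrite sc_right_map er map_scalar_mx rmorph1.
Qed.

End BaseChange.

Section WeightDegeneration.
Variables (K : fieldType) (d : nat) (wt : 'I_d -> nat).
Variables (mu nu : structure_constants K d).
Hypothesis nu_homog : forall i j k, nu (i, j, k) != 0 -> wt k = (wt i + wt j)%N.
Hypothesis mu_lead : forall i j k,
  mu (i, j, k) != nu (i, j, k) -> (wt i + wt j < wt k)%N.
Variables (L : fieldType) (iota : {rmorphism K -> L}).

Definition weight_curve (s : L) : structure_constants L d :=
  [ffun p => iota (mu p) * s ^+ (wt p.2 - (wt p.1.1 + wt p.1.2))].

Lemma mu_wt_le i j k : mu (i, j, k) != 0 -> (wt i + wt j <= wt k)%N.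
Proof.
have [-> /nu_homog -> //|/mu_lead h _] := eqVneq (mu (i, j, k)) (nu (i, j, k)).
exact: ltnW.
Qed.

Lemma weight_curve0 : weight_curve 0 = sc_map iota nu.
Proof.
apply/ffunP => -[[i j] k]; rewrite !ffunE /=.
have [e|ne] := eqVneq (mu (i, j, k)) (nu (i, j, k)).
  rewrite e; have [->|/nu_homog ->] := eqVneq (nu (i, j, k)) 0.
    by rewrite rmorph0 mul0r.
  by rewrite subnn mulr1.
have lt := mu_lead ne; rewrite expr0n subn_eq0 leqNgt lt mulr0.
have [->|/nu_homog wk] := eqVneq (nu (i, j, k)) 0; first by rewrite rmorph0.
by rewrite wk ltnn in lt.
Qed.

Lemma weight_curve_orbit s : s != 0 -> sc_orbit (sc_map iota mu) (weight_curve s).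
Proof.
move=> s0; pose D := diag_mx (\row_k s ^+ wt k) : 'M[L]_d.
pose D' := diag_mx (\row_k s ^- wt k) : 'M[L]_d.
have DD' : D *m D' = 1%:M.
  rewrite mulmx_diag -diag_const_mx; congr diag_mx; apply/rowP => k; rewrite !mxE.
  by rewrite mulfV // expf_neq0.
have [Du _] := mulmx1_unit DD'; exists D => //.
have eD : invmx D = D' by rewrite -[LHS]mulmx1 -DD' mulmxA mulVmx // mul1mx.
apply/ffunP => -[[i j] k]; rewrite !ffunE /= eD !row_diag_mx sc_rightE.
rewrite sc_rightZ sc_right_delta -scalemxAl -scalemxAr -rowE mul_mx_diag !mxE ffunE.
have [->|/mu_wt_le le] := eqVneq (mu (i, j, k)) 0; first by rewrite rmorph0 !(mulr0, mul0r).
rewrite -{2}(subnK le) !exprD; set u := s ^+ (_ - _).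
by field; rewrite !expf_neq0.
Qed.

(** The weights define a one-parameter subgroup of GL, along which mu tends to
    nu when the parameter tends to 0. *)
Lemma weight_degeneration : Defs.in_alg nu -> (forall s : seq L, exists x, x \notin s) ->
  zariski_closure (sc_orbit (sc_map iota mu)) (sc_map iota nu).
Proof.
move=> nu_alg L_inf; split=> [|P P0]; first exact: in_alg_map.
(* q is P along the curve, a polynomial in the parameter. *)
pose q : {poly L} := \sum_(e <- msupp P) (P@_e)%:P * \prod_i
  (let p := enum_val i in
   (iota (mu p))%:P * 'X ^+ (wt p.2 - (wt p.1.1 + wt p.1.2))) ^+ e i.
have qE s : q.[s] = sc_eval P (weight_curve s).
  rewrite /sc_eval mevalE horner_sum; apply: eq_bigr => e _.
  rewrite hornerM hornerC horner_prod; congr (_ * _); apply: eq_bigr => i _.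
  by rewrite horner_exp hornerM hornerC hornerXn ffunE.
have q_root s : s != 0 -> root q s.
  by move=> s0; apply/rootP; rewrite qE; apply/P0/weight_curve_orbit.
have long n : exists r : seq L, [/\ uniq r, size r = n & 0 \notin r].
  elim: n => [|n [r [ur sr r0]]]; first by exists [::].
  have [x] := L_inf (0 :: r); rewrite inE negb_or => /andP[x0 xr].
  by exists (x :: r); rewrite /= xr ur sr inE negb_or eq_sym x0.
have q0 : q = 0.
  apply/eqP; apply: contraT => q_neq0; have [r [ur sr r0]] := long (size q).
  have := max_poly_roots q_neq0 _ ur; rewrite sr ltnn; apply.
  by apply/allP => s sr'; apply: q_root; apply: contraNneq r0 => <-.
by rewrite -weight_curve0 -qE q0 horner0.
Qed.

End WeightDegeneration.

(** * Weights with a strict inequality on every triangle *)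

Section Connectivity.
Variable R : ribbonQuiver.
Hypotheses (conn : connected_quiver R) (tri : triangulation R).
Local Notation f := (@rq_f R).
Local Notation g := (@rq_g R).

(** Connectedness of the quiver makes the group generated by f and g transitive
    on the arrows. *)
Lemma arrows_connected (P : pred (arr R)) a0 : P a0 ->
  (forall a, P a -> P (f a)) -> (forall a, P a -> P (g a)) -> forall a, P a.
Proof.
move=> Pa0 Pf Pg.
have Pbar a : P a -> P (rq_bar a) by move=> Pa; rewrite -g_ff //; apply/Pg/Pf/Pf.
pose A := [pred v : vert R | [forall b, (src b == v) ==> P b]].
have A_src a : P a -> A (src a).
  move=> Pa; apply/forallP => b; apply/implyP => /eqP sb.
  by have [->//|->] := src_eq sb; apply: Pbar.
have A_P a : A (src a) -> P a by move/forallP/(_ a); rewrite eqxx.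
have A_tgt a : A (tgt a) = A (src a).
  apply/idP/idP => h.
    by apply: A_src; rewrite -(tri a); apply/Pf/Pf/A_P; rewrite src_f.
  by rewrite -src_f; apply/A_src/Pf/A_P.
move=> a; apply: A_P; have [_ /(_ (src a0) (src a)) path_a] := conn.
have/closed_connect/(_ _ _ path_a) : closed (fun x y : vert R =>
    [exists a : arr R, ((src a == x) && (tgt a == y))
                    || ((src a == y) && (tgt a == x))]) A.
  move=> x y /existsP[b]; rewrite -!topredE /=.
  by case/orP => /andP[/eqP <- /eqP <-]; rewrite [LHS]A_tgt || rewrite [RHS]A_tgt.
by rewrite -!topredE /= => <-; apply: A_src.
Qed.

End Connectivity.

Section StrictWeights.
Variables (R : ribbonQuiver) (m : arr R -> nat).
Hypotheses (conn : connected_quiver R) (tri : triangulation R).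
Hypotheses (m_inv : g_invariant m) (m_adm : admissible m).
Local Notation f := (@rq_f R).
Local Notation g := (@rq_g R).
Local Notation len := (len m).
Implicit Types (W F : arr R -> nat) (a b : arr R).

Definition tri_sum W a : nat := (W a + W (f a) + W (f (f a)))%N.

Lemma tri_sum_f W a : tri_sum W (f a) = tri_sum W a.
Proof. by rewrite /tri_sum tri; lia. Qed.

Lemma sum_shift F a :
  (\sum_(i < len a) F (g (iter i g a)) = \sum_(i < len a) F (iter i g a))%N.
Proof.
rewrite -(len_predK m_adm a) big_ord_recr [RHS]big_ord_recl /= addnC.
by congr (_ + _)%N; rewrite -iterS len_predK // iter_len.
Qed.

(** Starting from the uniform weights, which are tight exactly on the f-orbits
    with m n = 3 throughout, weight is moved along a g-orbit from a tight
    f-orbit to a slack one; the factor 4 makes room for the integral move. *)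
Lemma strict_weights : (exists a, len a != 3%N) -> exists (W : arr R -> nat) M,
  [/\ forall a, (0 < W a)%N, balanced m W M &
      forall a, (W a + W (f a) + W (f (f a)) < M)%N].
Proof.
move=> [a3 len_a3].
have step n : forall W M, (forall a, (0 < W a)%N) -> balanced m W M ->
    (forall a, tri_sum W a <= M)%N -> (exists a, tri_sum W a < M)%N ->
    (#|[pred a | tri_sum W a == M]| <= n)%N ->
    exists W' M', [/\ forall a, (0 < W' a)%N, balanced m W' M' &
      forall a, (tri_sum W' a < M')%N].
  elim: n => [|n IH] W M W_gt0 W_bal W_le [a0 a0_slack] tight_n.
    exists W, M; split=> // a; rewrite ltn_neqAle W_le andbT.
    by apply: contraTN tight_n => tight_a; rewrite -ltnNge; apply/card_gt0P; exists a.
  have [b0 /eqP tight_b0|slack] := pickP [pred b | tri_sum W b == M]; last first.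
    by exists W, M; split=> // a; rewrite ltn_neqAle W_le andbT; apply/negbT/slack.
  have [b /andP[/eqP tight_b slack_gb]|closed] :=
      pickP [pred b | (tri_sum W b == M) && (tri_sum W (g b) != M)]; last first.
    have all_tight : forall a, tri_sum W a == M.
      apply: (@arrows_connected R conn tri (fun a => tri_sum W a == M) b0) => [|a|a ta].
      - exact/eqP.
      - by rewrite tri_sum_f.
      - by have := closed a; rewrite /= ta /= => /negbFE.
    by rewrite (eqP (all_tight a0)) ltnn in a0_slack.
  (* One unit of weight is moved from b to g b. *)
  pose ind (y x : arr R) : nat := x == y.
  pose W' x := (4 * W x + ind (g b) x - ind b x)%N.
  have W'E x : (W' x + ind b x = 4 * W x + ind (g b) x)%N.
    by rewrite /W' /ind; have := W_gt0 x; lia.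
  have sumE a : (tri_sum W' a + tri_sum (ind b) a
      = 4 * tri_sum W a + tri_sum (ind (g b)) a)%N.
    by have := W'E a; have := W'E (f a); have := W'E (f (f a)); rewrite /tri_sum; lia.
  have ind_le3 y a : (tri_sum (ind y) a <= 3)%N by rewrite /tri_sum /ind; lia.
  have tight0 a : tri_sum W a = M -> tri_sum (ind (g b)) a = 0%N.
    move=> ta; rewrite /tri_sum /ind.
    have ne x : tri_sum W x = M -> (x == g b) = false.
      by move=> tx; apply: contraNF slack_gb => /eqP <-; rewrite tx.
    by rewrite !ne ?tri_sum_f.
  have slack' a : (tri_sum W a < M)%N -> (tri_sum W' a < 4 * M)%N.
    by move=> sa; have := sumE a; have := ind_le3 (g b) a; lia.
  apply: (IH W' (4 * M)%N).
  - by move=> a; rewrite /W' /ind; have := W_gt0 a; lia.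
  - move=> a; apply: (@addIn (\sum_(i < len a) ind b (iter i g a))).
    rewrite -big_split /=; under eq_bigr => i _ do rewrite W'E.
    rewrite big_split -big_distrr /= W_bal; congr (_ + _)%N.
    rewrite -(sum_shift (ind (g b))); apply: eq_bigr => i _.
    by rewrite /ind (inj_eq (@rq_g_inj R)).
  - move=> a; have [/eqP ta|sa] := eqVneq (tri_sum W a) M.
      by have := sumE a; rewrite (tight0 _ (eqP ta)) (eqP ta); lia.
    by apply/ltnW/slack'; rewrite ltn_neqAle sa W_le.
  - by exists a0; apply: slack'.
  - rewrite -ltnS; apply: leq_trans tight_n; apply: proper_card.
    apply/properP; split.
      apply/subsetP => a; rewrite !inE; apply: contraLR => sa.
      by rewrite ltn_eqF // slack' // ltn_neqAle sa W_le.
    exists b; rewrite !inE ?tight_b //.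
    rewrite ltn_eqF //; have := sumE b; rewrite (tight0 _ tight_b) tight_b.
    by rewrite {2}/tri_sum {1}/ind eqxx; lia.
apply: (step _ (uniform_weight m) (tri_N m)) (leqnn _).
- exact: uniform_gt0.
- exact: uniform_balanced.
- exact: uniform_le.
- exists a3; have := uniform_le3 m_adm (f a3); have := uniform_le3 m_adm (f (f a3)).
  have := uniform_gt0 m_adm a3; have := divnK (len_dvd m a3); rewrite -/(uniform_weight m a3).
  have : (4 <= len a3)%N by rewrite ltn_neqAle eq_sym len_a3 (len_ge3 m_adm).
  by rewrite /tri_sum; nia.
Qed.

End StrictWeights.

(** * Triangulation quivers with m n = 3 *)

Lemma surj_bij (S T : Type) (h : S -> T) :
  injective h -> (forall y, exists x, h x = y) -> bijective h.
Proof.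
move=> inj surj; pose k y := projT1 (cid (surj y)).
have kK y : h (k y) = y by rewrite /k; case: cid.
by exists k => // x; apply: inj; rewrite kK.
Qed.

(** The vertices of a ribbon quiver are the orbits of bar, so that an
    isomorphism is determined by the arrows. *)
Lemma weighted_iso_arrows (R R' : ribbonQuiver) (m : arr R -> nat) (m' : arr R' -> nat)
    (h : arr R' -> arr R) : bijective h ->
  (forall x, h (rq_f x) = rq_f (h x)) ->
  (forall x y, src x = src y -> src (h x) = src (h y)) ->
  (forall x, m (h x) = m' x) -> weighted_iso m m'.
Proof.
move=> [k hK kK] h_f h_src h_m.
have h_bar x : h (rq_bar x) = rq_bar (h x).
  apply: rq_bar_unique; first by apply: h_src; rewrite src_bar.
  by move/(can_inj hK)/eqP; rewrite bar_neq.
have k_bar a : k (rq_bar a) = rq_bar (k a) by apply: (can_inj hK); rewrite h_bar !kK.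
have k_f a : k (rq_f a) = rq_f (k a) by apply: (can_inj hK); rewrite h_f !kK.
have k_src a b : src a = src b -> src (k a) = src (k b).
  by move=> /src_eq[->//|->]; rewrite k_bar src_bar.
pose phi0 v := src (k (arrow_at v)); pose psi0 v := src (h (arrow_at v)).
have phi0E a : phi0 (src a) = src (k a) by apply: k_src; rewrite src_arrow_at.
have psi0E x : psi0 (src x) = src (h x) by apply: h_src; rewrite src_arrow_at.
exists phi0, k; split=> [||a|//|a]; last by rewrite -h_m kK.
- exists psi0 => v; rewrite -(src_arrow_at v).
    by rewrite phi0E psi0E kK.
  by rewrite psi0E phi0E hK.
- by exists h.
- by rewrite phi0E -!src_f phi0E k_f.
Qed.

Section Classification.
Variables (R : ribbonQuiver) (m : arr R -> nat).
Hypotheses (conn : connected_quiver R) (tri : triangulation R).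
Hypothesis m_inv : g_invariant m.
Local Notation f := (@rq_f R).
Local Notation g := (@rq_g R).
Local Notation bar := (@rq_bar R).
Local Notation len := (len m).
Implicit Types (a b x y : arr R).

Lemma len3_g a : len a = 3%N -> g (g (g a)) = a.
Proof. by move=> e; rewrite -[RHS](iter_len m a) e. Qed.

Lemma len3_fixed a : len a = 3%N -> g a = a -> m a = 3%N.
Proof.
move=> + ga; rewrite /len; case: (rq_nP a) => n0 _ n_min.
have -> : rq_n a = 1%N.
  by apply/eqP; rewrite eqn_leq n0 andbT leqNgt; apply/negP => n1; apply: (n_min 1%N).
by rewrite muln1.
Qed.

Lemma len3_moved a : len a = 3%N -> g a != a -> m a = 1%N.
Proof.
move=> + /eqP ga; rewrite /len => e.
have n1 : rq_n a != 1%N.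
  by apply: contra_not_neq ga => n1; rewrite -[RHS](iter_n a) n1.
by move: e n1; case: (m a) (rq_n a) => [|[|[|[|k]]]] [|[|[|l]]] //; lia.
Qed.

Section MonogonCase.
Hypothesis len3 : forall a, len a = 3%N.
Variable x : arr R.
Hypothesis gx : g x = x.

Lemma monogon_case : weighted_iso m (monogon_m : arr punctured_monogon -> nat).
Proof.
pose y := bar x; pose z := f y; pose w := bar z.
have fx : f x = y by rewrite -[f x]rq_barK bar_f gx.
have fz : f z = x by rewrite /z -fx tri.
have gy : g y = w by [].
have gz : g z = y by rewrite /rq_g fz.
have gw : g w = z by apply: (@rq_g_inj R); rewrite gz -gy len3_g.
have fw : f w = w by rewrite -[f w]rq_barK bar_f gw.
have xy : y != x by rewrite bar_neq.
have zw : w != z by rewrite bar_neq.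
have zx : z != x by apply: contraNneq xy => e; rewrite -fx -{1}e fz.
have zy : z != y.
  by apply: contraNneq xy => e; apply/eqP/(@rq_f_inj R); rewrite fx -/z.
have wx : w != x.
  by apply: contraNneq zy => e; rewrite -[z]rq_barK -/w e.
have wy : w != y.
  by apply: contraNneq zx => e; rewrite -[z]rq_barK -/w e rq_barK.
pose t := [tuple x; y; z; w]; pose h (i : 'I_4) := tnth t i.
have all_t a : a \in t.
  apply: (@arrows_connected R conn tri (mem t) x) => [|b|b] /=.
  - by rewrite !inE eqxx.
  - rewrite !inE => /or4P[]/eqP->; rewrite ?fx ?fz ?fw -/z ?eqxx ?orbT //.
  - rewrite !inE => /or4P[]/eqP->; rewrite ?gx ?gy ?gz ?gw ?eqxx ?orbT //.
have ut : uniq t.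
  by rewrite /= !inE !negb_or eq_sym xy eq_sym zx eq_sym wx eq_sym zy eq_sym wy eq_sym zw.
apply: (@weighted_iso_arrows R punctured_monogon m monogon_m h).
- apply: surj_bij; first exact/tuple_uniqP.
  by move=> a; have /tnthP[i ->] := all_t a; exists i.
- by move=> i; rewrite /h; case: i => [[|[|[|[|]]]]] //= hi; rewrite !(tnth_nth x) /= ?fx ?fz ?fw.
- have sy : src y = src x by rewrite src_bar.
  have sw : src w = src z by rewrite src_bar.
  move=> i j; rewrite /h !(tnth_nth x).
  by case: i j => [[|[|[|[|]]]] //= hi] [[|[|[|[|]]]] //= hj] //; rewrite ?sy ?sw.
- move=> i; rewrite /h (tnth_nth x); case: i => [[|[|[|[|]]]]] //= hi.
  + exact: len3_fixed.
  + by apply: len3_moved => //; rewrite gy.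
  + by apply: len3_moved => //; rewrite gz eq_sym.
  + by apply: len3_moved => //; rewrite gw eq_sym.
Qed.

End MonogonCase.
Section LocalCondition.
Variable a : arr R.
Hypotheses (len_a : len a = 3%N) (len_ba : len (bar a) = 3%N)
  (len_fa : len (f a) = 3%N) (len_fba : len (f (bar a)) = 3%N).

(** The twelve arrows (i, j) of the tetrahedron, in g-cycles, and the
    permutations g and bar of their indices. *)
Definition tet_list : seq (nat * nat) :=
  [:: (0,1); (0,2); (0,3); (1,0); (1,3); (1,2); (2,0); (2,1); (2,3); (3,1); (3,0); (3,2)]%N.
Definition tet_gi (i : nat) : nat := nth 0%N [:: 1; 2; 0; 4; 5; 3; 7; 8; 6; 10; 11; 9]%N i.
Definition tet_bi (i : nat) : nat := nth 0%N [:: 3; 6; 10; 0; 9; 7; 1; 5; 11; 4; 2; 8]%N i.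

Definition tet_arrows : seq (arr R) :=
  [:: a; g a; g (g a); bar a; g (bar a); g (g (bar a));
      f a; g (f a); g (g (f a)); f (bar a); g (f (bar a)); g (g (f (bar a)))].
Local Notation h i := (nth a tet_arrows i).

Lemma tet_h_g i : (i < 12)%N -> h (tet_gi i) = g (h i).
Proof. by do 12?[case: i => [|i]]; rewrite //= ?len3_g. Qed.

Lemma tet_h_bar i : (i < 12)%N -> h (tet_bi i) = bar (h i).
Proof.
have e1 : f (f a) = g (g (bar a)) by apply: (@rq_g_inj R); rewrite g_ff // len3_g.
have e2 : f (f (bar a)) = g (g a).
  by apply: (@rq_g_inj R); rewrite g_ff // rq_barK len3_g.
have b2 : bar (g (g a)) = g (f (bar a)) by rewrite -e2.
have b5 : bar (g (g (bar a))) = g (f a) by rewrite -e1.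
have b11 : bar (g (g (f (bar a)))) = g (g (f a)).
  apply: (@rq_g_inj R); rewrite (len3_g len_fa) bar_g.
  have <- : f (g a) = g (f (bar a)) by rewrite -bar_g b2.
  by rewrite g_ff // bar_g.
have b8 : bar (g (g (f a))) = g (g (f (bar a))) by rewrite -b11 rq_barK.
by do 12?[case: i => [|i]]; rewrite //= ?rq_barK ?bar_g ?b2 ?b5 ?b8 ?b11 // -?b2 -?b5 ?rq_barK.
Qed.

Lemma tet_h_all x : exists2 i, (i < 12)%N & h i = x.
Proof.
have lt_g i : (i < 12)%N -> (tet_gi i < 12)%N by do 12?[case: i => [|i]].
have lt_b i : (i < 12)%N -> (tet_bi i < 12)%N by do 12?[case: i => [|i]].
suff : x \in tet_arrows by move/(nthP a).
move: x; apply: (@arrows_connected R conn tri (mem tet_arrows) a) => [|y|y] /=.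
- by rewrite inE eqxx.
- move/(nthP a) => [i i12 <-]; rewrite -[f _]rq_barK bar_f -tet_h_g // -tet_h_bar ?lt_g //.
  by apply: mem_nth; apply/lt_b/lt_g.
- by move/(nthP a) => [i i12 <-]; rewrite -tet_h_g //; apply/mem_nth/lt_g.
Qed.

Lemma tet_len3 x : len x = 3%N.
Proof.
have [i + <-] := tet_h_all x.
by do 12?[case: i => [|i]] => //= _; rewrite ?(len_g m_inv).
Qed.

Section NoFixedArrow.
Hypothesis g_free : forall x, g x != x.

(** Two indices are distinct if words in g and bar of length at most n move them to
    a pair related by g or by bar, neither of which fixes an arrow. *)
Fixpoint tet_clash n i j : bool :=
  [|| j == tet_bi i, j == tet_gi i, i == tet_gi j |
      if n is n'.+1 then tet_clash n' (tet_gi i) (tet_gi j)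
                         || tet_clash n' (tet_bi i) (tet_bi j) else false].

Lemma tet_clash_neq n i j : (i < 12)%N -> (j < 12)%N -> tet_clash n i j -> h i != h j.
Proof.
have lt_g k : (k < 12)%N -> (tet_gi k < 12)%N by do 12?[case: k => [|k]].
have lt_b k : (k < 12)%N -> (tet_bi k < 12)%N by do 12?[case: k => [|k]].
elim: n i j => [|n IH] i j i12 j12 /or4P[/eqP->|/eqP->|/eqP->|] //.
1,4: by rewrite tet_h_bar // eq_sym bar_neq.
1,3: by rewrite tet_h_g // eq_sym g_free.
1,2: by rewrite tet_h_g // g_free.
case/orP => /IH.
- by rewrite !lt_g // !tet_h_g // (inj_eq (@rq_g_inj R)); apply.
- by rewrite !lt_b // !tet_h_bar // (inj_eq (inv_inj (@rq_barK R))); apply.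
Qed.

Lemma tet_arrows_uniq : uniq tet_arrows.
Proof.
apply/(uniqP a) => i j i12 j12 e; apply: contra_eq e => ne.
(* Words of length at most 6 suffice. *)
apply: (@tet_clash_neq 6) => //.
have : all (fun i => all (fun j => (i != j) ==> tet_clash 6 i j) (iota 0 12)) (iota 0 12).
  by vm_compute.
move/allP/(_ i); rewrite mem_iota => /(_ i12)/allP/(_ j); rewrite mem_iota => /(_ j12).
by rewrite ne.
Qed.

Definition tet_index (p : tet_arr) : nat :=
  index (val (val p).1, val (val p).2) tet_list.

Lemma tet_index_lt p : (tet_index p < 12)%N.
Proof. by case: p => [[[[|[|[|[|]]]] //= hi] [[|[|[|[|]]]] //= hj]] ne]. Qed.
Lemma tet_index_g p : tet_index (tet_g p) = tet_gi (tet_index p).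
Proof. by case: p => [[[[|[|[|[|]]]] //= hi] [[|[|[|[|]]]] //= hj]] ne]. Qed.
Lemma tet_index_bar p : tet_index (tet_bar p) = tet_bi (tet_index p).
Proof. by case: p => [[[[|[|[|[|]]]] //= hi] [[|[|[|[|]]]] //= hj]] ne]. Qed.

Lemma tet_index_inj : injective tet_index.
Proof.
move=> p q e; apply/val_inj.
have mem_list (r : tet_arr) : (val (val r).1, val (val r).2) \in tet_list.
  by rewrite -index_mem; apply: tet_index_lt.
have := nth_index (0, 0)%N (mem_list p); rewrite -[index _ _]/(tet_index p) e.
rewrite (nth_index _ (mem_list q)) => -[e1 e2].
by rewrite [LHS]surjective_pairing [RHS]surjective_pairing; congr (_, _); apply: val_inj.
Qed.

Lemma tet_index_surj i : (i < 12)%N -> exists p, tet_index p = i.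
Proof.
move=> i12; have [[x y] p_mem <-] : exists2 p, p \in tet_list & index p tet_list = i.
  by exists (nth (0, 0)%N tet_list i); rewrite ?mem_nth ?index_uniq.
have /andP[/andP[x4 y4] xy] := allP (isT : all
  (fun p : nat * nat => (p.1 < 4)%N && (p.2 < 4)%N && (p.1 != p.2)) tet_list) _ p_mem.
by exists (exist (fun p : 'I_4 * 'I_4 => p.1 != p.2) (Ordinal x4, Ordinal y4) xy).
Qed.

Lemma tetrahedron_case : weighted_iso m ((fun=> 1%N) : arr tetrahedron -> nat).
Proof.
pose k (p : tet_arr) := h (tet_index p).
have k_bar p : k (tet_bar p) = bar (k p).
  by rewrite /k tet_index_bar tet_h_bar ?tet_index_lt.
have k_g p : k (tet_g p) = g (k p) by rewrite /k tet_index_g tet_h_g ?tet_index_lt.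
apply: (@weighted_iso_arrows R tetrahedron m (fun=> 1%N) k).
- apply: surj_bij.
    move=> p q /(uniqP a tet_arrows_uniq); rewrite !inE !tet_index_lt => e.
    by apply/tet_index_inj/e.
  move=> x; have [i i12 <-] := tet_h_all x.
  by have [p <-] := tet_index_surj i12; exists p.
- by move=> p; rewrite /rq_f /= /tet_f k_bar k_g -bar_f rq_barK.
- move=> p q epq; have [->|->] : p = q \/ p = tet_bar q := tet_src_eq epq.
    by [].
  by rewrite k_bar src_bar.
- by move=> p; apply: len3_moved (tet_len3 _) (g_free _).
Qed.

End NoFixedArrow.

(** The relations f^3 = g^3 = (f g^-1)^2 = 1 present the alternating group of
    degree 4, and bar acts freely: up to isomorphism there are only the regular
    action and the action on four points. *)
Lemma local_exceptional : exceptional m.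
Proof.
have [x /eqP gx|free] := pickP (fun x : arr R => g x == x).
  by left; apply: (monogon_case tet_len3 gx).
by right; apply: tetrahedron_case => x; rewrite free.
Qed.

End LocalCondition.
End Classification.

(** * The completed algebra *)

Section Near.
Variables (K : fieldType) (Q : quiver) (J : ideal (path_alg K Q)).
Implicit Types (x y : path_alg K Q).

(** J plus the n-th power of the arrow ideal. *)
Definition near_pred n x : Prop :=
  exists2 y, J y & forall p, (plen p < n)%N -> pcoef x p = pcoef y p.

Lemma near_0 n : near_pred n 0.
Proof. by exists 0 => //; apply: ideal_0. Qed.
Lemma near_D n x y : near_pred n x -> near_pred n y -> near_pred n (x + y).
Proof.
move=> [x' Jx ex] [y' Jy ey]; exists (x' + y'); first exact: ideal_D.
by move=> p pn; rewrite !pcoefD ex // ey.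
Qed.
Lemma near_Ml n z x : near_pred n x -> near_pred n (z * x).
Proof.
move=> [x' Jx ex]; exists (z * x'); first exact: ideal_Ml.
move=> p pn; rewrite !pcoefM; apply: eq_bigr => i _; rewrite ex // plen_drop.
exact: leq_ltn_trans (leq_subr _ _) pn.
Qed.
Lemma near_Mr n z x : near_pred n x -> near_pred n (x * z).
Proof.
move=> [x' Jx ex]; exists (x' * z); first exact: ideal_Mr.
move=> p pn; rewrite !pcoefM; apply: eq_big_nat => i /andP[_ ip].
by rewrite ex // plen_take //; apply: leq_ltn_trans pn.
Qed.
Definition near n : ideal (path_alg K Q) :=
  Ideal (near_0 n) (near_D (n := n)) (near_Ml (n := n)) (near_Mr (n := n)).

Lemma near_in n x : J x -> near n x. Proof. by exists x. Qed.
Lemma near0 x : near 0 x. Proof. by exists 0 => //; apply: ideal_0. Qed.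

Lemma pcoef_arr (a : arr Q) p : plen p != 1%N -> pcoef (arr_elt K a) p = 0.
Proof.
move=> p1; rewrite arr_word pcoef_word; case: eqP => // e.
by move: p1; rewrite /plen e.
Qed.

Lemma near_arrl n (a : arr Q) x : near n x -> near n.+1 (arr_elt K a * x).
Proof.
move=> [y Jy e]; exists (arr_elt K a * y); first exact: ideal_Ml.
move=> p pn; rewrite !pcoefM; apply: eq_big_nat => i /andP[_ ip].
case: i ip => [|i] ip; first by rewrite pcoef_arr ?mul0r // plen_take.
by rewrite e // plen_drop; lia.
Qed.

Lemma near_arrr n (a : arr Q) x : near n x -> near n.+1 (x * arr_elt K a).
Proof.
move=> [y Jy e]; exists (y * arr_elt K a); first exact: ideal_Mr.
move=> p pn; rewrite !pcoefM; apply: eq_big_nat => i /andP[_ ip].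
have [->|ne] := eqVneq i (plen p); last by rewrite e // plen_take //; lia.
by rewrite pcoef_arr ?mulr0 // plen_drop subnn.
Qed.

End Near.

Section Closure.
Variables (K : fieldType) (R : ribbonQuiver).
Variables (m : arr R -> nat) (c : arr R -> K) (lam : f_fixed R -> K).
Hypotheses (m_gt0 : forall a, (0 < m a)%N) (m_inv : g_invariant m)
  (m_adm : admissible m) (tri : triangulation R) (c_neq0 : forall a, c a != 0)
  (c_inv : g_invariant c).
Local Notation f := (@rq_f R).
Local Notation g := (@rq_g R).
Local Notation bar := (@rq_bar R).
Local Notation x_ a := (arr_elt K a).
Local Notation len := (len m).
Local Notation gp := (gpath K).
Local Notation lamx := (lam_ext lam).
Implicit Types (a b e : arr R).

Definition tri_ideal : ideal (path_alg K R) := gen_ideal (triangulation_rel m c lam).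
Local Notation J := tri_ideal.

Lemma tri_ideal_turn a : J (x_ a * x_ (f a) - lamx a *' x_ a ^+ 3
  - c (bar a) *' gp (bar a) (len (bar a)).-1).
Proof.
apply: gen_ideal_in; rewrite -omega'_len //.
have [fa|fa] := boolP (f a == a).
  have fb : f (bar (bar a)) == bar (bar a) by rewrite rq_barK.
  have := TriRelFixed m c lam fb; rewrite -lam_extE !rq_barK.
  by rewrite expr2 (eqP fa).
have := @TriRel K R m c lam (bar a); rewrite !rq_barK => /(_ fa).
by rewrite lam_ext0 // alg_scale0 subr0.
Qed.

Section Quotient.
Variable V : ideal (path_alg K R).
Hypothesis JV : forall x, J x -> V x.

Definition vpi : {rmorphism path_alg K R -> quot_alg V} := @quot_pi (path_alg K R) V.
Lemma vpiZ (z : K) x : vpi (z *' x) = z *' vpi x. Proof. exact: quot_piZ. Qed.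
Lemma vpi0P x : vpi x = 0 <-> V x. Proof. exact: quot_pi0P. Qed.

Lemma vpi_turn a : vpi (x_ a) * vpi (x_ (f a)) =
  lamx a *' vpi (x_ a) ^+ 3 + c (bar a) *' vpi (gp (bar a) (len (bar a)).-1).
Proof.
have /JV/vpi0P := tri_ideal_turn a.
rewrite !rmorphB !vpiZ rmorphM rmorphXn /= -addrA -opprD => /eqP.
by rewrite subr_eq0 => /eqP.
Qed.

(** Both sides are equal to the product around the f-orbit of a. *)
Lemma vpi_commut a :
  c a *' vpi (gp a (len a)) = c (bar a) *' vpi (gp (bar a) (len (bar a))).
Proof.
pose u := vpi (x_ a) * vpi (x_ (f a)) * vpi (x_ (f (f a))).
have e1 : u = lamx a *' vpi (x_ a) ^+ 3 * vpi (x_ (f (f a)))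
            + c (bar a) *' vpi (gp (bar a) (len (bar a))).
  rewrite /u vpi_turn mulrDl (alg_scaleAl (c _)) -[X in _ = _ + _ *' vpi (gp _ X)](len_predK m_adm).
  by rewrite gpathS (iter_last_bar m_adm tri) rmorphM.
have e2 : u = vpi (x_ a) * (lamx (f a) *' vpi (x_ (f a)) ^+ 3) + c a *' vpi (gp a (len a)).
  rewrite /u -mulrA vpi_turn mulrDr bar_f (alg_scaleAr (c _)) c_inv len_g //.
  by rewrite -rmorphM -gpathSl len_predK.
have [fa|fa] := eqVneq (f a) a; last first.
  move: e1 e2; rewrite lam_ext0 // lam_ext0 ?(inj_eq (@rq_f_inj R)) //.
  by rewrite !alg_scale0 mul0r mulr0 !add0r => -> ->.
move: e1 e2; rewrite !fa alg_scaleAl alg_scaleAr -exprS -exprSr => ->.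
by move/addrI.
Qed.

End Quotient.

Definition fg a : path_alg K R := x_ a * x_ (f a) * x_ (g (f a)).
Definition gf a : path_alg K R := x_ a * x_ (g a) * x_ (f (g a)).

Section Step.
Variable n : nat.
Hypotheses (fg_n : forall a, near J n (fg a)) (gf_n : forall a, near J n (gf a)).
Local Notation V := (near J n.+1).
Local Notation pi := (vpi V).

(** The turn at a is replaced by a g-path which, followed by the last arrow of
    fg a, ends in gf of some arrow; that arrow is bar a if the g-path has length
    2. Otherwise gf is preceded by an arrow. *)
Lemma fg_step a : (len (bar a) = 3%N -> V (gf (bar a))) -> V (fg a).
Proof.
move=> h; have JV := @near_in K R J n.+1.
apply/vpi0P; rewrite /fg !rmorphM vpi_turn // mulrDl !alg_scaleAl.
have -> : lamx a *' (pi (x_ a) ^+ 3 * pi (x_ (g (f a)))) = 0.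
  have [fa|fa] := eqVneq (f a) a; last by rewrite lam_ext0 // alg_scale0.
  have /vpi0P : V (x_ a * fg a) by apply: near_arrl.
  by rewrite /fg !rmorphM !fa !exprS mulr1 -!mulrA => ->; rewrite alg_scaler0.
rewrite add0r -rmorphM -vpiZ; apply/vpi0P/ideal_scale.
have l3 := len_ge3 m_adm (bar a); pose l := (len (bar a) - 3)%N.
have el : (len (bar a)).-1 = l.+2 by rewrite /l; lia.
have -> : gp (bar a) (len (bar a)).-1 * x_ (g (f a))
    = gp (bar a) l * gf (iter l g (bar a)).
  have := iter_last_bar m_adm tri a; rewrite el !gpathS -!mulrA /gf -!mulrA !iterS => e.
  by rewrite -(bar_g (g (iter l g (bar a)))) e.
have : l = (len (bar a) - 3)%N by [].
case: l {el} => [|l] el; first by apply: ideal_Ml; apply: h; lia.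
by rewrite gpathSl -mulrA; apply: near_arrl; apply: ideal_Ml.
Qed.

Lemma gf_step a : (len (f a) = 3%N -> V (fg a)) -> V (gf a).
Proof.
move=> h; have JV := @near_in K R J n.+1.
apply/vpi0P; rewrite /gf !rmorphM -mulrA vpi_turn // mulrDr !alg_scaleAr bar_g.
have -> : lamx (g a) *' (pi (x_ a) * pi (x_ (g a)) ^+ 3) = 0.
  have [fa|fa] := eqVneq (f (g a)) (g a); last by rewrite lam_ext0 // alg_scale0.
  have /vpi0P : V (gf a * x_ (g a)) by apply: near_arrr.
  by rewrite /gf !rmorphM !fa !exprS mulr1 -!mulrA => ->; rewrite alg_scaler0.
rewrite add0r -rmorphM -vpiZ; apply/vpi0P/ideal_scale.
have l3 := len_ge3 m_adm (f a); pose l := (len (f a) - 3)%N.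
have el : (len (f a)).-1 = l.+2 by rewrite /l; lia.
have -> : x_ a * gp (f a) (len (f a)).-1 = fg a * gp (g (g (f a))) l.
  by rewrite el !gpathSl /fg !mulrA.
have : l = (len (f a) - 3)%N by [].
case: l {el} => [|l] el; first by apply: ideal_Mr; apply: h; lia.
by rewrite gpathS mulrA; apply: near_arrr; apply: ideal_Mr.
Qed.

End Step.

Hypothesis not_local3 : forall a, ~ [/\ len a = 3%N, len (bar a) = 3%N,
  len (f a) = 3%N & len (f (bar a)) = 3%N].

(** The steps fg a -> gf (bar a) -> fg (bar a) -> gf a -> fg a form a loop, in
    which some step lengthens the path unless all four lengths are 3. *)
Lemma fg_gf_near n a : near J n (fg a) /\ near J n (gf a).
Proof.
elim: n a => [|n IH] a; first by split; apply: near0.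
have fg_n b := (IH b).1; have gf_n b := (IH b).2.
have fg_S b : near J n.+1 (fg b).
  apply: (fg_step fg_n gf_n) => l1; apply: (gf_step fg_n gf_n) => l2.
  apply: (fg_step fg_n gf_n); rewrite rq_barK => l3; apply: (gf_step fg_n gf_n) => l4.
  by case: (@not_local3 b).
by split=> //; apply: (gf_step fg_n gf_n).
Qed.

Lemma vpi_gf n a : vpi (near J n) (x_ a) * vpi (near J n) (x_ (g a))
  * vpi (near J n) (x_ (f (g a))) = 0.
Proof. by rewrite -!rmorphM; apply/vpi0P; case: (fg_gf_near n a). Qed.

Lemma vpi_cube n a : f a = a -> vpi (near J n) (x_ a) ^+ 3
  = lamx a *' vpi (near J n) (x_ a) ^+ 4
  + c (bar a) *' vpi (near J n) (gp (bar a) (len (bar a))).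
Proof.
move=> fa; have := vpi_turn (@near_in K R J n) a; rewrite fa => e.
rewrite exprSr expr2 e mulrDl !alg_scaleAl -exprSr; congr (_ + _ *' _).
rewrite -[X in _ = vpi _ (gp _ X)](len_predK m_adm) gpathS.
by rewrite (iter_last_bar m_adm tri) rmorphM !fa.
Qed.

(** A loop x fixed by f satisfies x^4 = lam x^5 up to a multiple of some gf, which
    lies in J plus every power of the arrow ideal. *)
Lemma near_fourth n a : f a = a -> near J n (x_ a ^+ 4).
Proof.
move=> fa; elim: n => [|n IH]; first exact: near0.
apply/vpi0P; rewrite rmorphXn exprSr vpi_cube // mulrDl !alg_scaleAl.
have /vpi0P := near_arrl a IH; rewrite rmorphM rmorphXn -exprS -exprSr => ->.
rewrite alg_scaler0 add0r; have l3 := len_ge3 m_adm (bar a).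
have e := iter_last_bar m_adm tri a; rewrite !fa in e.
have el : len (bar a) = ((len (bar a)) - 2).+2 by lia.
rewrite el in e *; rewrite !gpathS !rmorphM -!mulrA.
rewrite /= in e; rewrite iterS e.
have := vpi_gf n.+1 (iter (len (bar a) - 2) g (bar a)); rewrite e fa -mulrA => ->.
by rewrite mulr0 alg_scaler0.
Qed.

Local Notation I := (turn_ideal m c (fun=> 1) lamx).

Lemma turn_in_near n x : I x -> near J n x.
Proof.
apply: gen_ideal_min => {}x; case=> a; apply/vpi0P.
- rewrite !rmorphB rmorphM !vpiZ vpi_turn; last exact: near_in.
  rewrite mul1r addrK; have [fa|fa] := eqVneq (f a) a; last first.
    by rewrite lam_ext0 // mul0r !alg_scale0 subrr.
  rewrite vpi_cube // -rmorphXn; have /vpi0P -> := near_fourth n fa.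
  by rewrite alg_scaler0 add0r alg_scaleA subrr.
- by apply/vpi0P; case: (fg_gf_near n a).
- by rewrite rmorphB !vpiZ vpi_commut ?subrr //; apply: near_in.
Qed.

Local Notation tpi := (tpi m c (fun=> 1) lamx).

Lemma tpi_cube a : f a = a ->
  tpi (x_ a) ^+ 3 = c (bar a) *' tpi (gp (bar a) (len (bar a))).
Proof.
move=> fa; have := tpi_turn m c (fun=> 1) lamx a; rewrite fa mul1r => e.
rewrite exprSr expr2 e mulrDl !alg_scaleAl tpi_socle // alg_scaler0 addr0.
rewrite -[X in _ = _ *' tpi (gp _ X)](len_predK m_adm) gpathS.
by rewrite (iter_last_bar m_adm tri) rmorphM !fa.
Qed.

Lemma tri_in_turn x : J x -> I x.
Proof.
apply: gen_ideal_min => {}x hx; apply/tpi0P; case: hx => {x} [a fa|a fa].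
- have := tpi_turn m c (fun=> 1) lamx (bar a); rewrite rq_barK mul1r lam_ext0 //.
  rewrite mul0r alg_scale0 addr0 => e.
  by rewrite omega'_len // rmorphB rmorphM tpiZ e subrr.
- have := tpi_turn m c (fun=> 1) lamx (bar a); rewrite rq_barK mul1r (eqP fa) => e.
  rewrite omega'_len // !rmorphB !tpiZ !rmorphXn /= expr2 e.
  rewrite tpi_cube ?(eqP fa) // rq_barK -lam_extE alg_scaleA.
  by rewrite addrK subrr.
Qed.

End Closure.

Section Truncation.
Variables (K : fieldType) (Q : quiver).
Local Notation A := (path_alg K Q).
Local Notation Ahat := (complete_path_alg K Q).

Lemma trunc_fin n (y : cpath K Q) :
  ((fun p => if (plen p < n)%N then y p else 0) : cpath K Q) \in @finitely_supported K Q.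
Proof.
apply/finitely_supportedP.
exists (pmap insub [seq (u.1, val u.2) | u <- enum {: vert Q * {bseq n of arr Q}}]) => p.
case: ifP => // pn; case/negP; rewrite mem_pmap_sub.
apply/mapP; exists ((val p).1, Bseq (ltnW pn)); first by rewrite mem_enum.
by rewrite -surjective_pairing.
Qed.

Definition trunc n (y : Ahat) : A :=
  exist (fun x : cpath K Q => x \in @finitely_supported K Q) _ (trunc_fin n y).

Lemma pcoef_trunc n y p : pcoef (trunc n y) p = if (plen p < n)%N then (y : cpath K Q) p else 0.
Proof. by []. Qed.

Definition emb (x : A) : Ahat := val (x : Defs.fpath K Q).
Lemma embE x p : (emb x : cpath K Q) p = pcoef x p. Proof. by []. Qed.
Lemma embB : zmod_morphism emb. Proof. by []. Qed.
Lemma embM : monoid_morphism emb. Proof. by []. Qed.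
HB.instance Definition _ := GRing.isZmodMorphism.Build A Ahat emb embB.
HB.instance Definition _ := GRing.isMonoidMorphism.Build A Ahat emb embM.

Lemma trunc_emb n x p : (plen p < n)%N -> pcoef (trunc n (emb x)) p = pcoef x p.
Proof. by rewrite pcoef_trunc => ->. Qed.

Lemma trunc_mul n (y z : Ahat) p : (plen p < n)%N ->
  pcoef (trunc n (y * z)) p = pcoef (trunc n y * trunc n z) p.
Proof.
move=> pn; rewrite pcoefM pcoef_trunc pn [LHS]/GRing.mul /= /cp_mul.
apply: eq_big_nat => i /andP[_ ip]; rewrite !pcoef_trunc plen_drop plen_take //.
by rewrite (leq_ltn_trans _ pn) // (leq_ltn_trans (leq_subr _ _) pn).
Qed.

Variables (I : ideal A) (L : nat).
Hypothesis long_word : forall v w, (L <= size w)%N -> I (word_elt K v w).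

Lemma long_elt x : (forall p, (plen p < L)%N -> pcoef x p = 0) -> I x.
Proof.
move=> hx; have [s us hs] := fin_supp x; rewrite (path_decomp us hs).
apply: ideal_sum => p; have [pL|pL] := ltnP (plen p) L.
  by rewrite hx // alg_scale0; apply: ideal_0.
by apply: ideal_scale; rewrite path_word; apply: long_word.
Qed.

Lemma eq_quot_short x y : (forall p, (plen p < L)%N -> pcoef x p = pcoef y p) ->
  @quot_pi A I x = @quot_pi A I y.
Proof. by move=> h; apply/quot_eqP/long_elt => p pL; rewrite pcoefB h ?subrr. Qed.

Definition trunc_pi (y : Ahat) : quot_alg I := @quot_pi A I (trunc L y).

Lemma trunc_piB : zmod_morphism trunc_pi.
Proof.
move=> y z; rewrite /trunc_pi -rmorphB; congr quot_pi; apply: pcoefP => p.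
by rewrite pcoefB !pcoef_trunc; case: ifP => // _; rewrite subr0.
Qed.
Lemma trunc_piM : monoid_morphism trunc_pi.
Proof.
split; first by rewrite -(rmorph1 (@quot_pi A I)); apply: eq_quot_short => p pL;
  rewrite pcoef_trunc pL.
move=> y z; rewrite /trunc_pi -rmorphM; apply: eq_quot_short => p.
exact: trunc_mul.
Qed.
HB.instance Definition _ := GRing.isZmodMorphism.Build Ahat (quot_alg I) trunc_pi trunc_piB.
HB.instance Definition _ := GRing.isMonoidMorphism.Build Ahat (quot_alg I) trunc_pi trunc_piM.

Lemma trunc_piZ a y : trunc_pi (a *' y) = a *' trunc_pi y.
Proof.
rewrite /trunc_pi -quot_piZ; congr quot_pi; apply: pcoefP => p.
by rewrite pcoefZ !pcoef_trunc; case: ifP => _; rewrite ?mulr0 //; apply: cp_strMl.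
Qed.

Lemma trunc_pi_emb x : trunc_pi (emb x) = @quot_pi A I x.
Proof. by apply: eq_quot_short => p; apply: trunc_emb. Qed.

(** If the ideal of the path algebra contains all long paths and lies in the
    closure of the given relations, completing does not change the quotient. *)
Lemma completion_iso (S : A -> Prop) :
  (forall x, S x -> I x) -> (forall n x, I x -> near (gen_ideal S) n x) ->
  alg_iso (quot_alg (A := Ahat)
    (closure_ideal (gen_ideal (fun y : Ahat => exists2 x : A, S x & y = emb x))))
    (quot_alg I).
Proof.
move=> SI I_near; set J := gen_ideal _.
have J_emb x : gen_ideal S x -> J (emb x).
  apply: (@gen_ideal_min _ _ (pullback (emb : {rmorphism A -> Ahat}) J)) => {}x Sx.
  by apply: gen_ideal_in; exists x.
have J_ker y : J y -> trunc_pi y = 0.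
  apply: (@gen_ideal_min _ _ (pullback (trunc_pi : {rmorphism Ahat -> quot_alg I})
    (zero_ideal (quot_alg I)))) => {}y [x Sx ->].
  by change (trunc_pi (emb x) = 0); rewrite trunc_pi_emb; apply/quot_pi0P/SI.
apply: (@first_iso _ _ _ _ (trunc_pi : {rmorphism Ahat -> quot_alg I})) => [a y|u|y].
- exact: trunc_piZ.
- by exists (emb (@quot_repr A I u)); rewrite /= trunc_pi_emb quot_reprK.
split=> /= [/quot_pi0P Iy n|cl_y].
  (* The truncation at L is in I, but agrees with y only up to L. *)
  have It : I (trunc (maxn L n) y).
    apply/quot_pi0P; rewrite -[RHS](iffRL (quot_pi0P _ _) Iy); apply: eq_quot_short => p pL.
    by rewrite !pcoef_trunc pL leq_max pL.
  have [x Sx ex] := I_near n _ It; exists (emb x); first exact: J_emb.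
  by move=> p pn; rewrite embE -ex // pcoef_trunc leq_max pn orbT.
have [z Jz ez] := cl_y L; rewrite -[RHS](J_ker z Jz); apply: eq_quot_short => p pL.
by rewrite !pcoef_trunc pL ez.
Qed.

End Truncation.

(** * Conclusion *)

Section Assembly.
Variables (K : fieldType) (R : ribbonQuiver).
Variables (m : arr R -> nat) (c : arr R -> K) (lam : f_fixed R -> K).
Hypotheses (conn : connected_quiver R) (tri : triangulation R)
  (m_gt0 : forall a, (0 < m a)%N) (m_inv : g_invariant m) (m_adm : admissible m)
  (c_neq0 : forall a, c a != 0) (c_inv : g_invariant c) (m_nonexc : ~ exceptional m).
Local Notation f := (@rq_f R).
Local Notation bar := (@rq_bar R).
Local Notation len := (len m).
Local Notation lamx := (lam_ext lam).
Local Notation one := (fun _ : arr R => 1 : K).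
Local Notation zero := (fun _ : arr R => 0 : K).

Lemma not_local3 a : ~ [/\ len a = 3%N, len (bar a) = 3%N,
  len (f a) = 3%N & len (f (bar a)) = 3%N].
Proof. by case=> l1 l2 l3 l4; apply: m_nonexc; apply: (local_exceptional conn tri m_inv l1 l2). Qed.

Lemma exists_strict_weights : exists (W : arr R -> nat) M,
  [/\ forall a, (0 < W a)%N, balanced m W M &
      forall a, (W a + W (f a) + W (f (f a)) < M)%N].
Proof.
apply: strict_weights => //; have [/card_gt0P[v _] _] := conn.
have [a len_a|len3] := pickP (fun a => len a != 3%N); first by exists a.
have {}len3 a : len a = 3%N by apply/eqP; have /= /negbFE := len3 a.
by case: (@not_local3 (arrow_at v)).
Qed.

Lemma sigma_lam a : f a != a -> lamx a = 0. Proof. exact: lam_ext0. Qed.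
Definition sigma_zero a (_ : f a != a) : zero a = 0 := erefl.

Lemma triangulation_turn_iso :
  alg_iso (triangulation_alg m c lam) (turn_alg m c one lamx).
Proof.
have [W [M [W_gt0 W_bal W_lt]]] := exists_strict_weights.
apply: (@completion_iso K R (turn_ideal m c one lamx) M.+1 _ (triangulation_rel m c lam)).
- move=> v w Mw; exact: (long_word_in_ideal m_adm tri c_neq0 sigma_lam W_gt0 W_bal W_lt).
- by move=> x rel_x; apply: tri_in_turn => //; apply: gen_ideal_in.
- by move=> n x; apply: turn_in_near => //; apply: not_local3.
Qed.

Lemma deform1_turn_iso : alg_iso (deform_alg m c lam 1) (turn_alg m c one lamx).
Proof. by apply: eq_ideal_iso => x; apply: deform1_turn. Qed.

Lemma deform1_iso : alg_iso (deform_alg m c lam 1) (triangulation_alg m c lam).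
Proof. exact: alg_iso_trans deform1_turn_iso (alg_iso_sym triangulation_turn_iso). Qed.

Lemma brauer_degeneration :
  degeneration (triangulation_alg m c lam) (brauer_graph_alg m c).
Proof.
have [W [M [W_gt0 W_bal W_lt]]] := exists_strict_weights.
have lead := turn_sc_leading c one m_adm tri sigma_lam W_bal W_lt.
have mu_pres := turn_sc_presents m_inv m_adm tri c_neq0 c_inv
  (fun _ : arr R => erefl (1 : K)) sigma_lam.
have nu_pres := turn_sc_presents m_inv m_adm tri c_neq0 c_inv
  (fun _ : arr R => erefl (0 : K)) sigma_zero.
exists #|turn_basis m|, (turn_sc c one m_adm tri sigma_lam), (turn_sc c zero m_adm tri sigma_zero).
split.
- exact: presents_in_alg mu_pres.
- exact: presents_in_alg nu_pres.
- exact: presents_iso (alg_iso_sym triangulation_turn_iso) mu_pres.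
- apply: presents_iso nu_pres; apply: eq_ideal_iso => x; apply: iff_sym.
  exact: brauer_turn.
- move=> L iota L_inf; apply: (@weight_degeneration K #|turn_basis m| (ord_wt W M)) => //.
  + by move=> i j k; have [+ _] := lead i j k.
  + by move=> i j k; have [_ +] := lead i j k.
  + exact: presents_in_alg nu_pres.
Qed.

End Assembly.

Theorem proposition7p13 (K : fieldType) (R : ribbonQuiver)
    (m : arr R -> nat) (c : arr R -> K) (lam : f_fixed R -> K)
    (Rconnected : connected_quiver R) (Rtriangulation : triangulation R)
    (m_gt0 : forall a, (0 < m a)%N) (m_inv : g_invariant m)
    (m_adm : admissible m)
    (c_neq0 : forall a, c a != 0) (c_inv : g_invariant c)
    (m_nonexc : ~ exceptional m) :
  [/\ (* the numbers N e_a and N e'_a are natural, and the latter positive *)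
      (forall a : arr R, (tri_N m)%:R * tri_e m a \is a Num.nat) /\
      (forall a : arr R, rq_f a = a ->
         (tri_N m)%:R * tri_e' m a \is a Num.nat /\
         0 < (tri_N m)%:R * tri_e' m a),
      (* (a): positivity of the N e_a is needed here, and it can fail *)
      (forall a : arr R, 0 < (tri_N m)%:R * tri_e m a) ->
        alg_iso (deform_alg m c lam 0) (brauer_graph_alg m c),
      (* (b) *)
      alg_iso (deform_alg m c lam 1) (triangulation_alg m c lam),
      (* (c) *)
      forall t : K, t != 0 ->
        (exists phi : {rmorphism path_alg K R -> path_alg K R},
           [/\ bijective phi,
               forall (a : K) (x : path_alg K R), phi (a *' x) = a *' phi x,
               forall v : vert R, phi (triv_elt K v) = triv_elt K v,
               forall a : arr R,
                 phi (arr_elt K a)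
                 = t ^+ (tri_N m %/ (m a * rq_n a)) *' arr_elt K a &
               forall y : path_alg K R,
                 deform_ideal m c lam t y <->
                 exists2 x, deform_ideal m c lam 1 x & y = phi x]) /\
        alg_iso (deform_alg m c lam t) (triangulation_alg m c lam) &
      (* (d) *)
      degeneration (triangulation_alg m c lam) (brauer_graph_alg m c)].
Proof.
have iso1 : alg_iso (deform_alg m c lam 1) (triangulation_alg m c lam).
  exact: deform1_iso.
split.
- split=> [a|a _]; first by rewrite tri_eE // natr_nat.
  by rewrite tri_e'E // natr_nat ltr0n tri_Ne'_gt0.
- exact: deform0_iso.
- exact: iso1.
- move=> t t0; split; last exact: alg_iso_trans (alg_iso_sym (deform_iso _ _ _ _ _ _ t0)) iso1.
  have [FZ Fv Fa] := rescalingP (fun a : arr R => t ^+ uniform_weight m a).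
  exists (rescaling (fun a => t ^+ uniform_weight m a)); split=> //.
  + by apply: rescaling_bij => a; rewrite expf_neq0.
  + by move=> y; apply: deform_rescaling.
- exact: brauer_degeneration.
Qed.
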